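(* Let $G$ be an abelian group and $n\ge0$. Then there is an isomorphism of groups $$H^n(K^2,G)\cong\begin{cases}H^n(\mathbb RP^2,G)&n\ne1\\ G\times H^1(\mathbb RP^2,G)&n=1,\end{cases}$$ where $K^2$ is the Klein bottle.
   Context: We work in Homotopy Type Theory (as in the HoTT Book). The real projective plane $\mathbb RP^2$ is the higher inductive type generated by a point $\star$, a path $\ell:\star=\star$ and a path $\mathsf{sq}:\ell^{-1}=\ell$. The Klein bottle $K^2$ is the higher inductive type generated by a point $\star$, paths $\ell_1,\ell_2:\star=\star$ and a filler of the square whose top and bottom sides are $\ell_2$ (left to right), whose right side is $\ell_1$ (bottom to top) and whose left side is $\ell_1$ (top to bottom); equivalently a path $\ell_1\cdot\ell_2\cdot\ell_1=\ell_2$. $\Sigma A$ is the suspension, with constructors $\mathsf{north},\mathsf{south}$ and $\mathsf{merid}\,a:\mathsf{north}=\mathsf{south}$ for $a:A$. $\|A\|_n$ is the $n$-truncation, with canonical elements $|a|$. Eilenberg-MacLane spaces. For an abelian group $G$, $\widetilde K(G,1)$ is the higher inductive type generated by a point $\star$, a path $\mathsf{loop}_k\,g:\star=\star$ for every $g:G$, and for all $g_1,g_2:G$ a filler witnessing $\mathsf{loop}_k\,g_1\cdot\mathsf{loop}_k\,g_2=\mathsf{loop}_k(g_1+g_2)$. For $n>1$, $\widetilde K(G,n):=\Sigma\,\widetilde K(G,n-1)$. The basepoint $0_k$ of $\widetilde K(G,n)$ is $\star$ if $n=1$ and $\mathsf{north}$ if $n>1$. $K(G,0):=G$ with basepoint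 $0_G$, and $K(G,n):=\|\widetilde K(G,n)\|_n$ with basepoint $|0_k|$ for $n\ge1$; all basepoints are written $0_k$. Addition. $+_k:K(G,n)\times K(G,n)\to K(G,n)$ is the addition of $G$ for $n=0$. For $n\ge1$ it is induced from $\widetilde K(G,n)\times\widetilde K(G,n)\to K(G,n)$: for $n=1$ by $\star+_ky:=y$ and $\mathsf{ap}_{\_+_k\star}(\mathsf{loop}_k\,g):=\mathsf{loop}_k\,g$ (the action on a pair of loops is a filler of the square with horizontal sides $\mathsf{loop}_k\,g_1$ and vertical sides $\mathsf{loop}_k\,g_2$; the rest is determined since $K(G,1)$ is $1$-truncated); for $n\ge2$ it is the unique map with $x+_k0_k:=x$ and $0_k+_ky:=y$, these agreeing by $\mathsf{refl}$ at $(0_k,0_k)$. Cohomology. $H^n(X,G):=\|X\to K(G,n)\|_0$, an abelian group under pointwise $+_k$. *)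

(* Defs.v *)
(* Only the Rocq prelude and List are used.

   Rocq's own universes cannot host univalence: a statement quantifying over
   Rocq types under a univalence hypothesis would have contradictory
   hypotheses as soon as proof irrelevance is available.  So homotopy type
   theory is represented here as an object theory: the type theory of the HoTT
   Book (cumulative universes, Pi, Sigma, +, 0, 1, nat, identity types,
   function extensionality, univalence) with the higher inductive types that
   are needed, each with a judgmental computation rule for points and
   propositional ones for paths.  A theorem of homotopy type theory is a closed
   type with a closed inhabitant ([derivable] below). *)

From Stdlib Require Import List.
Import ListNotations.
Set Implicit Arguments.

(** * Raw terms *)

(* Arguments are universe levels.  The two-level eliminators take the level of
   the types being eliminated (if there is one to choose) and then the level of
   the motive. *)
Inductive cst : Set :=
| cEmpty | cEmptyInd (m : nat)
| cUnit | cTt | cUnitInd (m : nat)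
| cSum (l : nat) | cInl (l : nat) | cInr (l : nat) | cSumInd (l m : nat)
| cNat | cZero | cSucc | cNatInd (m : nat)
| cSig (l : nat) | cPair (l : nat) | cSigInd (l m : nat)
| cId (l : nat) | cRefl (l : nat) | cJ (l m : nat)
| cFunext (l : nat) | cUA (l : nat)
| cRP2 | cRPpt | cRPloop | cRPsq | cRPInd (m : nat) | cRPbeta (m : nat)
| cK2 | cKpt | cKloop1 | cKloop2 | cKsq | cKInd (m : nat) | cKbeta (m : nat)
| cSusp (l : nat) | cNorth (l : nat) | cSouth (l : nat) | cMerid (l : nat)
| cSuspInd (l m : nat) | cSuspBeta (l m : nat)
| cTrunc (l : nat) | cTr (l : nat) | cTrLevel (l : nat) | cTrInd (l m : nat)
| cEM (l : nat) | cEMpt (l : nat) | cEMloop (l : nat) | cEMsq (l : nat)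
| cEMInd (l m : nat) | cEMbeta (l m : nat).

(* De Bruijn indices; lambda-abstractions carry no domain. *)
Inductive tm : Set :=
| Var (n : nat)
| Univ (l : nat)
| Pi (A B : tm)
| Lam (b : tm)
| App (f a : tm)
| Cst (c : cst).

(* [shift k n t] adds [n] to the indices of [t] that are at least [k]. *)
Fixpoint shift (k n : nat) (t : tm) : tm :=
  match t with
  | Var x => Var (if Nat.leb k x then n + x else x)
  | Univ l => Univ l
  | Pi A B => Pi (shift k n A) (shift (S k) n B)
  | Lam b => Lam (shift (S k) n b)
  | App f a => App (shift k n f) (shift k n a)
  | Cst c => Cst c
  end.

(* [subst k u t] replaces index [k] by [u] and lowers the indices above [k]. *)
Fixpoint subst (k : nat) (u t : tm) : tm :=
  match t with
  | Var x => match Nat.compare x k with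
             | Lt => Var x
             | Eq => shift 0 k u
             | Gt => Var (pred x)
             end
  | Univ l => Univ l
  | Pi A B => Pi (subst k u A) (subst (S k) u B)
  | Lam b => Lam (subst (S k) u b)
  | App f a => App (subst k u f) (subst k u a)
  | Cst c => Cst c
  end.

(** * Named surface syntax *)

(* An expression is a raw term depending on the number of binders it stands
   under, so that binders can be written with Rocq functions: a variable bound
   at depth [d] has de Bruijn index [d' - S d] at depth [d']. *)
Definition exp : Set := nat -> tm.

Definition bvar (d : nat) : exp := fun d' => Var (d' - S d).
Definition U (l : nat) : exp := fun _ => Univ l.
Definition C (c : cst) : exp := fun _ => Cst c.
Definition appl (f a : exp) : exp := fun d => App (f d) (a d).
Definition pi (A : exp) (B : exp -> exp) : exp :=
  fun d => Pi (A d) (B (bvar d) (S d)).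
Definition lam (b : exp -> exp) : exp := fun d => Lam (b (bvar d) (S d)).

Declare Scope hott_scope.
Delimit Scope hott_scope with hott.
Bind Scope hott_scope with exp.
Local Open Scope hott_scope.

Notation "f $ a" := (appl f a) (at level 40, left associativity) : hott_scope.
Notation "'Π' x .. y : A , B" :=
  (pi A (fun x => .. (pi A (fun y => B)) ..))
  (at level 200, x closed binder, y closed binder, A at level 85, B at level 200,
   right associativity) : hott_scope.
Notation "'λ' x .. y , b" := (lam (fun x => .. (lam (fun y => b)) ..))
  (at level 200, x closed binder, y closed binder, b at level 200,
   right associativity) : hott_scope.
Notation "A ⇒ B" := (pi A (fun _ => B))
  (at level 85, right associativity) : hott_scope.

(** * Derived notions of the object theory *)

(* In the definitions below [l], [m] are universe levels, and families and
   functions that are Rocq functions [exp -> exp] are open expressions. *)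

Definition Empty := C cEmpty.
Definition Nat := C cNat.
Definition zero := C cZero.
Definition succ (n : exp) := C cSucc $ n.
Definition natInd m (P : exp -> exp) (z : exp) (s : exp -> exp -> exp)
  (n : exp) := C (cNatInd m) $ (λ n, P n) $ z $ (λ n h, s n h) $ n.

Definition Sig l (A : exp) (B : exp -> exp) := C (cSig l) $ A $ (λ x, B x).
Definition Times l (A B : exp) := Sig l A (fun _ => B).
Definition Pair l (A : exp) (B : exp -> exp) (a b : exp) :=
  C (cPair l) $ A $ (λ x, B x) $ a $ b.
Definition Fst l (A B t : exp) :=
  C (cSigInd l l) $ A $ (λ _, B) $ (λ _, A) $ (λ x y, x) $ t.
Definition Snd l (A B t : exp) :=
  C (cSigInd l l) $ A $ (λ _, B) $ (λ _, B) $ (λ x y, y) $ t.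

Definition Id l (A x y : exp) := C (cId l) $ A $ x $ y.
Definition refl l (A x : exp) := C (cRefl l) $ A $ x.
Definition J l m (A a : exp) (P : exp -> exp -> exp) (d x p : exp) :=
  C (cJ l m) $ A $ a $ (λ x p, P x p) $ d $ x $ p.

(* [p : x = y] and [q : y = z] *)
Definition inv l (A x y p : exp) :=
  J l l A x (fun y _ => Id l A y x) (refl l A x) y p.
Definition comp l (A x y z p q : exp) :=
  J l l A y (fun z _ => Id l A x z) p z q.
Definition ap l m (A B : exp) (f : exp -> exp) (x y p : exp) :=
  J l m A x (fun y _ => Id m B (f x) (f y)) (refl m B (f x)) y p.
Definition transport l m (A : exp) (P : exp -> exp) (x y p u : exp) :=
  J l m A x (fun y _ => P x ⇒ P y) (λ v, v) y p $ u.

(* Paths over [p : x = y] in the family [P], from [u : P x] to [v : P y]. *)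
Definition over l m (A : exp) (P : exp -> exp) (x y p u v : exp) :=
  Id m (P y) (transport l m A P x y p u) v.
Definition apd l m (A : exp) (P : exp -> exp) (f : exp -> exp) (x y p : exp) :=
  J l m A x (fun y p => over l m A P x y p (f x) (f y)) (refl m (P x) (f x))
    y p.

(* Inverse and composite of paths over: [u] goes from [b] to [c] over
   [p : x = y], and [v] from [c] to [d] over [q : y = z]. *)
Definition oinv l m (A : exp) (P : exp -> exp) (x y p b c u : exp) :=
  J l m A x
    (fun y p => Π c : P y, over l m A P x y p b c
                  ⇒ over l m A P y x (inv l A x y p) c b)
    (λ c u, inv m (P x) b c u) y p $ c $ u.
Definition oconcat l m (A : exp) (P : exp -> exp)
  (x y z p q b c d u v : exp) :=
  J l m A y
    (fun z q => Π d : P z, over l m A P y z q c d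
                  ⇒ over l m A P x z (comp l A x y z p q) b d)
    (λ d v, comp m (P y) (transport l m A P x y p b) c d u v)
    z q $ d $ v.

(* [apd] commutes with inverses and composites. *)
Definition apd_inv l m (A : exp) (P f : exp -> exp) (x y p : exp) :=
  J l m A x
    (fun y p =>
       Id m (over l m A P y x (inv l A x y p) (f y) (f x))
         (oinv l m A P x y p (f x) (f y) (apd l m A P f x y p))
         (apd l m A P f y x (inv l A x y p)))
    (refl m (Id m (P x) (f x) (f x)) (refl m (P x) (f x))) y p.
Definition apd_concat l m (A : exp) (P f : exp -> exp) (x y z p q : exp) :=
  J l m A y
    (fun z q =>
       Id m (over l m A P x z (comp l A x y z p q) (f x) (f z))
         (oconcat l m A P x y z p q (f x) (f y) (f z)
            (apd l m A P f x y p) (apd l m A P f y z q))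
         (apd l m A P f x z (comp l A x y z p q)))
    (refl m (over l m A P x y p (f x) (f y)) (apd l m A P f x y p)) z q.

(* Paths over a path [s : p = q] between paths [p, q : x = y], from [u] over
   [p] to [v] over [q]. *)
Definition over2 l m (A : exp) (P : exp -> exp) (x y p q s b c u v : exp) :=
  over l m (Id l A x y) (fun r => over l m A P x y r b c) p q s u v.
(* The action of [f] on [s : p = q], precomposed with [e : u = apd f p]. *)
Definition apd2 l m (A : exp) (P f : exp -> exp) (x y p q s u e : exp) :=
  let O r := over l m A P x y r (f x) (f y) in
  let T w := transport l m (Id l A x y) O p q s w in
  comp m (O q) (T u) (T (apd l m A P f x y p)) (apd l m A P f x y q)
    (ap m m (O p) (O q) T u (apd l m A P f x y p) e)
    (apd l m (Id l A x y) O (fun r => apd l m A P f x y r) p q s).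

Definition isContr l (A : exp) := Sig l A (fun a => Π x : A, Id l A a x).
(* [ofLevel l k A]: [A] is a [(k-2)]-type. *)
Definition ofLevel l (k A : exp) :=
  natInd (S l) (fun _ => U l ⇒ U l) (λ A, isContr l A)
    (fun _ h => λ A, Π x y : A, h $ Id l A x y) k $ A.
Definition isType l (n A : exp) := ofLevel l (succ (succ n)) A.
Definition isSet l (A : exp) := isType l zero A.

Definition isEquiv l (A B : exp) (f : exp -> exp) :=
  Times l (Sig l (B ⇒ A) (fun g => Π y : B, Id l B (f (g $ y)) y))
         (Sig l (B ⇒ A) (fun h => Π x : A, Id l A (h $ f x) x)).
Definition Equiv l (A B : exp) :=
  Sig l (A ⇒ B) (fun f => isEquiv l A B (fun x => f $ x)).
Definition idEquiv l (A : exp) :=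
  let R := Sig l (A ⇒ A) (fun g => Π y : A, Id l A (g $ y) y) in
  let r := Pair l (A ⇒ A) (fun g => Π y : A, Id l A (g $ y) y)
             (λ x, x) (λ x, refl l A x) in
  Pair l (A ⇒ A) (fun f => isEquiv l A A (fun x => f $ x))
    (λ x, x) (Pair l R (fun _ => R) r r).
Definition idToEquiv l (A B p : exp) :=
  J (S l) l (U l) A (fun B _ => Equiv l A B) (idEquiv l A) B p.
Definition happly l (A : exp) (B : exp -> exp) (f g p : exp) :=
  J l l (Π x : A, B x) f (fun g _ => Π x : A, Id l (B x) (f $ x) (g $ x))
    (λ x, refl l (B x) (f $ x)) g p.

Definition RP2 := C cRP2.
Definition K2 := C cK2.
Definition Susp l (A : exp) := C (cSusp l) $ A.
Definition north l (A : exp) := C (cNorth l) $ A.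
Definition south l (A : exp) := C (cSouth l) $ A.
Definition merid l (A a : exp) := C (cMerid l) $ A $ a.
Definition Trunc l (n A : exp) := C (cTrunc l) $ n $ A.
Definition tr l (n A a : exp) := C (cTr l) $ n $ A $ a.
Definition trRec l m (n A B h : exp) (f : exp -> exp) (x : exp) :=
  C (cTrInd l m) $ n $ A $ (λ _, B) $ (λ _, h) $ (λ a, f a) $ x.
(* [EM l G add] is generated by [★], by [loop g : ★ = ★] for [g : G] and by
   [loop g · loop h = loop (add g h)] for [g h : G]. *)
Definition EM l (G add : exp) := C (cEM l) $ G $ add.
Definition EMpt l (G add : exp) := C (cEMpt l) $ G $ add.
Definition EMloop l (G add g : exp) := C (cEMloop l) $ G $ add $ g.
Definition EMsq l (G add g h : exp) := C (cEMsq l) $ G $ add $ g $ h.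

(** * Types of the constants *)

Definition RPloop := C cRPloop.
Definition RPinv := inv 0 RP2 (C cRPpt) (C cRPpt) RPloop.
(* Premises of the induction principle, for a family [P] and [b : P ★]. *)
Definition RPover m (P : exp -> exp) (b : exp) :=
  over 0 m RP2 P (C cRPpt) (C cRPpt) RPloop b b.
Definition RPover2 m (P : exp -> exp) (b u : exp) :=
  over2 0 m RP2 P (C cRPpt) (C cRPpt) RPinv RPloop (C cRPsq) b b
    (oinv 0 m RP2 P (C cRPpt) (C cRPpt) RPloop b b u) u.
(* The actions of [f : forall x, P x] on the two path constructors. *)
Definition RPapd m (P f : exp -> exp) :=
  apd 0 m RP2 P f (C cRPpt) (C cRPpt) RPloop.
Definition RPapd2 m (P f : exp -> exp) :=
  let pt := C cRPpt in
  apd2 0 m RP2 P f pt pt RPinv RPloop (C cRPsq)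
    (oinv 0 m RP2 P pt pt RPloop (f pt) (f pt) (RPapd m P f))
    (apd_inv 0 m RP2 P f pt pt RPloop).

Definition Kconcat (p q : exp) :=
  comp 0 K2 (C cKpt) (C cKpt) (C cKpt) p q.
Definition K12 := Kconcat (C cKloop1) (C cKloop2).
Definition K121 := Kconcat K12 (C cKloop1).
Definition Kover m (P : exp -> exp) (p b : exp) :=
  over 0 m K2 P (C cKpt) (C cKpt) p b b.
Definition Koconcat m (P : exp -> exp) (p q b u v : exp) :=
  oconcat 0 m K2 P (C cKpt) (C cKpt) (C cKpt) p q b b b u v.
Definition Kover121 m (P : exp -> exp) (b u1 u2 : exp) :=
  Koconcat m P K12 (C cKloop1) b
    (Koconcat m P (C cKloop1) (C cKloop2) b u1 u2) u1.
Definition Kover2 m (P : exp -> exp) (b u1 u2 : exp) :=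
  over2 0 m K2 P (C cKpt) (C cKpt) K121 (C cKloop2) (C cKsq) b b
    (Kover121 m P b u1 u2) u2.
Definition Kapd m (P f : exp -> exp) (p : exp) :=
  apd 0 m K2 P f (C cKpt) (C cKpt) p.
Definition Kapd2 m (P f : exp -> exp) :=
  let pt := C cKpt in
  let l1 := C cKloop1 in
  let l2 := C cKloop2 in
  let u1 := Kapd m P f l1 in
  let u2 := Kapd m P f l2 in
  let w12 := Koconcat m P l1 l2 (f pt) u1 u2 in
  let O p := Kover m P p (f pt) in
  let R w := Koconcat m P K12 l1 (f pt) w u1 in
  apd2 0 m K2 P f pt pt K121 l2 (C cKsq) (R w12)
    (comp m (O K121) (R w12) (R (Kapd m P f K12)) (Kapd m P f K121)
       (ap m m (O K12) (O K121) R w12 (Kapd m P f K12)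
          (apd_concat 0 m K2 P f pt pt pt l1 l2))
       (apd_concat 0 m K2 P f pt pt pt K12 l1)).

Definition EMconcat l (G add p q : exp) :=
  comp l (EM l G add) (EMpt l G add) (EMpt l G add) (EMpt l G add) p q.
Definition EMover l m (G add : exp) (P : exp -> exp) (b g : exp) :=
  over l m (EM l G add) P (EMpt l G add) (EMpt l G add)
    (EMloop l G add g) b b.
Definition EMoconcat l m (G add : exp) (P : exp -> exp) (b g h u v : exp) :=
  let pt := EMpt l G add in
  oconcat l m (EM l G add) P pt pt pt
    (EMloop l G add g) (EMloop l G add h) b b b u v.
Definition EMover2 l m (G add : exp) (P : exp -> exp) (b u g h : exp) :=
  let pt := EMpt l G add in
  over2 l m (EM l G add) P pt pt
    (EMconcat l G add (EMloop l G add g) (EMloop l G add h))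
    (EMloop l G add (add $ g $ h)) (EMsq l G add g h) b b
    (EMoconcat l m G add P b g h (u $ g) (u $ h)) (u $ (add $ g $ h)).
Definition EMapd l m (G add : exp) (P f : exp -> exp) (g : exp) :=
  apd l m (EM l G add) P f (EMpt l G add) (EMpt l G add) (EMloop l G add g).
Definition EMapd2 l m (G add : exp) (P f : exp -> exp) (g h : exp) :=
  let pt := EMpt l G add in
  let lg := EMloop l G add g in
  let lh := EMloop l G add h in
  apd2 l m (EM l G add) P f pt pt (EMconcat l G add lg lh)
    (EMloop l G add (add $ g $ h)) (EMsq l G add g h)
    (EMoconcat l m G add P (f pt) g h
       (EMapd l m G add P f g) (EMapd l m G add P f h))
    (apd_concat l m (EM l G add) P f pt pt pt lg lh).

(* The propositional computation rules of [RP2], [K2] and [EM] identify the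
   tuple of the actions of the eliminator on the path constructors with the
   tuple of the given data; identifying tuples avoids conjugating the rule for
   2-paths by the rules for paths. *)
Definition cst_exp (c : cst) : exp :=
  match c with
  | cEmpty => U 0
  | cEmptyInd m => Π P : Empty ⇒ U m, Π x : Empty, P $ x
  | cUnit => U 0
  | cTt => C cUnit
  | cUnitInd m =>
      Π P : C cUnit ⇒ U m, (P $ C cTt) ⇒ Π x : C cUnit, P $ x
  | cSum l => U l ⇒ U l ⇒ U l
  | cInl l => Π A B : U l, A ⇒ C (cSum l) $ A $ B
  | cInr l => Π A B : U l, B ⇒ C (cSum l) $ A $ B
  | cSumInd l m =>
      Π A B : U l, Π P : (C (cSum l) $ A $ B) ⇒ U m,
      (Π a : A, P $ (C (cInl l) $ A $ B $ a)) ⇒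
      (Π b : B, P $ (C (cInr l) $ A $ B $ b)) ⇒
      Π x : C (cSum l) $ A $ B, P $ x
  | cNat => U 0
  | cZero => Nat
  | cSucc => Nat ⇒ Nat
  | cNatInd m =>
      Π P : Nat ⇒ U m, P $ zero ⇒ (Π n : Nat, P $ n ⇒ P $ succ n) ⇒
      Π n : Nat, P $ n
  | cSig l => Π A : U l, (A ⇒ U l) ⇒ U l
  | cPair l =>
      Π A : U l, Π B : A ⇒ U l, Π a : A, B $ a ⇒ C (cSig l) $ A $ B
  | cSigInd l m =>
      Π A : U l, Π B : A ⇒ U l, Π P : (C (cSig l) $ A $ B) ⇒ U m,
      (Π a : A, Π b : B $ a, P $ (C (cPair l) $ A $ B $ a $ b)) ⇒
      Π x : C (cSig l) $ A $ B, P $ x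
  | cId l => Π A : U l, A ⇒ A ⇒ U l
  | cRefl l => Π A : U l, Π x : A, Id l A x x
  | cJ l m =>
      Π A : U l, Π a : A, Π P : (Π x : A, Id l A a x ⇒ U m),
      P $ a $ refl l A a ⇒ Π x : A, Π p : Id l A a x, P $ x $ p
  | cFunext l =>
      Π A : U l, Π B : A ⇒ U l, Π f g : (Π x : A, B $ x),
      isEquiv l (Id l (Π x : A, B $ x) f g)
        (Π x : A, Id l (B $ x) (f $ x) (g $ x))
        (fun p => happly l A (fun x => B $ x) f g p)
  | cUA l =>
      Π A B : U l,
      isEquiv (S l) (Id (S l) (U l) A B) (Equiv l A B)
        (fun p => idToEquiv l A B p)

  | cRP2 => U 0
  | cRPpt => RP2
  | cRPloop => Id 0 RP2 (C cRPpt) (C cRPpt)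
  | cRPsq => Id 0 (Id 0 RP2 (C cRPpt) (C cRPpt)) RPinv RPloop
  | cRPInd m =>
      Π P : RP2 ⇒ U m, Π b : P $ C cRPpt,
      Π u : RPover m (fun x => P $ x) b,
      RPover2 m (fun x => P $ x) b u ⇒ Π x : RP2, P $ x
  | cRPbeta m =>
      Π P : RP2 ⇒ U m, Π b : P $ C cRPpt,
      Π u : RPover m (fun x => P $ x) b,
      Π s : RPover2 m (fun x => P $ x) b u,
      let Q x := P $ x in
      let f x := C (cRPInd m) $ P $ b $ u $ s $ x in
      let D u := RPover2 m Q b u in
      Id m (Sig m (RPover m Q b) D)
        (Pair m (RPover m Q b) D (RPapd m Q f) (RPapd2 m Q f))
        (Pair m (RPover m Q b) D u s)

  | cK2 => U 0
  | cKpt => K2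
  | cKloop1 => Id 0 K2 (C cKpt) (C cKpt)
  | cKloop2 => Id 0 K2 (C cKpt) (C cKpt)
  | cKsq => Id 0 (Id 0 K2 (C cKpt) (C cKpt)) K121 (C cKloop2)
  | cKInd m =>
      Π P : K2 ⇒ U m, Π b : P $ C cKpt,
      Π u1 : Kover m (fun x => P $ x) (C cKloop1) b,
      Π u2 : Kover m (fun x => P $ x) (C cKloop2) b,
      Kover2 m (fun x => P $ x) b u1 u2 ⇒ Π x : K2, P $ x
  | cKbeta m =>
      Π P : K2 ⇒ U m, Π b : P $ C cKpt,
      Π u1 : Kover m (fun x => P $ x) (C cKloop1) b,
      Π u2 : Kover m (fun x => P $ x) (C cKloop2) b,
      Π s : Kover2 m (fun x => P $ x) b u1 u2,
      let Q x := P $ x in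
      let f x := C (cKInd m) $ P $ b $ u1 $ u2 $ s $ x in
      let O1 := Kover m Q (C cKloop1) b in
      let O2 := Kover m Q (C cKloop2) b in
      let D u1 := Sig m O2 (fun u2 => Kover2 m Q b u1 u2) in
      let tuple v1 v2 t :=
        Pair m O1 D v1 (Pair m O2 (fun v2 => Kover2 m Q b v1 v2) v2 t) in
      Id m (Sig m O1 D)
        (tuple (Kapd m Q f (C cKloop1)) (Kapd m Q f (C cKloop2))
           (Kapd2 m Q f))
        (tuple u1 u2 s)

  | cSusp l => U l ⇒ U l
  | cNorth l => Π A : U l, Susp l A
  | cSouth l => Π A : U l, Susp l A
  | cMerid l => Π A : U l, A ⇒ Id l (Susp l A) (north l A) (south l A)
  | cSuspInd l m =>
      Π A : U l, Π P : Susp l A ⇒ U m,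
      Π n : P $ north l A, Π s : P $ south l A,
      (Π a : A, over l m (Susp l A) (fun x => P $ x) (north l A) (south l A)
                  (merid l A a) n s) ⇒
      Π x : Susp l A, P $ x
  | cSuspBeta l m =>
      Π A : U l, Π P : Susp l A ⇒ U m,
      Π n : P $ north l A, Π s : P $ south l A,
      let O a := over l m (Susp l A) (fun x => P $ x) (north l A) (south l A)
                   (merid l A a) n s in
      Π u : (Π a : A, O a), Π a : A,
      Id m (O a)
        (apd l m (Susp l A) (fun x => P $ x)
           (fun x => C (cSuspInd l m) $ A $ P $ n $ s $ u $ x)
           (north l A) (south l A) (merid l A a))
        (u $ a)

  | cTrunc l => Nat ⇒ U l ⇒ U l
  | cTr l => Π n : Nat, Π A : U l, A ⇒ Trunc l n A
  | cTrLevel l => Π n : Nat, Π A : U l, isType l n (Trunc l n A)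
  | cTrInd l m =>
      Π n : Nat, Π A : U l, Π P : Trunc l n A ⇒ U m,
      (Π x : Trunc l n A, isType m n (P $ x)) ⇒
      (Π a : A, P $ tr l n A a) ⇒ Π x : Trunc l n A, P $ x

  | cEM l => Π G : U l, (G ⇒ G ⇒ G) ⇒ U l
  | cEMpt l => Π G : U l, Π add : G ⇒ G ⇒ G, EM l G add
  | cEMloop l =>
      Π G : U l, Π add : G ⇒ G ⇒ G,
      G ⇒ Id l (EM l G add) (EMpt l G add) (EMpt l G add)
  | cEMsq l =>
      Π G : U l, Π add : G ⇒ G ⇒ G, Π g h : G,
      Id l (Id l (EM l G add) (EMpt l G add) (EMpt l G add))
        (EMconcat l G add (EMloop l G add g) (EMloop l G add h))
        (EMloop l G add (add $ g $ h))
  | cEMInd l m =>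
      Π G : U l, Π add : G ⇒ G ⇒ G,
      Π P : EM l G add ⇒ U m, Π b : P $ EMpt l G add,
      Π u : (Π g : G, EMover l m G add (fun x => P $ x) b g),
      (Π g h : G, EMover2 l m G add (fun x => P $ x) b u g h) ⇒
      Π x : EM l G add, P $ x
  | cEMbeta l m =>
      Π G : U l, Π add : G ⇒ G ⇒ G,
      Π P : EM l G add ⇒ U m, Π b : P $ EMpt l G add,
      let Q x := P $ x in
      let O := Π g : G, EMover l m G add Q b g in
      let D u := Π g h : G, EMover2 l m G add Q b u g h in
      Π u : O, Π s : D u,
      let f x := C (cEMInd l m) $ G $ add $ P $ b $ u $ s $ x in
      let k := Nat.max l m in
      Id k (Sig k O D)
        (Pair k O D (λ g, EMapd l m G add Q f g)
           (λ g h, EMapd2 l m G add Q f g h))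
        (Pair k O D u s)
  end.

Definition cst_type (c : cst) : tm := cst_exp c 0.

(** * Judgments *)

Fixpoint apps (f : tm) (xs : list tm) : tm :=
  match xs with
  | [] => f
  | x :: xs => apps (App f x) xs
  end.

(* Judgmental computation rules of the eliminators. *)
Inductive iota : tm -> tm -> Prop :=
| iota_unit m P d :
    iota (apps (Cst (cUnitInd m)) [P; d; Cst cTt]) d
| iota_inl l m l' A B P f g A' B' a :
    iota (apps (Cst (cSumInd l m)) [A; B; P; f; g;
            apps (Cst (cInl l')) [A'; B'; a]])
         (App f a)
| iota_inr l m l' A B P f g A' B' b :
    iota (apps (Cst (cSumInd l m)) [A; B; P; f; g;
            apps (Cst (cInr l')) [A'; B'; b]])
         (App g b)
| iota_zero m P z s :
    iota (apps (Cst (cNatInd m)) [P; z; s; Cst cZero]) z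
| iota_succ m P z s n :
    iota (apps (Cst (cNatInd m)) [P; z; s; App (Cst cSucc) n])
         (apps s [n; apps (Cst (cNatInd m)) [P; z; s; n]])
| iota_pair l m l' A B P f A' B' a b :
    iota (apps (Cst (cSigInd l m)) [A; B; P; f;
            apps (Cst (cPair l')) [A'; B'; a; b]])
         (apps f [a; b])
| iota_refl l m l' A a P d x A' a' :
    iota (apps (Cst (cJ l m)) [A; a; P; d; x;
            apps (Cst (cRefl l')) [A'; a']])
         d
| iota_RPpt m P b u s :
    iota (apps (Cst (cRPInd m)) [P; b; u; s; Cst cRPpt]) b
| iota_Kpt m P b u1 u2 s :
    iota (apps (Cst (cKInd m)) [P; b; u1; u2; s; Cst cKpt]) b
| iota_north l m l' A P n s u A' :
    iota (apps (Cst (cSuspInd l m)) [A; P; n; s; u;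
            App (Cst (cNorth l')) A'])
         n
| iota_south l m l' A P n s u A' :
    iota (apps (Cst (cSuspInd l m)) [A; P; n; s; u;
            App (Cst (cSouth l')) A'])
         s
| iota_tr l m l' n A P h f n' A' a :
    iota (apps (Cst (cTrInd l m)) [n; A; P; h; f;
            apps (Cst (cTr l')) [n'; A'; a]])
         (App f a)
| iota_EMpt l m l' G add P b u s G' add' :
    iota (apps (Cst (cEMInd l m)) [G; add; P; b; u; s;
            apps (Cst (cEMpt l')) [G'; add']])
         b.

(* Judgmental equality is untyped conversion (beta, eta, iota). *)
Inductive conv : tm -> tm -> Prop :=
| conv_refl t : conv t t
| conv_sym t u : conv t u -> conv u t
| conv_trans t u v : conv t u -> conv u v -> conv t v
| conv_Pi A A' B B' : conv A A' -> conv B B' -> conv (Pi A B) (Pi A' B')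
| conv_Lam b b' : conv b b' -> conv (Lam b) (Lam b')
| conv_App f f' a a' : conv f f' -> conv a a' -> conv (App f a) (App f' a')
| conv_beta b a : conv (App (Lam b) a) (subst 0 a b)
| conv_eta f : conv (Lam (App (shift 0 1 f) (Var 0))) f
| conv_iota t u : iota t u -> conv t u.

(* [Γ ⊢ t : A]; contexts list the innermost variable first. *)
Inductive wf : list tm -> Prop :=
| wf_nil : wf []
| wf_cons Γ A l : has_type Γ A (Univ l) -> wf (A :: Γ)
with has_type : list tm -> tm -> tm -> Prop :=
| ty_Var Γ n A : wf Γ -> nth_error Γ n = Some A ->
    has_type Γ (Var n) (shift 0 (S n) A)
| ty_Univ Γ l : wf Γ -> has_type Γ (Univ l) (Univ (S l))
| ty_Cst Γ c : wf Γ -> has_type Γ (Cst c) (cst_type c)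
| ty_Pi Γ A B l : has_type Γ A (Univ l) -> has_type (A :: Γ) B (Univ l) ->
    has_type Γ (Pi A B) (Univ l)
| ty_Lam Γ A B b : has_type (A :: Γ) b B -> has_type Γ (Lam b) (Pi A B)
| ty_App Γ A B f a : has_type Γ f (Pi A B) -> has_type Γ a A ->
    has_type Γ (App f a) (subst 0 a B)
| ty_cumul Γ A l : has_type Γ A (Univ l) -> has_type Γ A (Univ (S l))
| ty_conv Γ A B t l : has_type Γ t A -> has_type Γ B (Univ l) -> conv A B ->
    has_type Γ t B.

Definition derivable (A : exp) : Prop := exists t : tm, has_type [] t (A 0).

(** * Groups, Eilenberg-MacLane spaces and cohomology *)

Definition isAbGroup l (G zero add opp : exp) :=
  Times l (isSet l G)
  (Times l (Π x y z : G,
             Id l G (add $ (add $ x $ y) $ z) (add $ x $ (add $ y $ z)))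
  (Times l (Π x : G, Id l G (add $ zero $ x) x)
  (Times l (Π x : G, Id l G (add $ (opp $ x) $ x) zero)
          (Π x y : G, Id l G (add $ x $ y) (add $ y $ x))))).

(* Isomorphisms of groups, given by their carriers and operations. *)
Definition GroupIso l (A : exp) (opA : exp -> exp -> exp)
  (B : exp) (opB : exp -> exp -> exp) :=
  Sig l (A ⇒ B) (fun f =>
    Times l (isEquiv l A B (fun x => f $ x))
      (Π x y : A, Id l B (f $ opA x y) (opB (f $ x) (f $ y)))).

(* The direct product of groups. *)
Definition TimesOp l (A : exp) (opA : exp -> exp -> exp)
  (B : exp) (opB : exp -> exp -> exp) (x y : exp) :=
  Pair l A (fun _ => B)
    (opA (Fst l A B x) (Fst l A B y)) (opB (Snd l A B x) (Snd l A B y)).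

(* [Kt l G add n] is the untruncated Eilenberg-MacLane space of degree
   [n + 1]. *)
Definition Kt l (G add n : exp) :=
  natInd (S l) (fun _ => U l) (EM l G add) (fun _ X => Susp l X) n.
Definition K l (G add n : exp) :=
  natInd (S l) (fun _ => U l) G
    (fun n _ => Trunc l (succ n) (Kt l G add n)) n.

(* [isAdd l G add n a]: the map [a : K n -> K n -> K n] is the addition of
   [K n].  It is the addition of [G] if [n = 0].  If [n = 1], it is determined
   by [★ + y = y] for all [y] and by the action of [_ + ★] on [loop g], which
   is [loop g] (up to the identification [★ + ★ = ★]); if [n >= 2], by
   [x + 0 = x] and [0 + y = y], which agree for [x = y = 0]. *)
Definition isAdd0 l (G add a : exp) :=
  Π x y : G, Id l G (a $ x $ y) (add $ x $ y).
Definition isAdd1 l (G add a : exp) :=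
  let X := EM l G add in
  let pt := EMpt l G add in
  let T := Trunc l (succ zero) X in
  let i x := tr l (succ zero) X x in
  Sig l (Π y : X, Id l T (a $ i pt $ i y) (i y)) (fun lu =>
    Π g : G,
      Id l (Id l T (a $ i pt $ i pt) (i pt))
        (comp l T (a $ i pt $ i pt) (a $ i pt $ i pt) (i pt)
           (ap l l X T (fun x => a $ i x $ i pt) pt pt (EMloop l G add g))
           (lu $ pt))
        (comp l T (a $ i pt $ i pt) (i pt) (i pt)
           (lu $ pt)
           (ap l l X T i pt pt (EMloop l G add g)))).
(* [isAdd2] is for degree [n + 2]. *)
Definition isAdd2 l (G add n a : exp) :=
  let X := Susp l (Kt l G add n) in
  let o := north l (Kt l G add n) in
  let d := succ (succ n) in
  let T := Trunc l d X in
  let i x := tr l d X x in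
  Sig l (Π x : X, Id l T (a $ i x $ i o) (i x)) (fun ru =>
  Sig l (Π y : X, Id l T (a $ i o $ i y) (i y)) (fun lu =>
    Id l (Id l T (a $ i o $ i o) (i o)) (ru $ o) (lu $ o))).
Definition isAdd l (G add n a : exp) :=
  let M n := (K l G add n ⇒ K l G add n ⇒ K l G add n) ⇒ U l in
  natInd (S l) M
    (λ a, isAdd0 l G add a)
    (fun n _ => natInd (S l) (fun n => M (succ n))
       (λ a, isAdd1 l G add a)
       (fun n _ => λ a, isAdd2 l G add n a) n)
    n $ a.

Definition H l (G add n X : exp) := Trunc l zero (X ⇒ K l G add n).
(* The pointwise addition on [H n X] induced by [a : K n -> K n -> K n]. *)
Definition Hadd l (G add n a X u v : exp) :=
  let F := X ⇒ K l G add n in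
  let T := Trunc l zero F in
  let h := C (cTrLevel l) $ zero $ F in
  trRec l l zero F T h (fun f =>
    trRec l l zero F T h (fun g =>
      tr l zero F (λ x, a $ (f $ x) $ (g $ x))) v) u.

(* Main.v *)
(* Write [X] for [K(G, n)].  A map [K2 -> X] is a point [b] with loops [u], [v] and
   a path [(u · v) · u = v]; a map [RP2 -> X] is a point [b] with a loop [u] and a
   path [u⁻¹ = u].  For [n > 0], [X] is a connected H-space, and translation by [b]
   identifies the loops at [0] with those at [b]: as this is a proposition, it
   suffices to see it for [b = 0].  Hence every loop at [b] is the value of a
   homotopy from the identity to itself, so it commutes with all loops at [b], and
   the types [(u · v) · u = v], [u · u = 1] and [u⁻¹ = u] are equivalent; the
   equivalence is normalized so that for [v = 1] it is composition with the map
   [K2 -> RP2] that collapses the second loop.  Thus a map [K2 -> X] is a map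
   [RP2 -> X] with a loop [v] at the image of the base point.  If [n <> 1], all loops
   are merely equal to [1], and composition with the collapse is bijective on
   components.  If [n = 1], the loops at [b] are the translates of those at [0],
   which form [G] by an encode-decode argument with univalence.  That translation
   takes sums to sums is again a proposition, as loop spaces of [X] are sets.

   The derivation in the object theory is given by terms that a type checker, sound
   for the judgments, accepts by computation.  Terms refer by position to a list of
   statements derived before. *)

(* The normalization at $v=1$ serves additivity. Addition of classes is pointwise, so composition
   with a fixed map $K^2\to\mathbb RP^2$ preserves it, whereas a bijection assembled from arbitrary
   equivalences of path types need not. Once the bijection is known to be inverse to composition
   with the collapse, it is additive as well. In degree 1 additivity has a different source:
   $K(G,1)$ is a 1-type, so a map out of [RP2] is determined by its point and its loop, and only
   loops have to be compared.

   That translation is an equivalence on loops is expressed as contractibility of its fibres: this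
   is a proposition by its form, so it can be carried along a connected type, and its centre gives
   back the loop to be translated.

   Path induction applies only to a path with a free end, while the constructors of [RP2] and [K2]
   are loops related by 2-paths. Hence each statement about their faces is first proved for paths
   between arbitrary points, with [q] in place of a second occurrence of [p], and then
   specialized. *)
Require Import Defs.
From Stdlib Require Import List Arith Lia Bool.
Import ListNotations.
Set Implicit Arguments.

(** * Metatheory of the object theory *)

Ltac cases_var :=
  repeat (cbn [shift subst] in *; match goal with
  | |- context [Nat.leb ?a ?b] => destruct (Nat.leb_spec a b)
  | |- context [Nat.compare ?a ?b] => destruct (Nat.compare_spec a b)
  end); subst; cbn [Nat.pred] in *; try lia; try (f_equal; lia).

Lemma shift_0 t : forall k, shift k 0 t = t.
Proof.
  induction t; intros; cbn [shift subst]; try congruence. cases_var.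
Qed.

Lemma shift_shift_merge t : forall j k m n, k <= j -> j <= k + n ->
  shift j m (shift k n t) = shift k (m + n) t.
Proof.
  induction t; intros; cbn [shift subst]; f_equal; auto; try (apply IHt2 || apply IHt; lia).
  cases_var.
Qed.

Lemma shift_shift t : forall j k m n, j <= k ->
  shift j m (shift k n t) = shift (m + k) n (shift j m t).
Proof.
  induction t; intros; cbn [shift subst]; f_equal; auto;
    try (rewrite ?IHt2, ?IHt by lia; f_equal; lia).
  cases_var.
Qed.

Lemma subst_shift t : forall j k n u, k <= j -> j <= k + n ->
  subst j u (shift k (S n) t) = shift k n t.
Proof.
  induction t; intros; cbn [shift subst]; f_equal; auto; try (apply IHt2 || apply IHt; lia).
  cases_var.
Qed.

Lemma shift_subst_le t : forall j k n u, k <= j ->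
  shift k n (subst j u t) = subst (n + j) u (shift k n t).
Proof.
  induction t; intros; cbn [shift subst]; f_equal; auto;
    try (rewrite ?IHt2, ?IHt by lia; f_equal; lia).
  cases_var.
  rewrite shift_shift_merge by lia. reflexivity.
Qed.

Lemma shift_subst_ge t : forall j k n u,
  shift (k + j) n (subst j u t) = subst j (shift k n u) (shift (S (k + j)) n t).
Proof.
  induction t; intros; cbn [shift subst]; f_equal; auto;
    try (rewrite plus_n_Sm; auto).
  cases_var.
  rewrite (shift_shift u (j := 0) (k := k)) by lia. f_equal; lia.
Qed.

Lemma shift_subst_0 t k n u :
  shift k n (subst 0 u t) = subst 0 (shift k n u) (shift (S k) n t).
Proof.
  rewrite <- (Nat.add_0_r k) at 1 3. apply shift_subst_ge.
Qed.

Lemma subst_subst t : forall j k u v,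
  subst (j + k) u (subst j v t) = subst j (subst k u v) (subst (S (j + k)) u t).
Proof.
  induction t; intros; [|cbn [subst]; f_equal; auto;
    (apply (IHt2 (S j)) || apply (IHt (S j))) ..].
  cases_var.
  - rewrite (shift_subst_le v (j := k)) by lia. reflexivity.
  - rewrite subst_shift by lia. reflexivity.
Qed.

Lemma subst_subst_0 t k u v :
  subst k u (subst 0 v t) = subst 0 (subst k u v) (subst (S k) u t).
Proof. apply (subst_subst t 0). Qed.

Fixpoint closed (k : nat) (t : tm) : bool :=
  match t with
  | Var x => Nat.ltb x k
  | Univ _ | Cst _ => true
  | Pi A B => closed k A && closed (S k) B
  | Lam b => closed (S k) b
  | App f a => closed k f && closed k a
  end.

Lemma closed_shift t : forall k j n, closed k t = true -> k <= j ->
  shift j n t = t.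
Proof.
  induction t; simpl; intros; rewrite ?andb_true_iff in *; f_equal; auto;
    try (eapply IHt1 || eapply IHt2 || eapply IHt); intuition eauto; try lia.
  apply Nat.ltb_lt in H. cases_var.
Qed.

Lemma closed_subst t : forall k j u, closed k t = true -> k <= j ->
  subst j u t = t.
Proof.
  induction t; simpl; intros; rewrite ?andb_true_iff in *; f_equal; auto;
    try (eapply IHt1 || eapply IHt2 || eapply IHt); intuition eauto; try lia.
  apply Nat.ltb_lt in H. cases_var.
Qed.

Lemma closed_cst_type c : closed 0 (cst_type c) = true.
Proof. destruct c; vm_compute; reflexivity. Qed.

Lemma shift_cst_type c k n : shift k n (cst_type c) = cst_type c.
Proof. apply closed_shift with 0; auto using closed_cst_type with arith. Qed.

Lemma subst_cst_type c k u : subst k u (cst_type c) = cst_type c.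
Proof. apply closed_subst with 0; auto using closed_cst_type with arith. Qed.

Lemma shift_iota t u k n : iota t u -> iota (shift k n t) (shift k n u).
Proof. destruct 1; simpl; econstructor. Qed.

Lemma subst_iota t u k v : iota t u -> iota (subst k v t) (subst k v u).
Proof. destruct 1; simpl; econstructor. Qed.

Lemma conv_shift t u : conv t u -> forall k n, conv (shift k n t) (shift k n u).
Proof.
  induction 1; intros; simpl; eauto using conv, shift_iota.
  - rewrite shift_subst_0. apply conv_beta.
  - change (S k) with (1 + k). rewrite <- (shift_shift f (j := 0)
    (k := k) 1 n) by lia. apply conv_eta.
Qed.

Lemma conv_subst t u : conv t u -> forall k v, conv (subst k v t) (subst k v u).
Proof.
  induction 1; intros; simpl; eauto using conv, subst_iota.
  - rewrite subst_subst_0. apply conv_beta.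
  - change (S k) with (1 + k). rewrite <- (shift_subst_le f (j := k)
    (k := 0) 1) by lia. apply conv_eta.
Qed.

Scheme wf_typing_ind := Minimality for wf Sort Prop
  with typing_wf_ind := Minimality for has_type Sort Prop.

Lemma wf_suffix Γ t A : has_type Γ t A ->
  forall Γ1 Γ2, Γ = Γ1 ++ Γ2 -> wf Γ2.
Proof.
  revert Γ t A.
  refine (@typing_wf_ind
    (fun Γ => forall Γ1 Γ2, Γ = Γ1 ++ Γ2 -> wf Γ2)
    (fun Γ _ _ => forall Γ1 Γ2, Γ = Γ1 ++ Γ2 -> wf Γ2)
    _ _ _ _ _ _ _ _ _ _); intros; eauto.
  - destruct Γ1; try discriminate. simpl in H. subst. constructor.
  - destruct Γ1; simpl in H1; [subst; eauto using wf_cons|].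
    injection H1; eauto.
  - apply (H0 (A :: Γ1)). simpl. congruence.
Qed.

Lemma has_type_wf Γ t A : has_type Γ t A -> wf Γ.
Proof. intros. eapply wf_suffix with (Γ1 := []); eauto. Qed.

Lemma wf_inv Γ A : wf (A :: Γ) -> exists l, has_type Γ A (Univ l).
Proof. inversion 1; eauto. Qed.

Inductive insertion (B : tm) : nat -> list tm -> list tm -> Prop :=
| ins_here Γ l : has_type Γ B (Univ l) -> insertion B 0 Γ (B :: Γ)
| ins_under k A Γ Γ' : insertion B k Γ Γ' ->
    insertion B (S k) (A :: Γ) (shift k 1 A :: Γ').

Lemma insertion_nth B k Γ Γ' : insertion B k Γ Γ' ->
  forall n A, nth_error Γ n = Some A ->
  exists A', nth_error Γ' (if Nat.leb k n then S n else n) = Some A' /\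
    shift 0 (S (if Nat.leb k n then S n else n)) A'
    = shift k 1 (shift 0 (S n) A).
Proof.
  induction 1; intros.
  - exists A. split; auto. cbn [Nat.leb]. rewrite shift_shift_merge by lia.
    reflexivity.
  - destruct n; simpl in H0.
    + injection H0; intros; subst. exists (shift k 1 A0). split; auto.
      change (S k) with (1 + k). rewrite shift_shift by lia. reflexivity.
    + destruct (IHinsertion _ _ H0) as (A' & E & E'). exists A'.
      cbn [Nat.leb]. destruct (Nat.leb k n); split; auto.
      * rewrite <- (shift_shift_merge A' (j := 0) (k := 0) 1), E' by lia.
        rewrite shift_shift, (shift_shift_merge A0) by lia. reflexivity.
      * rewrite <- (shift_shift_merge A' (j := 0) (k := 0) 1), E' by lia.
        rewrite shift_shift, (shift_shift_merge A0) by lia. reflexivity.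
Qed.

(** [wf Γ'] is carried along because [ty_Lam] has no premise on the domain: in that case the sort of
    the domain is read off the extended context. *)
Lemma weakening_gen Γ t A : has_type Γ t A ->
  forall B k Γ', insertion B k Γ Γ' ->
  wf Γ' /\ has_type Γ' (shift k 1 t) (shift k 1 A).
Proof.
  revert Γ t A.
  refine (@typing_wf_ind
    (fun Γ => forall B k Γ', insertion B k Γ Γ' -> wf Γ')
    (fun Γ t A => forall B k Γ', insertion B k Γ Γ' ->
       wf Γ' /\ has_type Γ' (shift k 1 t) (shift k 1 A))
    _ _ _ _ _ _ _ _ _ _); intros.
  - inversion H; subst. econstructor; eauto.
  - inversion H1; subst; [econstructor; eauto using wf_cons|].
    apply (wf_cons (l := l)). eapply H0; eauto.
  - split; eauto. destruct (insertion_nth H2 _ H1) as (A' & E & E').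
    cbn [shift]. rewrite <- E'. destruct (Nat.leb k n); constructor; eauto.
  - split; eauto. constructor; eauto.
  - split; eauto. cbn [shift]. rewrite shift_cst_type. constructor; eauto.
  - destruct (H0 _ _ _ H3). split; auto.
    constructor; auto. apply (H2 B0 (S k)). constructor; auto.
  - destruct (H0 _ _ _ (ins_under A H1)) as [W].
    destruct (wf_inv W). split; eauto using has_type_wf. constructor; auto.
  - destruct (H0 _ _ _ H3). destruct (H2 _ _ _ H3). split; auto.
    rewrite shift_subst_0. econstructor; eauto.
  - destruct (H0 _ _ _ H1). split; auto. constructor; auto.
  - destruct (H0 _ _ _ H4). destruct (H2 _ _ _ H4). split; auto.
    econstructor; eauto using conv_shift.
Qed.

Lemma weakening Γ t A B l : has_type Γ B (Univ l) -> has_type Γ t A ->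
  has_type (B :: Γ) (shift 0 1 t) (shift 0 1 A).
Proof. intros. eapply weakening_gen; eauto. econstructor; eauto. Qed.

Lemma weakening_closed t A Γ : closed 0 t = true -> closed 0 A = true ->
  has_type [] t A -> wf Γ -> has_type Γ t A.
Proof.
  intros. revert H2. induction Γ; intros; auto. inversion H2; subst.
  rewrite <- (closed_shift t 1 H (le_n 0)), <- (closed_shift A 1 H0 (le_n 0)).
  eapply weakening; eauto using has_type_wf.
Qed.

Lemma has_type_closed Γ t A : has_type Γ t A -> closed (length Γ) t = true.
Proof.
  induction 1; simpl in *; rewrite ?andb_true_iff; auto.
  apply Nat.ltb_lt, nth_error_Some. congruence.
Qed.

Lemma wf_nth Γ n A : wf Γ -> nth_error Γ n = Some A ->
  exists l, has_type Γ (shift 0 (S n) A) (Univ l).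
Proof.
  revert n. induction Γ as [|B Γ]; intros [|n] W E; simpl in E; try discriminate;
    destruct (wf_inv W) as [l T].
  - injection E; intros; subst. exists l. apply (weakening T T).
  - destruct (IHΓ n) as [l' T']; eauto using has_type_wf.
    exists l'. apply (weakening T) in T'.
    rewrite shift_shift_merge in T' by lia. exact T'.
Qed.

Inductive replacement (a : tm) : nat -> list tm -> list tm -> Prop :=
| repl_here A Γ : has_type Γ a A -> replacement a 0 (A :: Γ) Γ
| repl_under k A Γ Γ' : replacement a k Γ Γ' ->
    replacement a (S k) (A :: Γ) (subst k a A :: Γ').

Lemma replacement_nth a k Γ Γ' : replacement a k Γ Γ' -> wf Γ' ->
  forall n A, nth_error Γ n = Some A ->
  has_type Γ' (subst k a (Var n)) (subst k a (shift 0 (S n) A)).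
Proof.
  induction 1; intros W n B E.
  - rewrite subst_shift by lia. destruct n; simpl in E.
    + injection E; intros; subst. cbn [subst Nat.compare].
      rewrite !shift_0. auto.
    + cbn [subst Nat.compare Nat.pred]. constructor; auto.
  - destruct (wf_inv W) as [l T]. destruct n; simpl in E.
    + injection E; intros; subst.
      change (S k) with (1 + k). rewrite <- (shift_subst_le B (k := 0)) by lia.
      cbn [subst plus Nat.compare]. constructor; auto.
    + assert (T' := IHreplacement (has_type_wf T) n B E).
      apply (weakening T) in T'.
      rewrite !shift_subst_le, shift_shift_merge in T' by lia.
      exact T'.
Qed.

Lemma substitution_gen Γ t A : has_type Γ t A ->
  forall a k Γ', replacement a k Γ Γ' ->
  wf Γ' /\ has_type Γ' (subst k a t) (subst k a A).
Proof.
  revert Γ t A.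
  refine (@typing_wf_ind
    (fun Γ => forall a k Γ', replacement a k Γ Γ' -> wf Γ')
    (fun Γ t A => forall a k Γ', replacement a k Γ Γ' ->
       wf Γ' /\ has_type Γ' (subst k a t) (subst k a A))
    _ _ _ _ _ _ _ _ _ _); intros.
  - inversion H.
  - inversion H1; subst; [eauto using has_type_wf|].
    apply (wf_cons (l := l)). eapply H0; eauto.
  - split; eauto. eapply replacement_nth; eauto.
  - split; eauto. constructor; eauto.
  - split; eauto. rewrite subst_cst_type. constructor; eauto.
  - destruct (H0 _ _ _ H3). split; auto.
    constructor; auto. apply (H2 a (S k)). constructor; auto.
  - destruct (H0 _ _ _ (repl_under A H1)) as [W].
    destruct (wf_inv W). split; eauto using has_type_wf. constructor; auto.
  - destruct (H0 _ _ _ H3). destruct (H2 _ _ _ H3). split; auto.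
    rewrite subst_subst_0. econstructor; eauto.
  - destruct (H0 _ _ _ H1). split; auto. constructor; auto.
  - destruct (H0 _ _ _ H4). destruct (H2 _ _ _ H4). split; auto.
    econstructor; eauto using conv_subst.
Qed.

Lemma substitution Γ A a t B : has_type (A :: Γ) t B -> has_type Γ a A ->
  has_type Γ (subst 0 a t) (subst 0 a B).
Proof. intros. eapply substitution_gen; eauto. constructor; auto. Qed.

Lemma Pi_inv Γ A B S : has_type Γ (Pi A B) S ->
  exists l, has_type Γ A (Univ l) /\ has_type (A :: Γ) B (Univ l).
Proof.
  intros H. remember (Pi A B) as t. induction H; try discriminate; auto.
  injection Heqt; intros; subst. eauto.
Qed.

Lemma cumulativity Γ A l m : has_type Γ A (Univ l) -> l <= m ->
  has_type Γ A (Univ m).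
Proof. induction 2; auto using ty_cumul. Qed.

(** * A type checker *)

(* References to the entries of a list of closed terms are encoded as
   [cEmptyInd] at levels that are not otherwise used. *)
Definition ref (k : nat) : cst := cEmptyInd (3 + k).

Scheme Equality for cst.
(* The conditionals, unlike [andb] and [orb], are not strict in [vm_compute]. *)
Fixpoint tm_beq (t u : tm) : bool :=
  match t, u with
  | Var i, Var j => Nat.eqb i j
  | Univ i, Univ j => Nat.eqb i j
  | Pi a b, Pi c d | App a b, App c d => if tm_beq a c then tm_beq b d else false
  | Lam b, Lam c => tm_beq b c
  | Cst c, Cst d => cst_beq c d
  | _, _ => false
  end.

Lemma if_andb (a b : bool) : (if a then b else false) = a && b.
Proof. reflexivity. Qed.

Lemma if_orb (a b : bool) : (if a then true else b) = a || b.
Proof. reflexivity. Qed.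

Lemma tm_beq_eq t : forall u, tm_beq t u = true -> t = u.
Proof.
  induction t; destruct u; simpl; try discriminate;
    rewrite ?if_andb, ?andb_true_iff; intros H; f_equal;
    try apply Nat.eqb_eq; try apply internal_cst_dec_bl; intuition auto.
Qed.

Section Conversion.

(* The types of the entries, and the bodies of those that may be unfolded. *)
Variable env : list (tm * option tm).

(** [δ] governs the unfolding of references at the head only. Scrutinees are always reduced with
    unfolding, since an eliminator would otherwise be stuck on a defined constructor; if no
    constructor appears, the original spine is returned, so that terms stay folded. *)
Fixpoint whnf (n : nat) (δ : bool) (t : tm) (xs : list tm) : tm * list tm :=
  match n with
  | 0 => (t, xs)
  | S n =>
    match t, xs with
    | App f a, _ => whnf n δ f (a :: xs)
    | Lam b, x :: xs => whnf n δ (subst 0 x b) xs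
    | Cst (cNatInd m), P :: z :: s :: x :: ys =>
        match whnf n true x [] with
        | (Cst cZero, []) => whnf n δ z ys
        | (Cst cSucc, [k]) =>
            whnf n δ s (k :: apps (Cst (cNatInd m)) [P; z; s; k] :: ys)
        | _ => (t, xs)
        end
    | Cst (cSigInd _ _), _ :: _ :: _ :: f :: x :: ys =>
        match whnf n true x [] with
        | (Cst (cPair _), [_; _; a; b]) => whnf n δ f (a :: b :: ys)
        | _ => (t, xs)
        end
    | Cst (cJ _ _), _ :: _ :: _ :: d :: _ :: p :: ys =>
        match whnf n true p [] with
        | (Cst (cRefl _), [_; _]) => whnf n δ d ys
        | _ => (t, xs)
        end
    | Cst (cRPInd _), _ :: b :: _ :: _ :: x :: ys =>
        match whnf n true x [] with
        | (Cst cRPpt, []) => whnf n δ b ys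
        | _ => (t, xs)
        end
    | Cst (cKInd _), _ :: b :: _ :: _ :: _ :: x :: ys =>
        match whnf n true x [] with
        | (Cst cKpt, []) => whnf n δ b ys
        | _ => (t, xs)
        end
    | Cst (cSuspInd _ _), _ :: _ :: no :: so :: _ :: x :: ys =>
        match whnf n true x [] with
        | (Cst (cNorth _), [_]) => whnf n δ no ys
        | (Cst (cSouth _), [_]) => whnf n δ so ys
        | _ => (t, xs)
        end
    | Cst (cTrInd _ _), _ :: _ :: _ :: _ :: f :: x :: ys =>
        match whnf n true x [] with
        | (Cst (cTr _), [_; _; a]) => whnf n δ f (a :: ys)
        | _ => (t, xs)
        end
    | Cst (cEMInd _ _), _ :: _ :: _ :: b :: _ :: _ :: x :: ys =>
        match whnf n true x [] with
        | (Cst (cEMpt _), [_; _]) => whnf n δ b ys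
        | _ => (t, xs)
        end
    | Cst (cEmptyInd (S (S (S k)))), _ =>
        match δ, nth_error env k with
        | true, Some (_, Some b) => whnf n δ b xs
        | _, _ => (t, xs)
        end
    | _, _ => (t, xs)
    end
  end.

Definition hd_form (n : nat) (t : tm) : tm :=
  let (h, xs) := whnf n true t [] in apps h xs.

Fixpoint beta_nf (n : nat) (t : tm) : tm :=
  match n with
  | 0 => t
  | S n =>
    match t with
    | Pi A B => Pi (beta_nf n A) (beta_nf n B)
    | Lam b => Lam (beta_nf n b)
    | App f a =>
        match beta_nf n f with
        | Lam b => beta_nf n (subst 0 a b)
        | f' => App f' (beta_nf n a)
        end
    | _ => t
    end
  end.

Definition unfolding (t : tm) : option (nat * tm) :=
  match t with
  | Cst (cEmptyInd (S (S (S k)))) =>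
      match nth_error env k with
      | Some (_, Some b) => Some (k, b)
      | _ => None
      end
  | _ => None
  end.

(** Unfolding is lazy: folded heads with their arguments are compared first. If this fails and both
    heads are distinct transparent entries, the later one is unfolded, as it may be defined through
    the earlier one. *)
Fixpoint conv_check (n : nat) (t u : tm) : bool :=
  match n with
  | 0 => false
  | S n =>
    if tm_beq t u then true else
    let (h, xs) := whnf n false t [] in
    let (k, ys) := whnf n false u [] in
    let fix args xs ys :=
      match xs, ys with
      | [], [] => true
      | x :: xs, y :: ys => if conv_check n x y then args xs ys else false
      | _, _ => false
      end in
    if match h, k with
    | Lam b, Lam c => match xs, ys with [], [] => conv_check n b c | _, _ => false end
    | Lam b, _ =>
        match xs with
        | [] => conv_check n b (App (shift 0 1 (apps k ys)) (Var 0))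
        | _ => false
        end
    | _, Lam c =>
        match ys with
        | [] => conv_check n (App (shift 0 1 (apps h xs)) (Var 0)) c
        | _ => false
        end
    | Pi A B, Pi A' B' => if conv_check n A A' then
        if conv_check n B B' then args xs ys else false else false
    | Var i, Var j => if Nat.eqb i j then args xs ys else false
    | Univ l, Univ m => if Nat.eqb l m then args xs ys else false
    | Cst c, Cst d => if cst_beq c d then args xs ys else false
    | _, _ => false
    end then true else
    match unfolding h, unfolding k with
    | Some (i, b), Some (j, c) =>
        match Nat.compare i j with
        | Lt => conv_check n (apps h xs) (apps c ys)
        | Gt => conv_check n (apps b xs) (apps k ys)
        | Eq => conv_check n (apps b xs) (apps c ys)
        end
    | Some (_, b), None => conv_check n (apps b xs) (apps k ys)
    | None, Some (_, c) => conv_check n (apps h xs) (apps c ys)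
    | None, None => false
    end
  end.

(** Soundness is shown for any congruence [R] that contains the rules. It is later taken to be
    convertibility of interpretations; there a transparent reference and its body coincide, which
    justifies unfolding although [conv] has no such rule. *)
Variable R : tm -> tm -> Prop.
Hypothesis R_refl : forall t, R t t.
Hypothesis R_sym : forall t u, R t u -> R u t.
Hypothesis R_trans : forall t u v, R t u -> R u v -> R t v.
Hypothesis R_Pi : forall A A' B B', R A A' -> R B B' -> R (Pi A B) (Pi A' B').
Hypothesis R_Lam : forall b b', R b b' -> R (Lam b) (Lam b').
Hypothesis R_App : forall f f' a a', R f f' -> R a a' -> R (App f a) (App f' a').
Hypothesis R_beta : forall b a, R (App (Lam b) a) (subst 0 a b).
Hypothesis R_eta : forall f, R (Lam (App (shift 0 1 f) (Var 0))) f.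
Hypothesis R_iota : forall t u, iota t u -> R t u.
Hypothesis R_delta : forall k A b, nth_error env k = Some (A, Some b) ->
  R (Cst (ref k)) b.

Lemma apps_app f xs ys : apps f (xs ++ ys) = apps (apps f xs) ys.
Proof. revert f. induction xs; simpl; auto. Qed.

Lemma apps_R xs : forall f g, R f g -> R (apps f xs) (apps g xs).
Proof. induction xs; simpl; intros; auto. Qed.

Lemma apps_args f xs ys : Forall2 R xs ys -> R (apps f xs) (apps f ys).
Proof.
  intros H. revert f. induction H; intros; simpl; [apply R_refl|].
  eapply R_trans; [apply IHForall2|].
  apply apps_R. auto using R_App, R_refl.
Qed.

Lemma apps_iota c x x' zs r ys :
  R x x' -> iota (apps (Cst c) (zs ++ [x'])) r ->
  R (apps (Cst c) (zs ++ x :: ys)) (apps r ys).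
Proof.
  intros. change (x :: ys) with ([x] ++ ys). rewrite app_assoc, apps_app.
  apply apps_R. eapply R_trans; [|apply R_iota, H0].
  rewrite !apps_app. simpl. auto using R_App, R_refl.
Qed.

Ltac prefix l x :=
  match l with
  | x :: _ => constr:(@nil tm)
  | ?y :: ?l => let zs := prefix l x in constr:(y :: zs)
  end.

Lemma whnf_R n : forall δ t xs,
  R (apps t xs) (apps (fst (whnf n δ t xs)) (snd (whnf n δ t xs))).
Proof.
  induction n; intros; [apply R_refl|].
  assert (E : forall x h ys, whnf n true x [] = (h, ys) -> R x (apps h ys)).
  { intros. specialize (IHn true x []). rewrite H in IHn. exact IHn. }
  assert (K : forall u ys v zs, R (apps u ys) (apps v zs) ->
    R (apps u ys) (apps (fst (whnf n δ v zs)) (snd (whnf n δ v zs)))).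
  { intros. eapply R_trans; eauto. }
  cbn [whnf].
  destruct t; try apply R_refl.
  - destruct xs; [apply R_refl|]. apply (K (App (Lam t) t0) xs). apply apps_R, R_beta.
  - apply (K t1 (t2 :: xs)). apply R_refl.
  - destruct c; try apply R_refl;
    try (do 3 (destruct m; [apply R_refl|]);
      destruct δ; [|apply R_refl];
      destruct (nth_error env m) as [[A [b|]]|] eqn:L; try apply R_refl;
      apply K, apps_R; apply (R_delta _ L));
    repeat (destruct xs as [|? xs]; [apply R_refl|]);
    match goal with |- context [whnf n true ?x []] =>
      destruct (whnf n true x []) as [h ys] eqn:W; apply E in W;
      destruct h; try apply R_refl;
      match goal with c : cst |- _ => destruct c; try apply R_refl end;
      repeat (destruct ys as [|? ys]; try apply R_refl); apply K;
      match type of W with R ?x _ =>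
      match goal with |- R (apps (Cst ?c) ?l) _ =>
        let zs := prefix l x in
        refine (R_trans (apps_iota c zs _ W _) _);
          [econstructor|apply R_refl]
      end end
    end.
Qed.

Lemma hd_form_R n t : R t (hd_form n t).
Proof.
  assert (H := whnf_R n true t []). unfold hd_form. destruct (whnf n true t []). exact H.
Qed.

Lemma beta_nf_R n : forall t, R t (beta_nf n t).
Proof.
  induction n; intros; [apply R_refl|]. cbn [beta_nf].
  destruct t; try apply R_refl; auto using R_Pi, R_Lam.
  assert (H := IHn t1).
  destruct (beta_nf n t1); auto using R_App.
  eapply R_trans; [|apply IHn]. eapply R_trans; [|apply R_beta].
  auto using R_App, R_refl.
Qed.

Lemma unfolding_R t k b : unfolding t = Some (k, b) -> R t b.
Proof.
  destruct t as [| | | | |c]; try discriminate. destruct c; try discriminate.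
  do 3 (destruct m; [discriminate|]). cbn [unfolding].
  destruct (nth_error env m) as [[A [c|]]|] eqn:L; try discriminate.
  injection 1; intros; subst. apply (R_delta _ L).
Qed.

Lemma conv_check_sound n : forall t u, conv_check n t u = true -> R t u.
Proof.
  induction n; simpl; intros t u; [discriminate|].
  destruct (tm_beq t u) eqn:E; simpl.
  { apply tm_beq_eq in E. subst. intros. apply R_refl. }
  assert (Ht := whnf_R n false t []). assert (Hu := whnf_R n false u []).
  destruct (whnf n false t []) as [h xs]. destruct (whnf n false u []) as [k ys].
  set (args := fix args xs ys := match xs, ys with
      | [], [] => true
      | x :: xs, y :: ys => if conv_check n x y then args xs ys else false
      | _, _ => false
      end).
  assert (A : forall xs ys, args xs ys = true -> Forall2 R xs ys).
  { induction xs0; destruct ys0; simpl; try discriminate; auto.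
    rewrite if_andb, andb_true_iff. intros []. auto. }
  simpl in Ht, Hu. intros H.
  cut (R (apps h xs) (apps k ys)).
  { intros C. eapply R_trans; [exact Ht|].
    eapply R_trans; [exact C|]. apply R_sym, Hu. }
  rewrite if_orb in H. apply orb_true_iff in H. destruct H as [H|H].
  - assert (B : forall f g, R f g -> args xs ys = true ->
      R (apps f xs) (apps g ys)).
    { intros. eapply R_trans; [apply apps_args, A; eassumption|].
      apply apps_R; auto. }
    assert (Eta : forall b f, conv_check n b (App (shift 0 1 f) (Var 0)) = true ->
      R (Lam b) f).
    { intros. eapply R_trans; [apply R_Lam, IHn; eassumption|].
      apply R_eta. }
    assert (Eta' : forall b f, conv_check n (App (shift 0 1 f) (Var 0)) b = true ->
      R f (Lam b)).
    { intros. apply R_sym.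
      eapply R_trans; [apply R_Lam, R_sym, IHn; eassumption|].
      apply R_eta. }
    destruct h, k; try discriminate;
      rewrite ?if_andb, ?andb_true_iff in H;
      try (destruct xs; [|discriminate H]); try (destruct ys; [|discriminate H]);
      try (apply Eta; exact H); try (apply Eta'; exact H);
      try (simpl; apply R_Lam; auto; fail).
    + destruct H as [H]. apply Nat.eqb_eq in H. subst. auto using R_refl.
    + destruct H as [H]. apply Nat.eqb_eq in H. subst. auto using R_refl.
    + destruct H as (H & H' & H''). auto using R_Pi.
    + destruct H as [H]. apply internal_cst_dec_bl in H. subst. auto using R_refl.
  - destruct (unfolding h) as [[i b]|] eqn:Uh; [apply unfolding_R in Uh|];
      (destruct (unfolding k) as [[j c]|] eqn:Uk; [apply unfolding_R in Uk|]);
      try discriminate; try destruct (Nat.compare i j); apply IHn in H;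
      try (refine (R_trans _ H); apply apps_R; exact Uh);
      try (refine (R_trans H _); apply R_sym, apps_R; exact Uk).
    refine (R_trans (apps_R xs Uh) (R_trans H _)). apply R_sym, apps_R, Uk.
Qed.

End Conversion.

(** * Symbolic universe levels and the interpretation of checked terms *)

Definition map_levels (f : nat -> nat) (c : cst) : cst :=
  match c with
  | cEmptyInd m => cEmptyInd (f m)
  | cUnitInd m => cUnitInd (f m)
  | cSum l => cSum (f l)
  | cInl l => cInl (f l)
  | cInr l => cInr (f l)
  | cSumInd l m => cSumInd (f l) (f m)
  | cNatInd m => cNatInd (f m)
  | cSig l => cSig (f l)
  | cPair l => cPair (f l)
  | cSigInd l m => cSigInd (f l) (f m)
  | cId l => cId (f l)
  | cRefl l => cRefl (f l)
  | cJ l m => cJ (f l) (f m)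
  | cFunext l => cFunext (f l)
  | cUA l => cUA (f l)
  | cRPInd m => cRPInd (f m)
  | cRPbeta m => cRPbeta (f m)
  | cKInd m => cKInd (f m)
  | cKbeta m => cKbeta (f m)
  | cSusp l => cSusp (f l)
  | cNorth l => cNorth (f l)
  | cSouth l => cSouth (f l)
  | cMerid l => cMerid (f l)
  | cSuspInd l m => cSuspInd (f l) (f m)
  | cSuspBeta l m => cSuspBeta (f l) (f m)
  | cTrunc l => cTrunc (f l)
  | cTr l => cTr (f l)
  | cTrLevel l => cTrLevel (f l)
  | cTrInd l m => cTrInd (f l) (f m)
  | cEM l => cEM (f l)
  | cEMpt l => cEMpt (f l)
  | cEMloop l => cEMloop (f l)
  | cEMsq l => cEMsq (f l)
  | cEMInd l m => cEMInd (f l) (f m)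
  | cEMbeta l m => cEMbeta (f l) (f m)
  | c => c
  end.

(* The checker runs on terms without free level variables: the level [S k]
   stands for [l + k], where [l] is arbitrary, and [0] for itself. *)
Definition level (l k : nat) : nat :=
  match k with 0 => 0 | S k => k + l end.

Lemma level_mono l j k : j <= k -> level l j <= level l k.
Proof. destruct j, k; simpl; lia. Qed.

Lemma level_max l j k : level l (Nat.max j k) = Nat.max (level l j) (level l k).
Proof. destruct j, k; simpl; lia. Qed.

(** A reference out of range becomes [tt], a closed default, so that interpretation commutes with
    shifting and substitution for all terms. *)
Fixpoint den (l : nat) (ρ : list tm) (t : tm) : tm :=
  match t with
  | Var x => Var x
  | Univ k => Univ (level l k)
  | Pi A B => Pi (den l ρ A) (den l ρ B)
  | Lam b => Lam (den l ρ b)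
  | App f a => App (den l ρ f) (den l ρ a)
  | Cst (cEmptyInd (S (S (S k)))) => nth k ρ (Cst cTt)
  | Cst c => Cst (map_levels (level l) c)
  end.

Fixpoint refs_below (n : nat) (t : tm) : bool :=
  match t with
  | Var _ | Univ _ => true
  | Pi a b | App a b => refs_below n a && refs_below n b
  | Lam b => refs_below n b
  | Cst (cEmptyInd (S (S (S k)))) => Nat.ltb k n
  | Cst _ => true
  end.

Definition closed_list (ρ : list tm) := Forall (fun t => closed 0 t = true) ρ.

Section Denotation.

Variables (l : nat) (ρ : list tm).
Hypothesis Hρ : closed_list ρ.

Notation "⟦ t ⟧" := (den l ρ t).

Lemma den_Cst c : (exists k, c = ref k) \/ ⟦Cst c⟧ = Cst (map_levels (level l) c).
Proof. destruct c; auto. do 3 (destruct m; auto). left. exists m. reflexivity. Qed.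

Lemma den_ref k : ⟦Cst (ref k)⟧ = nth k ρ (Cst cTt).
Proof. reflexivity. Qed.

Lemma closed_ref k : closed 0 (nth k ρ (Cst cTt)) = true.
Proof.
  destruct (nth_in_or_default k ρ (Cst cTt)) as [H|H]; [|rewrite H; reflexivity].
  unfold closed_list in Hρ. rewrite Forall_forall in Hρ. auto.
Qed.

Lemma den_shift t : forall k n, ⟦shift k n t⟧ = shift k n ⟦t⟧.
Proof.
  induction t; intros; cbn [den shift]; f_equal; auto.
  fold (den l ρ (Cst c)). destruct (den_Cst c) as [[i ->]|E].
  - rewrite den_ref, (closed_shift _ _ (closed_ref i)); auto with arith.
  - rewrite E. reflexivity.
Qed.

Lemma den_subst t : forall k u, ⟦subst k u t⟧ = subst k ⟦u⟧ ⟦t⟧.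
Proof.
  induction t; intros; cbn [den subst]; f_equal; auto.
  - destruct (Nat.compare n k); auto using den_shift.
  - fold (den l ρ (Cst c)). destruct (den_Cst c) as [[i ->]|E].
    + rewrite den_ref, (closed_subst _ _ (closed_ref i)); auto with arith.
    + rewrite E. reflexivity.
Qed.

Lemma den_conv t u : conv t u -> conv ⟦t⟧ ⟦u⟧.
Proof.
  induction 1; cbn [den]; eauto using conv.
  - rewrite den_subst. apply conv_beta.
  - fold (den l ρ (Var 0)). rewrite den_shift. apply conv_eta.
  - apply conv_iota. destruct H; cbn [den apps map_levels]; econstructor.
Qed.

Lemma den_closed t k : closed k t = true -> closed k ⟦t⟧ = true.
Proof.
  revert k. induction t; cbn [den closed]; intros; rewrite ?andb_true_iff in *;
    intuition auto.
  fold (den l ρ (Cst c)). destruct (den_Cst c) as [[i ->]|E].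
  - generalize (closed_ref i). rewrite den_ref. generalize (nth i ρ (Cst cTt)).
    assert (M : forall t j k, closed j t = true -> j <= k -> closed k t = true).
    { clear. induction t; simpl; intros; rewrite ?andb_true_iff in *;
        rewrite ?Nat.ltb_lt in *; intuition (eauto with arith; lia). }
    intros. eapply M; eauto with arith.
  - rewrite E. reflexivity.
Qed.

(** The types of the constants in the second case mention the successor of this level, and [level l]
    commutes with [S] only from 1 on: it sends 0 to 0 but 1 to [l]. Above 2, [cEmptyInd] encodes
    references. *)
Definition cst_ok (c : cst) : bool :=
  match c with
  | cEmptyInd m => Nat.leb m 2
  | cUA l | cTrLevel l | cTrInd _ l => Nat.leb 1 l
  | _ => true
  end.

Lemma den_cst_type c : cst_ok c = true ->
  ⟦cst_type c⟧ = cst_type (map_levels (level l) c) /\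
  ⟦Cst c⟧ = Cst (map_levels (level l) c).
Proof.
  destruct c; try (intros; split; vm_compute; reflexivity).
  - do 3 (destruct m; [intros; split; vm_compute; reflexivity|]). discriminate.
  - destruct l0; [discriminate|]. intros; split; vm_compute; reflexivity.
  - destruct l0; [discriminate|]. intros; split; vm_compute; reflexivity.
  - destruct m; [discriminate|]. intros; split; vm_compute; reflexivity.
  (* The type of [cEMbeta] contains the maximum of its two levels, which [level l] preserves only
     propositionally. *)
  - split; [|reflexivity]. cbn [map_levels].
    match goal with |- context [cEMbeta ?j ?k] => assert (M := level_max l j k) end.
    vm_compute. vm_compute in M. rewrite M. reflexivity.
Qed.

End Denotation.

Lemma den_app l ρ ρ' t : refs_below (length ρ) t = true ->
  den l (ρ ++ ρ') t = den l ρ t.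
Proof.
  induction t; cbn [den refs_below]; rewrite ?andb_true_iff;
    intuition (f_equal; auto).
  destruct c; auto. do 3 (destruct m; auto).
  apply app_nth1, Nat.ltb_lt. assumption.
Qed.

Lemma refs_below_mono m n t : m <= n -> refs_below m t = true ->
  refs_below n t = true.
Proof.
  intros L. induction t; cbn [refs_below]; rewrite ?andb_true_iff;
    intuition auto.
  destruct c; auto. do 3 (destruct m0; auto).
  apply Nat.ltb_lt. apply Nat.ltb_lt in H. lia.
Qed.

(** * Type inference and its soundness *)

Section Inference.

Variables (sig : cst -> bool) (env : list (tm * option tm)) (fuel : nat).

(** [Univ 0] is placed in level 2 because [level l 1] is [l], which may be 0, while [level l 2] is
    positive. A redex is typed through its argument, which supplies the domain that [Lam] does not
    carry. *)
Fixpoint infer (n : nat) (Γ : list tm) (t : tm) : option tm :=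
  match n with
  | 0 => None
  | S n =>
    match t with
    | Var x => option_map (shift 0 (S x)) (nth_error Γ x)
    | Univ k => Some (Univ (match k with 0 => 2 | _ => S k end))
    | Cst (cEmptyInd (S (S (S k)))) => option_map fst (nth_error env k)
    | Cst c => if sig c && cst_ok c then Some (cst_type c) else None
    | Pi A B =>
        match sort n Γ A, sort n (A :: Γ) B with
        | Some j, Some k => Some (Univ (Nat.max j k))
        | _, _ => None
        end
    | App (Lam b) a =>
        match infer n Γ a with
        | Some A => option_map (subst 0 a) (infer n (A :: Γ) b)
        | None => None
        end
    | App f a =>
        match infer n Γ f with
        | Some F =>
            match domain n Γ F with
            | Some (A, B) => if check n Γ a A then Some (subst 0 a B) else None
            | None => None
            end
        | None => None
        end
    | Lam _ => None
    end
  end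
with check (n : nat) (Γ : list tm) (t T : tm) : bool :=
  match n with
  | 0 => false
  | S n =>
    match t with
    | Lam b =>
        match domain n Γ T with
        | Some (A, B) => check n (A :: Γ) b B
        | None => false
        end
    | _ =>
        match infer n Γ t with
        | Some T' =>
            if conv_check env fuel T' T then true else
            match hd_form env fuel T', hd_form env fuel T with
            | Univ j, Univ k => Nat.leb j k
            | _, _ => false
            end
        | None => false
        end
    end
  end
with sort (n : nat) (Γ : list tm) (A : tm) : option nat :=
  match n with
  | 0 => None
  | S n =>
    match infer n Γ A with
    | Some T => match hd_form env fuel T with Univ k => Some k | _ => None end
    | None => None
    end
  end
(* Types are kept as they are inferred; when one must be reduced to expose a
   product, the result is checked again, which spares subject reduction. *)
with domain (n : nat) (Γ : list tm) (F : tm) : option (tm * tm) :=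
  match n with
  | 0 => None
  | S n =>
    match F with
    | Pi A B => Some (A, B)
    | _ =>
        let F' := beta_nf fuel (hd_form env fuel F) in
        match F', infer n Γ F' with
        | Pi A B, Some _ => Some (A, B)
        | _, _ => None
        end
    end
  end.

Variables (l : nat) (ρ : list tm).

Notation "⟦ t ⟧" := (den l ρ t).
Notation "⟪ Γ ⟫" := (map (den l ρ) Γ).
Notation is_type Γ A := (exists k, has_type ⟪Γ⟫ ⟦A⟧ (Univ k)).

(** A transparent entry is interpreted by the very term that interprets its body, so unfolding does
    not change interpretations. The bounds on references allow [ρ] to grow without affecting earlier
    entries. *)
Definition env_model : Prop := length ρ = length env /\
  forall k A b, nth_error env k = Some (A, b) ->
  has_type [] ⟦Cst (ref k)⟧ ⟦A⟧ /\ is_type [] A /\ closed 0 A = true /\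
  refs_below (length ρ) A = true /\
  forall t, b = Some t -> ⟦Cst (ref k)⟧ = ⟦t⟧ /\ refs_below (length ρ) t = true.

Hypothesis env_typed : env_model.
Hypothesis sig_typed : forall c, sig c && cst_ok c = true ->
  exists k, has_type [] (cst_type (map_levels (level l) c)) (Univ k).

Lemma closed_env : closed_list ρ.
Proof.
  destruct env_typed as [E H]. apply Forall_forall. intros t I.
  destruct (In_nth _ _ (Cst cTt) I) as (k & L & <-). rewrite E in L.
  destruct (nth_error env k) as [[A b]|] eqn:N.
  - destruct (H _ _ _ N) as [T _]. apply has_type_closed in T. exact T.
  - apply nth_error_None in N. lia.
Qed.

Ltac den_rules := intros; cbv beta in *;
  first
  [ apply conv_refl
  | apply conv_sym; assumption
  | eapply conv_trans; eassumption
  | apply conv_Pi; assumption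
  | apply conv_Lam; assumption
  | apply conv_App; assumption
  | apply den_conv; [apply closed_env|];
    solve [auto using conv_beta, conv_eta, conv_iota]
  | destruct env_typed as [_ M];
    match goal with H : nth_error _ _ = _ |- _ =>
      destruct (M _ _ _ H) as (_ & _ & _ & _ & D); rewrite (proj1 (D _ eq_refl));
      apply conv_refl
    end ].

Lemma den_conv_check t u : conv_check env fuel t u = true -> conv ⟦t⟧ ⟦u⟧.
Proof.
  apply (@conv_check_sound env (fun t u => conv ⟦t⟧ ⟦u⟧)); den_rules.
Qed.

Lemma den_hd_form t : conv ⟦t⟧ ⟦hd_form env fuel t⟧.
Proof.
  apply (@hd_form_R env (fun t u => conv ⟦t⟧ ⟦u⟧)); den_rules.
Qed.

Lemma den_beta_nf t : conv ⟦t⟧ ⟦beta_nf fuel t⟧.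
Proof.
  apply (@beta_nf_R (fun t u => conv ⟦t⟧ ⟦u⟧)); den_rules.
Qed.

Lemma is_type_closed Γ A : wf Γ -> closed 0 A = true ->
  (exists k, has_type [] A (Univ k)) -> exists k, has_type Γ A (Univ k).
Proof.
  intros W C [k T]. exists k. apply weakening_closed; auto.
Qed.

Lemma Pi_is_type Γ A B : (exists k, has_type Γ (Pi A B) (Univ k)) <->
  (exists k, has_type Γ A (Univ k)) /\ (exists k, has_type (A :: Γ) B (Univ k)).
Proof.
  split.
  - intros [k H]. apply Pi_inv in H. destruct H as (j & ? & ?). eauto.
  - intros [[j H] [k H']]. exists (Nat.max j k).
    constructor; eapply cumulativity; eauto with arith.
Qed.

(** Well-formedness of the inferred types is part of the induction, because [ty_conv] demands it of
    the type that is converted to. *)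
Lemma infer_sound n :
  (forall Γ t A, wf ⟪Γ⟫ -> infer n Γ t = Some A ->
     has_type ⟪Γ⟫ ⟦t⟧ ⟦A⟧ /\ is_type Γ A) /\
  (forall Γ t A, is_type Γ A -> check n Γ t A = true ->
     has_type ⟪Γ⟫ ⟦t⟧ ⟦A⟧) /\
  (forall Γ A k, wf ⟪Γ⟫ -> sort n Γ A = Some k ->
     has_type ⟪Γ⟫ ⟦A⟧ (Univ (level l k))) /\
  (forall Γ F A B, is_type Γ F -> domain n Γ F = Some (A, B) ->
     conv ⟦F⟧ (Pi ⟦A⟧ ⟦B⟧) /\ is_type Γ A /\ is_type (A :: Γ) B).
Proof.
  assert (Hρ := closed_env).
  induction n as [|n (infer_ok & check_ok & sort_ok & domain_ok)].
  { repeat split; intros; discriminate. }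
  assert (conv_hd := den_hd_form).
  split; [|split; [|split]].
  - intros Γ t A W H. destruct t; cbn [infer] in H.
    + destruct (nth_error Γ n0) as [B|] eqn:E; [|discriminate].
      injection H; intros; subst. apply (map_nth_error (den l ρ)) in E.
      rewrite den_shift by auto. split; [constructor; auto|].
      eapply wf_nth; eauto.
    + injection H; intros; subst. cbn [den]. split.
      * apply cumulativity with (S (level l l0)); [constructor; auto|].
        destruct l0; simpl; lia.
      * eexists. constructor; auto.
    + destruct (sort n Γ t1) as [j|] eqn:E1; [|discriminate].
      destruct (sort n (t1 :: Γ) t2) as [k|] eqn:E2; [|discriminate].
      injection H; intros; subst. apply sort_ok in E1; auto.
      apply sort_ok in E2; [|econstructor; eauto]. cbn [den].
      rewrite level_max. split; [|eexists; constructor; auto].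
      constructor; eapply cumulativity; eauto with arith.
    + discriminate.
    + assert (R : (exists b B C, t1 = Lam b /\ infer n Γ t2 = Some B /\
          infer n (B :: Γ) b = Some C /\ A = subst 0 t2 C) \/
        match infer n Γ t1 with
        | Some F =>
            match domain n Γ F with
            | Some (A, B) => if check n Γ t2 A then Some (subst 0 t2 B) else None
            | None => None
            end
        | None => None
        end = Some A).
      { destruct t1; auto. left.
        destruct (infer n Γ t2) as [B|] eqn:EB; [|discriminate].
        destruct (infer n (B :: Γ) t1) as [C|] eqn:EC; [|discriminate].
        injection H. intros. exists t1, B, C. auto. }
      clear H. destruct R as [(b & B & C & -> & EB & EC & ->)|H].
      { apply infer_ok in EB; auto. destruct EB as [TB [k IB]].
        apply infer_ok in EC; [|econstructor; eauto]. destruct EC as [TC [j IC]].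
        rewrite den_subst by auto. cbn [den]. split.
        - econstructor; [constructor; exact TC|exact TB].
        - exists j. apply (substitution IC TB). }
      destruct (infer n Γ t1) as [F|] eqn:EF; [|discriminate].
      destruct (domain n Γ F) as [[B C]|] eqn:ED; [|discriminate].
      destruct (check n Γ t2 B) eqn:EC; [|discriminate].
      injection H; intros; subst.
      apply infer_ok in EF; auto. destruct EF as [TF IF].
      destruct (domain_ok _ _ _ _ IF ED) as (CF & IB & IC).
      apply check_ok in EC; auto. rewrite den_subst by auto. cbn [den]. split.
      * destruct (proj2 (Pi_is_type _ _ _) (conj IB IC)).
        econstructor; eauto using ty_conv.
      * destruct IC as [k IC]. exists k. apply (substitution IC EC).
    + assert (R : (exists k b, c = ref k /\ nth_error env k = Some (A, b)) \/
        sig c && cst_ok c = true /\ A = cst_type c).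
      { assert (D : infer (S n) Γ (Cst c) = Some A) by exact H. clear H.
        destruct c; cbn [infer] in D;
          try (destruct (sig _ && _) eqn:E in D; [|discriminate];
               injection D; auto; fail).
        do 3 (destruct m; [destruct (sig _ && _) eqn:E in D; [|discriminate];
               injection D; auto; fail|]).
        left. destruct (nth_error env m) as [[B b]|] eqn:E; [|discriminate].
        exists m, b. injection D; intros; subst. auto. }
      destruct R as [(k & b & -> & E)|[E ->]].
      * destruct env_typed as [_ M]. apply M in E. destruct E as (T & I & C & _).
        assert (C' := den_closed l Hρ _ _ C). split.
        -- apply weakening_closed; auto. rewrite den_ref. apply closed_ref; auto.
        -- apply is_type_closed; auto.
      * assert (I := sig_typed _ E). rewrite andb_true_iff in E.
        destruct (den_cst_type l ρ c (proj2 E)) as [-> ->].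
        split; [constructor; auto|].
        apply is_type_closed; auto using closed_cst_type.
  - intros Γ t A [k I] H. assert (W := has_type_wf I).
    assert (K : forall T, infer n Γ t = Some T ->
      (if conv_check env fuel T A then true else match hd_form env fuel T, hd_form env fuel A with
            | Univ j, Univ k => Nat.leb j k
            | _, _ => false
            end) = true -> has_type ⟪Γ⟫ ⟦t⟧ ⟦A⟧).
    { intros T E D. apply infer_ok in E; auto. destruct E as [E IT].
      rewrite if_orb in D. apply orb_true_iff in D. destruct D as [D|D].
      - apply den_conv_check in D.
        econstructor; eauto.
      - assert (CT := conv_hd T). assert (CA := conv_hd A).
        destruct (hd_form env fuel T) as [|i| | | |]; try discriminate.
        destruct (hd_form env fuel A) as [|j| | | |]; try discriminate.
        apply Nat.leb_le in D. cbn [den] in *.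
        apply conv_sym in CA. eapply ty_conv; [|exact I|exact CA].
        apply cumulativity with (level l i); auto using level_mono.
        econstructor; eauto using ty_Univ. }
    cbn [check] in H. destruct t;
      try (destruct (infer n Γ _) eqn:E in H; [eauto|discriminate]).
    destruct (domain n Γ A) as [[B C]|] eqn:E; [|discriminate].
    apply domain_ok in E; eauto. destruct E as (E & IB & IC).
    apply check_ok in H; auto. apply conv_sym in E.
    econstructor; [constructor; exact H|exact I|exact E].
  - intros Γ A k W H. cbn [sort] in H.
    destruct (infer n Γ A) as [T|] eqn:E; [|discriminate].
    assert (C := conv_hd T). destruct (hd_form env fuel T); try discriminate.
    injection H; intros; subst. apply infer_ok in E; auto.
    destruct E. econstructor; eauto using ty_Univ.
  - intros Γ F A B I H. cbn [domain] in H.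
    assert (K : (let F' := beta_nf fuel (hd_form env fuel F) in
        match F', infer n Γ F' with
        | Pi A B, Some _ => Some (A, B)
        | _, _ => None
        end) = Some (A, B) ->
        conv ⟦F⟧ (Pi ⟦A⟧ ⟦B⟧) /\ is_type Γ A /\ is_type (A :: Γ) B).
    { cbv zeta. intros E.
      assert (C : conv ⟦F⟧ ⟦beta_nf fuel (hd_form env fuel F)⟧).
      { eapply conv_trans; [apply conv_hd|]. apply den_beta_nf. }
      destruct (beta_nf fuel (hd_form env fuel F)); try discriminate.
      destruct (infer n Γ _) as [S|] eqn:E' in E; [|discriminate].
      injection E; intros; subst. destruct I as [k I].
      apply infer_ok in E'; [|eauto using has_type_wf]. destruct E' as [E' _].
      apply Pi_inv in E'. destruct E' as (j & ? & ?).
      split; [exact C|]. split; exists j; assumption. }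
    destruct F; try (exact (K H)).
    injection H; intros; subst. split; [apply conv_refl|].
    apply Pi_is_type. exact I.
Qed.

End Inference.

(** * Typing of the constants *)

Definition steps : nat := 40 * 50.
(** [steps] bounds reduction and conversion, [depth] bounds inference. Running out of either can
    only cause rejection. *)
Definition depth : nat := 500.

(* The constants at the levels at which they are needed *)
Definition sig_list : list cst :=
  let lv := [0; 1; 2] in
  flat_map (fun j => map (cJ j) lv ++ map (cSigInd j) lv) lv ++
  flat_map (fun c => map c lv)
    [cId; cRefl; cSig; cPair; cFunext; cNatInd; cEmptyInd; cRPInd; cKInd] ++
  [cEmpty; cUnit; cTt; cNat; cZero; cSucc; cNatInd 3; cUA 1;
   cRP2; cRPpt; cRPloop; cRPsq; cRPbeta 0; cRPbeta 1;
   cK2; cKpt; cKloop1; cKloop2; cKsq; cKbeta 0; cKbeta 1;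
   cSusp 1; cNorth 1; cSouth 1; cMerid 1; cSuspInd 1 1;
   cTrunc 1; cTr 1; cTrLevel 1; cTrInd 1 1; cTrInd 1 2;
   cEM 1; cEMpt 1; cEMloop 1; cEMsq 1; cEMInd 1 1; cEMInd 1 2; cEMbeta 1 2].

Definition sig (c : cst) : bool :=
  match find (cst_beq c) sig_list with Some _ => true | None => false end.

(* The type of a constant only contains constants of lower rank. *)
Definition rank (c : cst) : nat :=
  match c with
  | cEmpty | cUnit | cNat | cSum _ | cSig _ | cId _ | cRP2 | cK2 | cSusp _
  | cEM _ => 0
  | cTrunc _ => 1
  | cEmptyInd _ | cTt | cInl _ | cInr _ | cZero | cSucc | cPair _ | cRefl _
  | cRPpt | cKpt | cNorth _ | cSouth _ | cTr _ | cEMpt _ => 2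
  | cUnitInd _ | cSumInd _ _ | cNatInd _ | cSigInd _ _ | cJ _ _ | cMerid _
  | cRPloop | cKloop1 | cKloop2 | cEMloop _ => 3
  | cFunext _ | cUA _ | cRPsq | cKsq | cEMsq _ | cTrLevel _ | cSuspInd _ _ => 4
  | cTrInd _ _ | cRPInd _ | cKInd _ | cEMInd _ _ => 5
  | _ => 6
  end.

Definition sig_below (r : nat) (c : cst) : bool := sig c && Nat.ltb (rank c) r.

Lemma sig_listed c : sig c = true -> In c sig_list.
Proof.
  unfold sig. destruct (find _ _) as [d|] eqn:E; [|discriminate]. intros _.
  apply find_some in E. destruct E as [I E].
  apply internal_cst_dec_bl in E. subst. exact I.
Qed.

Lemma sig_list_typed :
  forallb (fun c => negb (cst_ok c) ||
    match sort (sig_below (rank c)) [] steps depth [] (cst_type c) with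
    | Some _ => true
    | None => false
    end) sig_list = true.
Proof. vm_compute. reflexivity. Qed.

Lemma sig_list_sort c : sig c = true -> cst_ok c = true ->
  exists k, sort (sig_below (rank c)) [] steps depth [] (cst_type c) = Some k.
Proof.
  intros S K. assert (T := sig_list_typed). rewrite forallb_forall in T.
  specialize (T c (sig_listed _ S)). rewrite K in T.
  destruct (sort _ _ _ _ _ _) as [k|]; [eauto|discriminate].
Qed.

Lemma empty_model l : env_model [] l [].
Proof. split; [reflexivity|]. intros [|k]; discriminate. Qed.

(** The checker is sound if the types of the constants are well formed, and their well-formedness is
    itself established by the checker. Induction on the rank breaks the circle. *)
Lemma sig_below_typed l r c : sig_below r c && cst_ok c = true ->
  exists k, has_type [] (cst_type (map_levels (level l) c)) (Univ k).
Proof.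
  revert c. induction r; intros c H; unfold sig_below in H;
    rewrite !andb_true_iff in H; destruct H as [[S R] K]; apply Nat.ltb_lt in R.
  - lia.
  - destruct (sig_list_sort _ S K) as [k E].
    assert (Hs : forall c', sig_below (rank c) c' && cst_ok c' = true ->
      exists k, has_type [] (cst_type (map_levels (level l) c')) (Univ k)).
    { intros. apply IHr. unfold sig_below in *.
      rewrite !andb_true_iff, Nat.ltb_lt in *. intuition lia. }
    (* With a variable as fuel, unification cannot start to run the checker. *)
    generalize dependent depth. intros d E.
    destruct (infer_sound (sig_below (rank c)) steps (empty_model l) Hs d)
      as (_ & _ & D & _).
    apply D in E; [|constructor].
    destruct (den_cst_type l [] c K) as [D' _]. cbn [map] in E.
    rewrite D' in E. eauto.
Qed.

(** * Libraries of derived statements *)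

(** A class, so that the most recent instance is the current list of entries. A model is required at
    every level [l], although each entry is checked only once. *)
Class library := Library {
  entries : list (tm * option tm);
  entries_model : forall l, exists ρ, env_model entries l ρ
}.

Definition empty_library : library :=
  Library (fun l => ex_intro _ [] (empty_model l)).

Definition accepts (L : library) (A t : tm) : bool :=
  closed 0 A && refs_below (length entries) A && refs_below (length entries) t &&
  match sort sig entries steps depth [] A with Some _ => true | None => false end &&
  check sig entries steps depth [] t A.

Lemma sig_typed l c : sig c && cst_ok c = true ->
  exists k, has_type [] (cst_type (map_levels (level l) c)) (Univ k).
Proof.
  intros. apply sig_below_typed with (r := S (rank c)). unfold sig_below.
  rewrite !andb_true_iff, Nat.ltb_lt in *. intuition lia.
Qed.

Lemma accepts_typed (L : library) A t l ρ : accepts L A t = true ->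
  env_model entries l ρ ->
  has_type [] (den l ρ t) (den l ρ A) /\
  exists k, has_type [] (den l ρ A) (Univ k).
Proof.
  unfold accepts. rewrite !andb_true_iff. intros [[[[C NA] Nt] S] K] M.
  destruct (sort _ _ _ _ _ _) as [k|] eqn:E in S; [|discriminate].
  destruct (infer_sound sig steps M (sig_typed l) depth)
    as (_ & check_ok & sort_ok & _).
  apply sort_ok in E; [|constructor]. split; [|eauto].
  apply (check_ok [] t A); eauto.
Qed.

Lemma accepts_model (L : library) A t (transparent : bool) :
  accepts L A t = true -> forall l, exists ρ,
  env_model (entries ++ [(A, if transparent then Some t else None)]) l ρ.
Proof.
  intros H l. destruct (entries_model l) as [ρ M]. assert (M' := M).
  destruct (accepts_typed L A t H M) as [T I]. destruct M as [E M].
  exists (ρ ++ [den l ρ t]). split; [rewrite !length_app, E; reflexivity|].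
  unfold accepts in H. rewrite !andb_true_iff in H.
  destruct H as [[[[C NA] Nt] _] _]. rewrite <- E in NA, Nt.
  assert (D : den l (ρ ++ [den l ρ t]) (Cst (ref (length ρ))) = den l ρ t).
  { rewrite den_ref, app_nth2, Nat.sub_diag by lia. reflexivity. }
  intros k B b N. rewrite length_app. cbn [length map].
  destruct (Nat.lt_ge_cases k (length ρ)) as [Hk|Hk].
  - rewrite nth_error_app1 in N by lia.
    destruct (M _ _ _ N) as (TB & IB & CB & RB & Db).
    replace (den l (ρ ++ [den l ρ t]) (Cst (ref k))) with (den l ρ (Cst (ref k)))
      by (rewrite !den_ref, app_nth1 by lia; reflexivity).
    rewrite den_app by assumption.
    split; [assumption|]. split; [assumption|]. split; [assumption|].
    split; [eapply refs_below_mono; [|exact RB]; lia|].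
    intros u Eu. destruct (Db u Eu) as [Du Ru]. rewrite den_app by assumption.
    split; [assumption|]. eapply refs_below_mono; [|exact Ru]; lia.
  - rewrite nth_error_app2 in N by lia.
    destruct (k - length entries) as [|[|]] eqn:Ek; try discriminate.
    replace k with (length ρ) by lia. rewrite D.
    injection N; intros; subst. rewrite !den_app by assumption.
    split; [assumption|]. split; [assumption|]. split; [assumption|].
    split; [eapply refs_below_mono; [|exact NA]; lia|].
    destruct transparent; [|discriminate]. intros u Eu.
    injection Eu; intros; subst. rewrite den_app by assumption.
    split; [reflexivity|]. eapply refs_below_mono; [|exact Nt]; lia.
Qed.

(** * Typed surface syntax *)

Unset Implicit Arguments.

Local Open Scope hott_scope.

(* [ty], and [term A] for the terms of type [A], are phantom types: they let
   Rocq infer arguments, and the checker does not rely on them. *)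
Set Primitive Projections.
Record ty : Set := El { code : exp }.
Record term (A : ty) : Set := mk { val : exp }.
Unset Primitive Projections.
Arguments mk {A} _.
Arguments val {A} _.
Coercion code : ty >-> exp.
Coercion El : exp >-> ty.
Coercion val : term >-> exp.
Coercion term : ty >-> Sortclass.
(** The index carries no data; it tells instance search that such a variable is to be bound in
    [U i]. *)
Definition typ (i : nat) : Set := ty.

(* The types of Rocq that describe closed statements of the object theory. *)
Class closable (F : Set) := Build_closable {
  closed_type : exp;
  close : F -> exp;
  open : exp -> F
}.
Arguments closed_type F {_}.
Arguments close {F _} _.
Arguments open {F _} _.

#[export] Instance closable_term A : closable (term A) :=
  Build_closable (term A) (code A) val mk.

#[export] Instance closable_typ i (F : typ i -> Set) (H : forall A, closable (F A)) :
  closable (forall A : typ i, F A) :=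
  {| closed_type := pi (U i) (fun A => closed_type (F (El A)));
     close f := lam (fun A => close (f (El A)));
     open e := fun A => open (e $ code A) |}.

(** An argument that is a Rocq function stands for an open expression. It is quantified as a
    function of the object theory and applied pointwise; a reference to the closed statement
    abstracts it again. *)
#[export] Instance closable_fun A B (F : (forall x : term A, term (B x)) -> Set)
  (H : forall f, closable (F f)) : closable (forall f, F f) :=
  Build_closable (forall f, F f)
    (pi (pi A (fun x => B (mk x))) (fun f => closed_type (F (fun x => mk (f $ x)))))
    (fun t => lam (fun f => close (t (fun x => mk (f $ x)))))
    (fun e f => open (e $ lam (fun x => f (mk x)))).

#[export] Instance closable_fam i A (F : (term A -> typ i) -> Set)
  (H : forall B, closable (F B)) : closable (forall B, F B) :=
  Build_closable (forall B, F B)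
    (pi (A ⇒ U i) (fun B => closed_type (F (fun x => El (B $ x)))))
    (fun t => lam (fun B => close (t (fun x => El (B $ x)))))
    (fun e B => open (e $ lam (fun x => code (B (mk x))))).

#[export] Instance closable_ty i : closable (typ i) :=
  Build_closable (typ i) (U i) code El.

#[export] Instance closable_pi A (F : term A -> Set) (H : forall x, closable (F x)) :
  closable (forall x : term A, F x) :=
  {| closed_type := pi A (fun x => closed_type (F (mk x)));
     close f := lam (fun x => close (f (mk x)));
     open e := fun x => open (e $ x) |}.

Definition extend {L : library} {F} {_ : closable F} (transparent : bool) (t : F)
  (H : accepts L (closed_type F 0) (close t 0) = true) : library :=
  Library (accepts_model L _ _ transparent H).

Definition entry {F} {_ : closable F} (t : F) (k : nat) : F := open (C (ref k)).

Lemma close_typed {L : library} {F} {_ : closable F} (t : F) (l : nat) :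
  accepts L (closed_type F 0) (close t 0) = true ->
  exists ρ u, has_type [] u (den l ρ (closed_type F 0)).
Proof.
  intros E. destruct (entries_model l) as [ρ M].
  exists ρ, (den l ρ (close t 0)). exact (proj1 (accepts_typed L _ _ E M)).
Qed.

(* [derive t] extends the library by [t], [define t] does so transparently, and
   [cite t] refers to the last entry, at the type of [t].  Below, [x'] is the
   term of an entry and [x] the reference to it. *)
Ltac add b t := refine (extend b t _); vm_compute; reflexivity.
Ltac last_entry t :=
  let k := eval vm_compute in (pred (length entries)) in exact (entry t k).
Notation derive t := ltac:(add false t) (only parsing).
Notation define t := ltac:(add true t) (only parsing).
Notation cite t := ltac:(last_entry t) (only parsing).

(* For a statement [t i] about two levels [i = 0, 1], which are the last entries *)
Ltac last_entries t i :=
  let k := eval vm_compute in (length entries - 2) in exact (entry (t i) (k + i)).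
Notation cite_levels t i := ltac:(last_entries t i) (only parsing).

Instance : library := empty_library.

(** Changes the phantom type only. Rocq does not see the judgmental equalities of the object theory;
    that they hold is decided by the checker. *)
Definition cast {A B : ty} (t : term A) : term B := @mk B (val t).
Arguments cast : simpl never.

Definition tpi (A : ty) (B : term A -> ty) : ty := pi A (fun x => B (mk x)).
Notation "∏ x .. y : A , B" :=
  (tpi A (fun x => .. (tpi A (fun y => B)) ..))
  (at level 200, x closed binder, y closed binder, A at level 85, B at level 200,
   right associativity) : hott_scope.
Notation "A ⟶ B" := (tpi A (fun _ => B))
  (at level 85, right associativity) : hott_scope.

Definition app {A B} (f : tpi A B) (a : A) : B a := mk (f $ a).
Definition fn {A : ty} {B : A -> ty} (b : forall x : A, B x) : tpi A B :=
  mk (lam (fun x => b (mk x))).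

Definition Eq i {A : ty} (x y : A) : ty := Id i A x y.
Definition rfl_at i {A : ty} (x : A) : Eq i x x := mk (refl i A x).
Definition path_ind {i} j {A : ty} {a : A}
  (P : forall x : A, Eq i a x -> ty) (d : P a (rfl_at i a))
  (x : A) (p : Eq i a x) : P x p :=
  mk (J i j A a (fun x p => P (mk x) (mk p)) d x p).
Definition cc {i} {A : ty} {x y z : A} (p : Eq i x y) (q : Eq i y z) :
  Eq i x z := mk (comp i A x y z p q).
Definition iv {i} {A : ty} {x y : A} (p : Eq i x y) : Eq i y x :=
  mk (inv i A x y p).
Definition app_path i j {A B : ty} (f : A -> B) {x y : A}
  (p : Eq i x y) : Eq j (f x) (f y) :=
  mk (ap i j A B (fun x => f (mk x)) x y p).
Definition tr {i j} {A : ty} (P : A -> ty) {x y : A} (p : Eq i x y)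
  (u : P x) : P y :=
  mk (transport i j A (fun x => P (mk x)) x y p u).

Definition Sg i (A : ty) (B : A -> ty) : ty := Sig i A (fun x => B (mk x)).
Definition pair {i} {A : ty} {B : A -> ty} (a : A) (b : B a) : Sg i A B :=
  mk (Pair i A (fun x => B (mk x)) a b).
Definition sig_ind {i} j {A B} (P : Sg i A B -> ty)
  (d : forall (a : A) (b : B a), P (pair a b))
  (t : Sg i A B) : P t :=
  mk (C (cSigInd i j) $ A $ (λ x, B (mk x)) $ (λ t, P (mk t)) $
      (λ a b, d (mk a) (mk b)) $ t).
Definition pr1 {i A B} (t : Sg i A B) : A :=
  sig_ind i (fun _ => A) (fun a _ => a) t.
Definition pr2 {i A B} (t : Sg i A B) : B (pr1 t) :=
  sig_ind i (fun t => B (pr1 t)) (fun a b => cast b) t.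

Notation "A × B" := (Sg 1 A (fun _ => B)) (at level 60, right associativity).

Notation "f @ a" := (app f a) (at level 34, left associativity).
Notation "x == y" := (Eq 1 x y) (at level 70).
Notation "x =={ i } y" := (Eq i x y) (at level 70, i at level 99).
Infix "•" := cc (at level 36, left associativity).
Notation "p ⁻¹" := (iv p) (at level 2, format "p ⁻¹").
Notation rfl := (rfl_at 1).
Notation ap1 := (app_path 1 1).
Notation tr1 := (tr (i := 1) (j := 1)).

(* Path induction: the goal is the only thing that depends on [p] and on its
   right end. *)
Ltac pind j p :=
  match type of p with term (@Eq _ _ _ ?x) =>
    revert x p; refine (path_ind j (fun x p => _) _)
  end.
(** A hypothesis that depends on the path must enter the motive, which is a type of the object
    theory, so it is moved there as a product; [lam] brings it back. *)
Ltac gen h := revert h; refine (app _).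
Ltac lam h := refine (fn (fun h => _)).

(** * Paths and loops *)

(** Composition is defined by induction on the second path, so the right unit law is judgmental, and
    many casts below rest on it; the left one is not. *)
Definition cc_rfl_l' (A : typ 1) (x y : A) (p : x == y) : rfl x • p == p.
Proof. pind 1 p. exact (cast (rfl (rfl x))). Defined.
Instance : library := define cc_rfl_l'.
Definition cc_rfl_l := cite cc_rfl_l'.
Arguments cc_rfl_l {A x y} p.

Definition cc_iv_r' i (A : typ i) (x y : A) (p : x =={i} y) : p • p⁻¹ =={i} rfl_at i x.
Proof. pind i p. exact (cast (rfl_at i (rfl_at i x))). Defined.
Instance : library := define (cc_iv_r' 0).
Instance : library := define (cc_iv_r' 1).
Definition cc_iv_r i := cite_levels cc_iv_r' i.
Arguments cc_iv_r i {A x y} p.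

Definition cc_ivK' (A : typ 1) (x y z : A) (p : x == y) (q : z == y) : (p • q⁻¹) • q == p.
Proof. gen p. pind 1 q. lam p. exact (cast (rfl p)). Defined.
Instance : library := define cc_ivK'.
Definition cc_ivK := cite cc_ivK'.
Arguments cc_ivK {A x y z} p q.

Definition iv_iv' (A : typ 1) (x y : A) (p : x == y) : p⁻¹⁻¹ == p.
Proof. pind 1 p. exact (cast (rfl (rfl x))). Defined.
Instance : library := define iv_iv'.
Definition iv_iv := cite iv_iv'.
Arguments iv_iv {A x y} p.

Definition cc_ivKl' (A : typ 1) (x y z : A) (p : x == y)
  (q : x == z) : p • (p⁻¹ • q) == q.
Proof. gen q. pind 1 p. lam q. exact (cast (cc_rfl_l _ • cc_rfl_l q)). Defined.
Instance : library := define cc_ivKl'.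
Definition cc_ivKl := cite cc_ivKl'.
Arguments cc_ivKl {A x y z} p q.

Definition Iso' (A B : typ 1) : typ 1 :=
  Sg 1 (A ⟶ B) (fun f => Sg 1 (B ⟶ A) (fun g =>
    (∏ x : A, g @ (f @ x) == x) × (∏ y : B, f @ (g @ y) == y))).
Instance : library := define Iso'.
Definition Iso := cite Iso'.

Definition iso' (A B : typ 1) (f : forall x : A, B) (g : forall y : B, A)
  (gf : forall x : A, g (f x) == x) (fg : forall y : B, f (g y) == y) : Iso A B :=
  cast (@pair 1 (A ⟶ B) (fun f => Sg 1 (B ⟶ A) (fun g =>
      (∏ x : A, g @ (f @ x) == x) × (∏ y : B, f @ (g @ y) == y))) (fn f)
    (cast (@pair 1 (B ⟶ A) (fun g =>
      (∏ x : A, g @ (f x) == x) × (∏ y : B, f (g @ y) == y)) (fn g)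
    (cast (@pair 1 (∏ x : A, g (f x) == x)
      (fun _ => ∏ y : B, f (g y) == y) (fn gf) (fn fg)))))).
Instance : library := define iso'.
Definition iso := cite iso'.
Arguments iso {A B} f g gf fg.

Definition to' (A B : typ 1) (e : Iso A B) (x : A) : B :=
  pr1 (cast (B := Iso' A B) e) @ x.
Instance : library := define to'.
Definition to := cite to'.
Arguments to {A B} e x.

Definition of' (A B : typ 1) (e : Iso A B) (y : B) : A :=
  pr1 (pr2 (cast (B := Iso' A B) e)) @ y.
Instance : library := define of'.
Definition of := cite of'.
Arguments of {A B} e y.

Definition ofK' (A B : typ 1) (e : Iso A B) (x : A) : of e (to e x) == x :=
  cast (pr1 (pr2 (pr2 (cast (B := Iso' A B) e))) @ x).
Instance : library := define ofK'.
Definition ofK := cite ofK'.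
Arguments ofK {A B} e x.

Definition toK' (A B : typ 1) (e : Iso A B) (y : B) : to e (of e y) == y :=
  cast (pr2 (pr2 (pr2 (cast (B := Iso' A B) e))) @ y).
Instance : library := define toK'.
Definition toK := cite toK'.
Arguments toK {A B} e y.

(** Needed at level 0 to define the collapse inside [RP2], and at level 1 for maps into [X]. *)
Definition psi' i (A : typ i) (x y : A) (p : x =={i} y)
  (q : y =={i} x) (κ : p⁻¹ =={i} q) : p • q =={i} rfl_at i x.
Proof.
  pind i κ. exact (cc_iv_r i p).
Defined.
Instance : library := define (psi' 0).
Instance : library := define (psi' 1).
Definition psi i := cite_levels psi' i.
Arguments psi i {A x y p q} κ.

Definition psi_rfl' (A : typ 1) (x : A) (q : x == x) (κ : rfl x == q) :
  psi 1 (p := rfl x) (cast κ) == cc_rfl_l q • κ⁻¹.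
Proof. pind 1 κ. exact (cast (rfl (rfl (rfl x)))). Defined.
Instance : library := define psi_rfl'.
Definition psi_rfl := cite psi_rfl'.
Arguments psi_rfl {A x q} κ.

Definition psi_iso_rfl' (A : typ 1) (x : A) (q : x == x) :
  Iso (rfl x == q) (rfl x • q == rfl x).
Proof.
  refine (iso (fun κ => psi 1 (p := rfl x) (cast κ))
    (fun h => ((cc_rfl_l q)⁻¹ • h)⁻¹) _ _).
  - intros κ. pind 1 κ. exact (cast (rfl (rfl (rfl x)))).
  - intros h. refine (psi_rfl _ • _).
    refine (ap1 (fun k => cc_rfl_l q • k) (iv_iv _) • _).
    exact (cc_ivKl (cc_rfl_l q) h).
Defined.
Instance : library := define psi_iso_rfl'.
Definition psi_iso_rfl := cite psi_iso_rfl'.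
Arguments psi_iso_rfl {A x} q.

(** Only [q = p = u] is wanted, but a loop admits no induction; with [q] separate, [p] may be
    contracted. *)
Definition psi_iso' (A : typ 1) (x y : A) (p : x == y) (q : y == x) :
  Sg 1 (Iso (p⁻¹ == q) (p • q == rfl x)) (fun s =>
    ∏ κ : p⁻¹ == q, to s κ == psi 1 κ).
Proof.
  gen q. pind 1 p. lam q.
  refine (pair (cast (psi_iso_rfl q)) _). lam κ.
  exact (cast (rfl (psi 1 κ))).
Defined.
Instance : library := define psi_iso'.
Definition psi_iso := cite psi_iso'.
Arguments psi_iso {A x y} p q.

Definition cancel' (A : typ 1) (x y : A) (c : x == y)
  (w : x == x) (z : x == y) (n : w • c == z) : Iso (z == c) (w == rfl x).
Proof.
  pind 1 n. gen w. pind 1 c. lam w.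
  refine (iso cast cast _ _); intros p; exact (cast (rfl p)).
Defined.
Instance : library := derive cancel'.
Definition cancel := cite cancel'.
Arguments cancel {A x y c w z} n.

Definition loops_commute' (X : typ 1) (ε : ∏ x : X, x == x)
  (x y z : X) (p : x == y) (q : y == z) : (p • q) • (ε @ z) == (p • (ε @ y)) • q.
Proof. pind 1 q. exact (cast (rfl (p • (ε @ y)))). Defined.
Instance : library := derive loops_commute'.
Definition loops_commute := cite loops_commute'.
Arguments loops_commute {X} ε {x y z} p q.

(* As [ε] is natural, [v = ε b] commutes with [u], whence [(u · v) · u = (u · u) · v]. *)
Definition twist' (X : typ 1) (ε : ∏ x : X, x == x)
  (b : X) (u : b == b) (v : b == b) (h : ε @ b == v) :
  Iso ((u • v) • u == v) (u • u == rfl b).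
Proof.
  pind 1 h. exact (cancel (loops_commute ε u u)).
Defined.
Instance : library := derive twist'.
Definition twist := cite twist'.
Arguments twist {X ε b} u {v} h.

(** The homotopy is given as data and not merely, since [theta] is constructed from it. *)
Definition Homogeneous' (X : typ 1) : typ 1 :=
  ∏ b : X, ∏ u : b == b, Sg 1 (∏ x : X, x == x) (fun ε => ε @ b == u).

(* The isomorphisms [F v ≅ W] are corrected by a constant automorphism of [W]
   so as to agree with the given isomorphism [Z ≅ F v0]. *)
Definition normalize' (V : typ 1) (F : V -> typ 1) (W Z : typ 1)
  (v0 : V) (t : ∏ v : V, Iso (F v) W) (s : Iso Z (F v0)) :
  Sg 1 (∏ v : V, Iso (F v) Z) (fun Θ =>
    ∏ z : Z, of (Θ @ v0) z == to s z).
Proof.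
  unshelve refine (pair (fn (fun v => iso
    (fun x => of s (of (t @ v0) (to (t @ v) x)))
    (fun z => of (t @ v) (to (t @ v0) (to s z))) _ _)) _).
  - intros x. refine (_ • ofK (t @ v) x). refine (ap1 (of (t @ v)) _).
    exact (ap1 (to (t @ v0)) (toK s _) • toK (t @ v0) _).
  - intros z. refine (_ • ofK s z). refine (ap1 (of s) _).
    exact (ap1 (of (t @ v0)) (toK (t @ v) _) • ofK (t @ v0) _).
  - lam z. exact (cast (ofK (t @ v0) (to s z))).
Defined.
Instance : library := derive normalize'.
Definition normalize := cite normalize'.

Instance : library := define Homogeneous'.
Definition Homogeneous := cite Homogeneous'.
Definition spread' (X : typ 1) (H : Homogeneous X) (b : X)
  (u : b == b) : Sg 1 (∏ x : X, x == x) (fun ε => ε @ b == u) :=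
  cast (B := Homogeneous' X) H @ b @ u.
Instance : library := define spread'.
Definition spread := cite spread'.
Arguments spread {X} H {b} u.

(** The isomorphisms for all [v] are chosen together with their value at [rfl b], so that both refer
    to the same choice of homotopies. *)
Definition theta_pack' (X : typ 1) (H : Homogeneous X) (b : X) (u : b == b) :
  Sg 1 (∏ v : b == b, Iso ((u • v) • u == v) (u⁻¹ == u))
    (fun Θ => ∏ κ : u⁻¹ == u, of (Θ @ rfl b) κ == cast (psi 1 κ)).
Proof.
  pose (n := normalize (b == b) (fun v => (u • v) • u == v)
    (u • u == rfl b) (u⁻¹ == u) (rfl b)
    (fn (fun v => twist u (pr2 (spread H v)))) (cast (pr1 (psi_iso u u)))).
  refine (pair (pr1 n) (fn (fun κ => _))).
  exact (pr2 n @ κ • cast (pr2 (psi_iso u u) @ κ)).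
Defined.
Instance : library := define theta_pack'.
Definition theta_pack := cite theta_pack'.
Arguments theta_pack {X} H {b} u.

Definition theta' (X : typ 1) (H : Homogeneous X) (b : X)
  (u v : b == b) : Iso ((u • v) • u == v) (u⁻¹ == u) :=
  pr1 (theta_pack H u) @ v.
Instance : library := define theta'.
Definition theta := cite theta'.
Arguments theta {X} H {b} u v.

(** * Maps out of the projective plane and the Klein bottle *)

(* Maps from [RP2] and [K2] that send the base point to [b] correspond to the
   elements of [DR b] and [DK b]. *)
Definition DR' i (X : typ i) (b : X) : typ i :=
  Sg i (b =={i} b) (fun u => u⁻¹ =={i} u).
Instance : library := define (DR' 0).
Instance : library := define (DR' 1).
Definition DR i := cite_levels DR' i.
Arguments DR i {X} b.

Definition dr' i (X : typ i) (b : X) (u : b =={i} b) (κ : u⁻¹ =={i} u) : DR i b :=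
  cast (@pair i (b =={i} b) (fun u => u⁻¹ =={i} u) u κ).
Instance : library := define (dr' 0).
Instance : library := define (dr' 1).
Definition dr i := cite_levels dr' i.
Arguments dr i {X b} u κ.

Definition DK' i (X : typ i) (b : X) : typ i :=
  Sg i (b =={i} b) (fun u => Sg i (b =={i} b) (fun v => (u • v) • u =={i} v)).
Instance : library := define (DK' 0).
Instance : library := define (DK' 1).
Definition DK i := cite_levels DK' i.
Arguments DK i {X} b.

Definition dk' i (X : typ i) (b : X) (u v : b =={i} b)
  (κ : (u • v) • u =={i} v) : DK i b :=
  cast (@pair i (b =={i} b) (fun u => Sg i (b =={i} b) (fun v => (u • v) • u =={i} v)) u
    (@pair i (b =={i} b) (fun v => (u • v) • u =={i} v) v κ)).
Instance : library := define (dk' 0).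
Instance : library := define (dk' 1).
Definition dk i := cite_levels dk' i.
Arguments dk i {X b} u v κ.

Definition dr_ind {i X b} j (P : (@DR i X b) -> ty)
  (h : forall u κ, P (dr i u κ)) (d : DR i b) : P d :=
  cast (sig_ind j (fun t => P (cast t)) (fun u κ => cast (h u κ))
    (cast (B := DR' i X b) d)).
Definition dk_ind {i X b} j (P : (@DK i X b) -> ty)
  (h : forall u v κ, P (dk i u v κ)) (e : DK i b) : P e :=
  cast (sig_ind j (fun t => P (cast t)) (fun u e =>
    sig_ind j (fun e => P (cast (@pair i (b =={i} b)
       (fun u => Sg i (b =={i} b) (fun v => (u • v) • u =={i} v)) u e)))
      (fun v κ => cast (h u v κ)) e)
    (cast (B := DK' i X b) e)).
Ltac drind j d := revert d; refine (dr_ind j (fun d => _) _).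
Ltac dkind j d := revert d; refine (dk_ind j (fun d => _) _).

Definition second' (X : typ 1) (b : X) (e : DK 1 b) : b == b :=
  dk_ind 1 (fun _ => b == b) (fun _ v _ => v) e.
Instance : library := define second'.
Definition second := cite second'.
Arguments second {X b} e.

(** With [second] this splits [DK 1 b] into [b == b] and [DR 1 b]; [combine] is the inverse. *)
Definition restrict' (X : typ 1) (H : Homogeneous X) (b : X) (e : DK 1 b) : DR 1 b :=
  dk_ind 1 (fun _ => DR 1 b) (fun u v κ => dr 1 u (to (theta H u v) κ)) e.
Instance : library := define restrict'.
Definition restrict := cite restrict'.
Arguments restrict {X} H {b} e.

Definition combine' (X : typ 1) (H : Homogeneous X) (b : X)
  (v : b == b) (d : DR 1 b) : DK 1 b :=
  dr_ind 1 (fun _ => DK 1 b) (fun u κ => dk 1 u v (of (theta H u v) κ)) d.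
Instance : library := define combine'.
Definition combine := cite combine'.
Arguments combine {X} H {b} v d.

(** The effect on data of composition with the collapse, as [evK_collapse] confirms. *)
Definition include' i (X : typ i) (b : X) (d : DR i b) : DK i b :=
  dr_ind i (fun _ => DK i b) (fun u κ => dk i u (rfl_at i b) (cast (psi i κ))) d.
Instance : library := define (include' 0).
Instance : library := define (include' 1).
Definition include i := cite_levels include' i.
Arguments include i {X b} d.

Definition restrict_combine' (X : typ 1) (H : Homogeneous X)
  (b : X) (v : b == b) (d : DR 1 b) : restrict H (combine H v d) == d.
Proof.
  drind 1 d. intros u κ. exact (cast (ap1 (dr 1 u) (toK (theta H u v) κ))).
Defined.
Instance : library := derive restrict_combine'.
Definition restrict_combine := cite restrict_combine'.
Arguments restrict_combine {X} H {b} v d.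

Definition combine_restrict' (X : typ 1) (H : Homogeneous X) (b : X) (e : DK 1 b) :
  combine H (second e) (restrict H e) == e.
Proof.
  dkind 1 e. intros u v κ.
  exact (cast (ap1 (dk 1 u v) (ofK (theta H u v) κ))).
Defined.
Instance : library := derive combine_restrict'.
Definition combine_restrict := cite combine_restrict'.
Arguments combine_restrict {X} H {b} e.

(** This is the point at which the normalization of [theta] is put to use. *)
Definition combine_rfl' (X : typ 1) (H : Homogeneous X)
  (b : X) (d : DR 1 b) : combine H (rfl b) d == include 1 d.
Proof.
  drind 1 d. intros u κ.
  exact (cast (ap1 (dk 1 u (rfl b))
    (cast (B := of (theta H u (rfl b)) κ == cast (psi 1 κ))
      (pr2 (theta_pack H u) @ κ)))).
Defined.
Instance : library := derive combine_rfl'.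
Definition combine_rfl := cite combine_rfl'.
Arguments combine_rfl {X} H {b} d.

(** * Recursion on [RP2] and [K2] with its computation rules *)

Notation ap0 := (app_path 0).

Definition rpt : RP2 := mk (C cRPpt).
Definition rloop : rpt =={0} rpt := mk RPloop.
Definition rsq : rloop⁻¹ =={0} rloop := mk (C cRPsq).
Definition kpt : K2 := mk (C cKpt).
Definition kloop1 : kpt =={0} kpt := mk (C cKloop1).
Definition kloop2 : kpt =={0} kpt := mk (C cKloop2).
Definition ksq : (kloop1 • kloop2) • kloop1 =={0} kloop2 := mk (C cKsq).

Definition ap_iv' j (A : typ 0) (X : typ j) (f : forall x : A, X)
  (x y : A) (p : x =={0} y) (q : y =={0} x)
  (κ : p⁻¹ =={0} q) : (ap0 j f p)⁻¹ =={j} ap0 j f q.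
Proof. pind j κ. pind j p. exact (cast (rfl_at j (rfl_at j (f x)))). Defined.
Instance : library := define (ap_iv' 0).
Instance : library := define (ap_iv' 1).
Definition ap_iv i := cite_levels ap_iv' i.
Arguments ap_iv i {A X} f {x y p q} κ.

Definition ap_cc' j (A : typ 0) (X : typ j) (f : forall x : A, X)
  (x y z w : A) (p : x =={0} y) (q : y =={0} z) (r : z =={0} w) (s : x =={0} w)
  (κ : (p • q) • r =={0} s) : (ap0 j f p • ap0 j f q) • ap0 j f r =={j} ap0 j f s.
Proof.
  pind j κ. pind j r. pind j q. exact (cast (rfl_at j (ap0 j f p))).
Defined.
Instance : library := define (ap_cc' 0).
Instance : library := define (ap_cc' 1).
Definition ap_cc i := cite_levels ap_cc' i.
Arguments ap_cc i {A X} f {x y z w p q r s} κ.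

Definition evR' j (X : typ j) (f : forall x : RP2, X) :
  DR j (f rpt) := dr j (ap0 j f rloop) (ap_iv j f rsq).
Instance : library := define (evR' 0).
Instance : library := define (evR' 1).
Definition evR i := cite_levels evR' i.
Arguments evR i {X} f.

Definition evK' j (X : typ j) (f : forall x : K2, X) :
  DK j (f kpt) := dk j (ap0 j f kloop1) (ap0 j f kloop2) (ap_cc j f ksq).
Instance : library := define (evK' 0).
Instance : library := define (evK' 1).
Definition evK i := cite_levels evK' i.
Arguments evK i {X} f.

(** The rules of the object theory speak of paths over constructors in a family. In a constant
    family these amount to ordinary paths, by [to_over] and [from_over], and [apd] amounts to
    [ap]. *)
Definition Over' j (A : typ 0) (X : typ j) (x y : A) (p : x =={0} y)
  (b c : X) : typ j := over 0 j A (fun _ => X) x y p b c.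
Instance : library := define (Over' 0).
Instance : library := define (Over' 1).
Definition Over i := cite_levels Over' i.
Arguments Over i {A X x y} p b c.
Definition apd_const' j (A : typ 0) (X : typ j) (f : forall x : A, X)
  (x y : A) (p : x =={0} y) : Over j p (f x) (f y) :=
  mk (apd 0 j A (fun _ => X) (fun x => f (mk x)) x y p).
Instance : library := define (apd_const' 0).
Instance : library := define (apd_const' 1).
Definition apd_const i := cite_levels apd_const' i.
Arguments apd_const i {A X} f {x y} p.

Definition to_over' j (A : typ 0) (X : typ j) (x y : A)
  (p : x =={0} y) (b c : X) (u : b =={j} c) : Over j p b c.
Proof. pind j p. exact (cast u). Defined.
Instance : library := define (to_over' 0).
Instance : library := define (to_over' 1).
Definition to_over i := cite_levels to_over' i.
Arguments to_over i {A X x y} p {b c} u.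

Definition from_over' j (A : typ 0) (X : typ j) (x y : A)
  (p : x =={0} y) (b c : X) (w : Over j p b c) : b =={j} c.
Proof. gen w. pind j p. lam w. exact (cast w). Defined.
Instance : library := define (from_over' 0).
Instance : library := define (from_over' 1).
Definition from_over i := cite_levels from_over' i.
Arguments from_over i {A X x y} p {b c} w.

Definition from_to_over' j (A : typ 0) (X : typ j) (x y : A)
  (p : x =={0} y) (b c : X) (u : b =={j} c) : from_over j p (to_over j p u) =={j} u.
Proof. pind j p. exact (cast (rfl_at j u)). Defined.
Instance : library := define (from_to_over' 0).
Instance : library := define (from_to_over' 1).
Definition from_to_over i := cite_levels from_to_over' i.
Arguments from_to_over i {A X x y} p {b c} u.

Definition from_apd' j (A : typ 0) (X : typ j) (f : forall x : A, X)
  (x y : A) (p : x =={0} y) : from_over j p (apd_const j f p) =={j} ap0 j f p.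
Proof. pind j p. exact (cast (rfl_at j (rfl_at j (f x)))). Defined.
Instance : library := define (from_apd' 0).
Instance : library := define (from_apd' 1).
Definition from_apd i := cite_levels from_apd' i.
Arguments from_apd i {A X} f {x y} p.

(** The 2-dimensional premise of the induction principle for [RP2], with [rsq] generalized to any
    [s]. Induction on [s] and [p] turns it into an equation of ordinary paths. *)
Definition OverR' j (A : typ 0) (X : typ j) (x y : A) (p : x =={0} y)
  (q : y =={0} x) (s : p⁻¹ =={0} q) (b c : X)
  (w : Over j p b c) (w' : Over j q c b) : typ j :=
  over2 0 j A (fun _ => X) y x p⁻¹ q s c b
    (oinv 0 j A (fun _ => X) x y p b c w) w'.
Instance : library := define (OverR' 0).
Instance : library := define (OverR' 1).
Definition OverR i := cite_levels OverR' i.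
Arguments OverR i {A X x y} p {q} s {b c} w w'.
Definition apd_R' j (A : typ 0) (X : typ j) (f : forall x : A, X)
  (x y : A) (p : x =={0} y) (q : y =={0} x) (s : p⁻¹ =={0} q) :
  OverR j p s (apd_const j f p) (apd_const j f q) :=
  let P := fun _ : exp => code X in
  let f x := val (f (mk x)) in
  mk (apd2 0 j A P f y x p⁻¹ q s
    (oinv 0 j A P x y p (f x) (f y) (apd 0 j A P f x y p)) (apd_inv 0 j A P f x y p)).
Instance : library := define (apd_R' 0).
Instance : library := define (apd_R' 1).
Definition apd_R i := cite_levels apd_R' i.
Arguments apd_R i {A X} f {x y p q} s.

Definition to_over_R' j (A : typ 0) (X : typ j) (x y : A)
  (p : x =={0} y) (q : y =={0} x) (s : p⁻¹ =={0} q)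
  (b c : X) (u : b =={j} c) (v : c =={j} b)
  (κ : u⁻¹ =={j} v) : OverR j p s (to_over j p u) (to_over j q v).
Proof. pind j s. pind j p. exact (cast κ). Defined.
Instance : library := define (to_over_R' 0).
Instance : library := define (to_over_R' 1).
Definition to_over_R i := cite_levels to_over_R' i.
Arguments to_over_R i {A X x y p q} s {b c u v} κ.

Definition from_over_R' j (A : typ 0) (X : typ j) (x y : A)
  (p : x =={0} y) (q : y =={0} x) (s : p⁻¹ =={0} q)
  (b c : X) (w : Over j p b c) (w' : Over j q c b)
  (t : OverR j p s w w') : (from_over j p w)⁻¹ =={j} from_over j q w'.
Proof.
  gen t. gen w'. pind j s. gen w. pind j p. lam w. lam w'. lam t. exact (cast t).
Defined.
Instance : library := define (from_over_R' 0).
Instance : library := define (from_over_R' 1).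
Definition from_over_R i := cite_levels from_over_R' i.
Arguments from_over_R i {A X x y p q} s {b c w w'} t.

Definition tr_R' j (X : typ j) (b c : X) (u u' : b =={j} c)
  (v v' : c =={j} b) (α : u =={j} u') (β : v =={j} v')
  (κ : u⁻¹ =={j} v) : u'⁻¹ =={j} v' :=
  tr (j := j) (fun v => u'⁻¹ =={j} v) β (tr (j := j) (fun u => u⁻¹ =={j} v) α κ).
Instance : library := define (tr_R' 0).
Instance : library := define (tr_R' 1).
Definition tr_R i := cite_levels tr_R' i.
Arguments tr_R i {X b c u u' v v'} α β κ.

Definition from_to_over_R' j (A : typ 0) (X : typ j) (x y : A)
  (p : x =={0} y) (q : y =={0} x) (s : p⁻¹ =={0} q)
  (b c : X) (u : b =={j} c) (v : c =={j} b) (κ : u⁻¹ =={j} v) :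
  tr_R j (from_to_over j p u) (from_to_over j q v)
    (from_over_R j s (to_over_R j s κ)) =={j} κ.
Proof. pind j s. pind j p. exact (cast (rfl_at j κ)). Defined.
Instance : library := define (from_to_over_R' 0).
Instance : library := define (from_to_over_R' 1).
Definition from_to_over_R i := cite_levels from_to_over_R' i.
Arguments from_to_over_R i {A X x y p q} s {b c u v} κ.

Definition from_apd_R' j (A : typ 0) (X : typ j) (f : forall x : A, X)
  (x y : A) (p : x =={0} y) (q : y =={0} x) (s : p⁻¹ =={0} q) :
  tr_R j (from_apd j f p) (from_apd j f q)
    (from_over_R j s (apd_R j f s)) =={j} ap_iv j f s.
Proof.
  pind j s. pind j p. exact (cast (rfl_at j (rfl_at j (rfl_at j (f x))))).
Defined.
Instance : library := define (from_apd_R' 0).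
Instance : library := define (from_apd_R' 1).
Definition from_apd_R i := cite_levels from_apd_R' i.
Arguments from_apd_R i {A X} f {x y p q} s.

Definition dr_eq' j (X : typ j) (b : X) (u u' : b =={j} b)
  (κ : u⁻¹ =={j} u) (κ' : u'⁻¹ =={j} u') (α : u =={j} u')
  (h : tr_R j α α κ =={j} κ') : dr j u κ =={j} dr j u' κ'.
Proof.
  gen h. gen κ'. pind j α. lam κ'. lam h.
  exact (app_path j j (dr j u) (cast (B := κ =={j} κ') h)).
Defined.
Instance : library := derive (dr_eq' 0).
Instance : library := derive (dr_eq' 1).
Definition dr_eq i := cite_levels dr_eq' i.
Arguments dr_eq i {X b u u' κ κ'} α h.

Definition recR' j (X : typ j) (b : X) (u : b =={j} b) (κ : u⁻¹ =={j} u) (x : RP2) : X :=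
  mk (C (cRPInd j) $ (λ _, X) $ b $ to_over j rloop u $ to_over_R j rsq κ $ x).
Instance : library := define (recR' 0).
Instance : library := define (recR' 1).
Definition recR i := cite_levels recR' i.
Arguments recR i {X} b u κ x.

(** The computation rule is a single path between tuples of paths over. Applying the translation [Θ]
    to it treats loop and 2-path at once; the two ends are then adjusted by [dr_eq]. *)
Definition betaR' j (X : typ j) (b : X) (u : b =={j} b) (κ : u⁻¹ =={j} u) :
  cast (B := DR j b) (evR j (recR j b u κ)) =={j} dr j u κ.
Proof.
  pose (T := Sg j (Over j rloop b b) (fun w => OverR j rloop rsq w w)).
  pose (Θ := fun t : T => dr j (from_over j rloop (pr1 t)) (from_over_R j rsq (pr2 t))).
  pose (f := recR j b u κ).
  pose (mkT := @pair j (Over j rloop b b) (fun w => OverR j rloop rsq w w)).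
  pose (t := mkT (cast (apd_const j f rloop)) (cast (apd_R j f rsq))).
  pose (t' := mkT (to_over j rloop u) (to_over_R j rsq κ)).
  assert (E : @Eq j T t t').
  { exact (mk (C (cRPbeta j) $ (λ _, X) $ b $ to_over j rloop u $ to_over_R j rsq κ)). }
  refine (cc (y := Θ t) _ (cc (y := Θ t') (app_path j j Θ E) _)).
  - exact (cast (iv (dr_eq j (from_apd j f rloop) (from_apd_R j f rsq)))).
  - exact (cast (dr_eq j (from_to_over j rloop u) (from_to_over_R j rsq κ))).
Defined.
Instance : library := derive (betaR' 0).
Instance : library := derive (betaR' 1).
Definition betaR i := cite_levels betaR' i.
Arguments betaR i {X} b u κ.

Definition OverK' j (A : typ 0) (X : typ j) (x y z w : A)
  (p : x =={0} y) (q : y =={0} z) (r : z =={0} w)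
  (s : x =={0} w) (h : (p • q) • r =={0} s) (b c d e : X)
  (t : Over j p b c) (t' : Over j q c d) (t'' : Over j r d e)
  (t3 : Over j s b e) : typ j :=
  let P := fun _ : exp => code X in
  over2 0 j A P x w ((p • q) • r) s h b e
    (oconcat 0 j A P x z w (p • q) r b d e
      (oconcat 0 j A P x y z p q b c d t t') t'') t3.
Instance : library := define (OverK' 0).
Instance : library := define (OverK' 1).
Definition OverK i := cite_levels OverK' i.
Arguments OverK i {A X x y z w p q r s} h {b c d e} t t' t'' t3.
Definition apd_K' j (A : typ 0) (X : typ j) (f : forall x : A, X) (x y z w : A)
  (p : x =={0} y) (q : y =={0} z) (r : z =={0} w)
  (s : x =={0} w) (h : (p • q) • r =={0} s) :
  OverK j h (apd_const j f p) (apd_const j f q) (apd_const j f r)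
    (apd_const j f s) :=
  let P := fun _ : exp => code X in
  let f x := val (f (mk x)) in
  let D x y p := apd 0 j A P f x y p in
  let O p := over 0 j A P x w p (f x) (f w) in
  let w12 := oconcat 0 j A P x y z p q (f x) (f y) (f z) (D x y p) (D y z q) in
  let R v := oconcat 0 j A P x z w (p • q) r (f x) (f z) (f w) v (D z w r) in
  mk (apd2 0 j A P f x w ((p • q) • r) s h (R w12)
    (comp j (O ((p • q) • r)) (R w12) (R (D x z (p • q))) (D x w ((p • q) • r))
       (ap j j (over 0 j A P x z (p • q) (f x) (f z)) (O ((p • q) • r)) R
          w12 (D x z (p • q)) (apd_concat 0 j A P f x y z p q))
       (apd_concat 0 j A P f x z w (p • q) r))).
Instance : library := define (apd_K' 0).
Instance : library := define (apd_K' 1).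
Definition apd_K i := cite_levels apd_K' i.
Arguments apd_K i {A X} f {x y z w p q r s} h.

Definition to_over_K' j (A : typ 0) (X : typ j) (x y z w : A)
  (p : x =={0} y) (q : y =={0} z) (r : z =={0} w)
  (s : x =={0} w) (h : (p • q) • r =={0} s) (b c d e : X)
  (u : b =={j} c) (v : c =={j} d) (v' : d =={j} e)
  (t : b =={j} e) (κ : (u • v) • v' =={j} t) :
  OverK j h (to_over j p u) (to_over j q v) (to_over j r v') (to_over j s t).
Proof. pind j h. pind j r. pind j q. pind j p. exact (cast κ). Defined.
Instance : library := define (to_over_K' 0).
Instance : library := define (to_over_K' 1).
Definition to_over_K i := cite_levels to_over_K' i.
Arguments to_over_K i {A X x y z w p q r s} h {b c d e u v v' t} κ.

Definition from_over_K' j (A : typ 0) (X : typ j) (x y z w : A)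
  (p : x =={0} y) (q : y =={0} z) (r : z =={0} w)
  (s : x =={0} w) (h : (p • q) • r =={0} s) (b c d e : X)
  (t : Over j p b c) (t' : Over j q c d) (t'' : Over j r d e)
  (t3 : Over j s b e) (o : OverK j h t t' t'' t3) :
  (from_over j p t • from_over j q t') • from_over j r t'' =={j} from_over j s t3.
Proof.
  gen o. gen t3. pind j h. gen t''. pind j r. gen t'. pind j q. gen t. pind j p.
  lam t. lam t'. lam t''. lam t3. lam o. exact (cast o).
Defined.
Instance : library := define (from_over_K' 0).
Instance : library := define (from_over_K' 1).
Definition from_over_K i := cite_levels from_over_K' i.
Arguments from_over_K i {A X x y z w p q r s} h {b c d e t t' t'' t3} o.

Definition tr_K' j (X : typ j) (b c d e : X) (u u' : b =={j} c)
  (v v' : c =={j} d) (w w' : d =={j} e) (z z' : b =={j} e)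
  (α : u =={j} u') (β : v =={j} v') (γ : w =={j} w') (δ : z =={j} z')
  (κ : (u • v) • w =={j} z) : (u' • v') • w' =={j} z' :=
  tr (j := j) (fun z => (u' • v') • w' =={j} z) δ
    (tr (j := j) (fun w => (u' • v') • w =={j} z) γ
      (tr (j := j) (fun v => (u' • v) • w =={j} z) β
        (tr (j := j) (fun u => (u • v) • w =={j} z) α κ))).
Instance : library := define (tr_K' 0).
Instance : library := define (tr_K' 1).
Definition tr_K i := cite_levels tr_K' i.
Arguments tr_K i {X b c d e u u' v v' w w' z z'} α β γ δ κ.

Definition from_to_over_K' j (A : typ 0) (X : typ j) (x y z w : A)
  (p : x =={0} y) (q : y =={0} z) (r : z =={0} w)
  (s : x =={0} w) (h : (p • q) • r =={0} s) (b c d e : X)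
  (u : b =={j} c) (v : c =={j} d) (v' : d =={j} e)
  (t : b =={j} e) (κ : (u • v) • v' =={j} t) :
  tr_K j (from_to_over j p u) (from_to_over j q v) (from_to_over j r v')
    (from_to_over j s t) (from_over_K j h (to_over_K j h κ)) =={j} κ.
Proof. pind j h. pind j r. pind j q. pind j p. exact (cast (rfl_at j κ)). Defined.
Instance : library := define (from_to_over_K' 0).
Instance : library := define (from_to_over_K' 1).
Definition from_to_over_K i := cite_levels from_to_over_K' i.
Arguments from_to_over_K i {A X x y z w p q r s} h {b c d e u v v' t} κ.

Definition from_apd_K' j (A : typ 0) (X : typ j) (f : forall x : A, X)
  (x y z w : A) (p : x =={0} y) (q : y =={0} z)
  (r : z =={0} w) (s : x =={0} w) (h : (p • q) • r =={0} s) :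
  tr_K j (from_apd j f p) (from_apd j f q) (from_apd j f r) (from_apd j f s)
    (from_over_K j h (apd_K j f h)) =={j} ap_cc j f h.
Proof.
  pind j h. pind j r. pind j q. pind j p.
  exact (cast (rfl_at j (rfl_at j (rfl_at j (f x))))).
Defined.
Instance : library := define (from_apd_K' 0).
Instance : library := define (from_apd_K' 1).
Definition from_apd_K i := cite_levels from_apd_K' i.
Arguments from_apd_K i {A X} f {x y z w p q r s} h.

Definition dk_eq' j (X : typ j) (b : X) (u u' v v' : b =={j} b)
  (κ : (u • v) • u =={j} v) (κ' : (u' • v') • u' =={j} v')
  (α : u =={j} u') (β : v =={j} v')
  (h : tr_K j α β α β κ =={j} κ') : dk j u v κ =={j} dk j u' v' κ'.
Proof.
  gen h. gen κ'. pind j β. pind j α. lam κ'. lam h.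
  exact (app_path j j (dk j u v) (cast (B := κ =={j} κ') h)).
Defined.
Instance : library := derive (dk_eq' 0).
Instance : library := derive (dk_eq' 1).
Definition dk_eq i := cite_levels dk_eq' i.
Arguments dk_eq i {X b u u' v v' κ κ'} α β h.

Definition recK' j (X : typ j) (b : X) (u v : b =={j} b)
  (κ : (u • v) • u =={j} v) (x : K2) : X :=
  mk (C (cKInd j) $ (λ _, X) $ b $ to_over j kloop1 u $ to_over j kloop2 v $
      to_over_K j ksq κ $ x).
Instance : library := define (recK' 0).
Instance : library := define (recK' 1).
Definition recK i := cite_levels recK' i.
Arguments recK i {X} b u v κ x.

Definition betaK' j (X : typ j) (b : X) (u v : b =={j} b) (κ : (u • v) • u =={j} v) :
  cast (B := DK j b) (evK j (recK j b u v κ)) =={j} dk j u v κ.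
Proof.
  pose (P1 := Over j kloop1 b b). pose (P2 := Over j kloop2 b b).
  pose (S := fun (w : P1) (w' : P2) => OverK j ksq w w' w w').
  pose (T := Sg j P1 (fun w => Sg j P2 (fun w' => S w w'))).
  pose (Θ := fun t : T => dk j (from_over j kloop1 (pr1 t))
     (from_over j kloop2 (pr1 (pr2 t))) (from_over_K j ksq (pr2 (pr2 t)))).
  pose (f := recK j b u v κ).
  pose (mkT w w' s := @pair j P1 (fun w => Sg j P2 (fun w' => S w w')) w
    (@pair j P2 (fun w' => S w w') w' s)).
  pose (t := mkT (cast (apd_const j f kloop1)) (cast (apd_const j f kloop2))
    (cast (apd_K j f ksq))).
  pose (t' := mkT (to_over j kloop1 u) (to_over j kloop2 v) (to_over_K j ksq κ)).
  assert (E : @Eq j T t t').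
  { exact (mk (C (cKbeta j) $ (λ _, X) $ b $ to_over j kloop1 u $ to_over j kloop2 v $
      to_over_K j ksq κ)). }
  refine (cc (y := Θ t) _ (cc (y := Θ t') (app_path j j Θ E) _)).
  - exact (cast (iv (dk_eq j (from_apd j f kloop1) (from_apd j f kloop2)
    (from_apd_K j f ksq)))).
  - exact (cast (dk_eq j (from_to_over j kloop1 u) (from_to_over j kloop2 v)
    (from_to_over_K j ksq κ))).
Defined.
Instance : library := derive (betaK' 0).
Instance : library := derive (betaK' 1).
Definition betaK i := cite_levels betaK' i.
Arguments betaK i {X} b u v κ.

(** * Uniqueness of maps with given data *)

Definition dr_code' (X : typ 1) (b : X) (u : b == b)
  (κ : u⁻¹ == u) (d : DR 1 b) : typ 1 :=
  dr_ind 2 (fun _ => U 1) (fun u' κ' => mk (code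
    (Sg 1 (u == u') (fun α => tr_R 1 α α κ == κ')))) d.
Instance : library := define dr_code'.
Definition dr_code := cite dr_code'.
Arguments dr_code {X b} u κ d.
(** A converse to [dr_eq]: it extracts from the equality [betaR] the path of loops and its
    coherence, from which a homotopy of maps is built. *)
Definition dr_encode' (X : typ 1) (b : X) (u : b == b)
  (κ : u⁻¹ == u) (d : DR 1 b) (E : dr 1 u κ == d) : dr_code u κ d.
Proof.
  pind 1 E. exact (cast (@pair 1 (u == u) (fun α => tr_R 1 α α κ == κ)
    (rfl u) (cast (rfl κ)))).
Defined.
Instance : library := derive dr_encode'.
Definition dr_encode := cite dr_encode'.
Arguments dr_encode {X b u κ d} E.

Definition dk_code' (X : typ 1) (b : X) (u v : b == b)
  (κ : (u • v) • u == v) (e : DK 1 b) : typ 1 :=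
  dk_ind 2 (fun _ => U 1) (fun u' v' κ' => mk (code
    (Sg 1 (u == u') (fun α => Sg 1 (v == v') (fun β => tr_K 1 α β α β κ == κ'))))) e.
Instance : library := define dk_code'.
Definition dk_code := cite dk_code'.
Arguments dk_code {X b} u v κ e.
Definition dk_encode' (X : typ 1) (b : X) (u v : b == b)
  (κ : (u • v) • u == v) (e : DK 1 b) (E : dk 1 u v κ == e) : dk_code u v κ e.
Proof.
  pind 1 E. exact (cast (@pair 1 (u == u) (fun α => Sg 1 (v == v)
    (fun β => tr_K 1 α β α β κ == κ))
    (rfl u) (@pair 1 (v == v) (fun β => tr_K 1 (rfl u) β (rfl u) β κ == κ)
      (rfl v) (cast (rfl κ))))).
Defined.
Instance : library := derive dk_encode'.
Definition dk_encode := cite dk_encode'.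
Arguments dk_encode {X b u v κ e} E.

(** When [u] and [v] are the images of [p] under [f] and [g], such a square gives a path over [p] in
    the family of the types [f x == g x], by [over_sq]. Squares can be inverted and composed without
    reference to [p]. *)
Definition Sq' (X : typ 1) (a a' b b' : X) (h : a == a')
  (k : b == b') (u : a == b) (v : a' == b') : typ 1 :=
  h • v == u • k.
Instance : library := define Sq'.
Definition Sq := cite Sq'.
Arguments Sq {X a a' b b'} h k u v.

Definition sq_rfl' (X : typ 1) (a a' : X) (h k : a == a')
  (σ : Sq h k (rfl a) (rfl a')) : h == k :=
  cast (B := h == rfl a • k) σ • cc_rfl_l k.
Instance : library := define sq_rfl'.
Definition sq_rfl := cite sq_rfl'.
Arguments sq_rfl {X a a' h k} σ.

Definition sq_iv' (X : typ 1) (a a' b b' : X) (h : a == a')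
  (k : b == b') (u : a == b) (v : a' == b') (σ : Sq h k u v) : Sq k h u⁻¹ v⁻¹.
Proof.
  gen σ. gen k. pind 1 v. pind 1 u. lam k. lam σ.
  exact (cast ((sq_rfl σ)⁻¹ • (cc_rfl_l h)⁻¹)).
Defined.
Instance : library := define sq_iv'.
Definition sq_iv := cite sq_iv'.
Arguments sq_iv {X a a' b b' h k u v} σ.

Definition sq_cc' (X : typ 1) (a a' b b' c c' : X) (h : a == a')
  (k : b == b') (m : c == c') (u : a == b) (v : b == c) (u' : a' == b') (v' : b' == c')
  (σ : Sq h k u u') (τ : Sq k m v v') : Sq h m (u • v) (u' • v').
Proof.
  gen τ. gen m. pind 1 v'. pind 1 v. lam m. lam τ.
  exact (cast (cast (B := h • u' == u • k) σ • ap1 (fun k => u • k) (sq_rfl τ))).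
Defined.
Instance : library := define sq_cc'.
Definition sq_cc := cite sq_cc'.
Arguments sq_cc {X a a' b b' c c' h k m u v u' v'} σ τ.

Definition sq_tr' (X : typ 1) (a a' b b' : X) (h : a == a')
  (k : b == b') (u v : a == b) (u' v' : a' == b')
  (κ : u == v) (κ' : u' == v') (σ : Sq h k u u') : Sq h k v v' :=
  tr (j := 1) (fun w => Sq h k v w) κ' (tr (j := 1) (fun w => Sq h k w u') κ σ).
Instance : library := define sq_tr'.
Definition sq_tr := cite sq_tr'.
Arguments sq_tr {X a a' b b' h k u v u' v'} κ κ' σ.

Definition sq_id' (X : typ 1) (a b : X) (u v : a == b)
  (α : u == v) : Sq (rfl a) (rfl b) u v :=
  cast (cc_rfl_l v • α⁻¹).
Instance : library := define sq_id'.
Definition sq_id := cite sq_id'.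
Arguments sq_id {X a b u v} α.

(** For trivial sides, inverse and composite of squares are those of paths, and so are inverse and
    composite of paths over [rfl]. This and [sq_rfl_cc] are what [over_sq_R] and [over_sq_K] reduce
    to. *)
Definition sq_rfl_iv' (X : typ 1) (a a' : X) (h k : a == a')
  (σ : Sq h k (rfl a) (rfl a')) : sq_rfl (cast (sq_iv σ)) == (sq_rfl σ)⁻¹.
Proof. exact (cast (cc_ivK (sq_rfl σ)⁻¹ (cc_rfl_l h))). Defined.
Instance : library := derive sq_rfl_iv'.
Definition sq_rfl_iv := cite sq_rfl_iv'.
Arguments sq_rfl_iv {X a a' h k} σ.

Definition cc_rfl_l_natural' (X : typ 1) (a a' : X) (h k m : a == a')
  (σ : h == rfl a • k) (t : k == m) :
  (σ • ap1 (fun k => rfl a • k) t) • cc_rfl_l m == (σ • cc_rfl_l k) • t.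
Proof. pind 1 t. exact (cast (rfl (σ • cc_rfl_l k))). Defined.
Instance : library := derive cc_rfl_l_natural'.
Definition cc_rfl_l_natural := cite cc_rfl_l_natural'.
Arguments cc_rfl_l_natural {X a a' h k m} σ t.

Definition sq_rfl_cc' (X : typ 1) (a a' : X) (h k m : a == a')
  (σ : Sq h k (rfl a) (rfl a')) (τ : Sq k m (rfl a) (rfl a')) :
  sq_rfl (cast (sq_cc σ τ)) == sq_rfl σ • sq_rfl τ.
Proof. exact (cast (cc_rfl_l_natural (cast (B := h == rfl a • k) σ) (sq_rfl τ))). Defined.
Instance : library := derive sq_rfl_cc'.
Definition sq_rfl_cc := cite sq_rfl_cc'.
Arguments sq_rfl_cc {X a a' h k m} σ τ.

Definition OverEq' (A : typ 0) (X : typ 1) (f g : forall x : A, X)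
  (x y : A) (p : x =={0} y) (h : f x == g x) (k : f y == g y) : typ 1 :=
  over 0 1 A (fun x => f (mk x) == g (mk x)) x y p h k.
Instance : library := define OverEq'.
Definition OverEq := cite OverEq'.
Arguments OverEq {A X} f g {x y} p h k.

Definition over_sq' (A : typ 0) (X : typ 1) (f g : forall x : A, X)
  (x y : A) (p : x =={0} y) (h : f x == g x)
  (k : f y == g y) (σ : Sq h k (ap0 1 f p) (ap0 1 g p)) : OverEq f g p h k.
Proof. gen σ. gen k. pind 1 p. lam k. lam σ. exact
  (cast (sq_rfl (cast (B := Sq h k (rfl (f x)) (rfl (g x))) σ))). Defined.
Instance : library := define over_sq'.
Definition over_sq := cite over_sq'.
Arguments over_sq {A X} f g {x y} p {h k} σ.

Definition over_sq_R' (A : typ 0) (X : typ 1) (f g : forall x : A, X)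
  (x y : A) (p : x =={0} y) (q : y =={0} x)
  (s : p⁻¹ =={0} q) (h : f x == g x) (k : f y == g y) (σ : Sq h k (ap0 1 f p) (ap0 1 g p))
  (σ' : Sq k h (ap0 1 f q) (ap0 1 g q))
  (c : sq_tr (ap_iv 1 f s) (ap_iv 1 g s) (sq_iv σ) == σ') :
  over2 0 1 A (fun x => f (mk x) == g (mk x)) y x p⁻¹ q s k h
    (oinv 0 1 A (fun x => f (mk x) == g (mk x)) x y p h k (over_sq f g p σ))
    (over_sq f g q σ').
Proof.
  gen c. gen σ'. pind 1 s. gen σ. gen k. pind 1 p. lam k. lam σ. lam σ'. lam c.
  pose (σ0 := cast (B := Sq h k (rfl (f x)) (rfl (g x))) σ).
  pose (τ := cast (B := Sq k h (rfl (f x)) (rfl (g x))) σ').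
  exact (cast ((sq_rfl_iv σ0)⁻¹ •
    ap1 (fun τ : Sq k h (rfl (f x)) (rfl (g x)) => sq_rfl τ)
      (cast (B := cast (sq_iv σ0) == τ) c))).
Defined.
Instance : library := derive over_sq_R'.
Definition over_sq_R := cite over_sq_R'.
Arguments over_sq_R {A X} f g {x y p q} s {h k σ σ'} c.

Definition over_sq_K' (A : typ 0) (X : typ 1) (f g : forall x : A, X)
  (x y z w : A) (p : x =={0} y) (q : y =={0} z)
  (r : z =={0} w) (t : x =={0} w) (s : (p • q) • r =={0} t)
  (h : f x == g x) (k : f y == g y) (m : f z == g z) (n : f w == g w)
  (σ : Sq h k (ap0 1 f p) (ap0 1 g p)) (τ : Sq k m (ap0 1 f q) (ap0 1 g q))
  (σ' : Sq m n (ap0 1 f r) (ap0 1 g r)) (ω : Sq h n (ap0 1 f t) (ap0 1 g t))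
  (c : sq_tr (ap_cc 1 f s) (ap_cc 1 g s) (sq_cc (sq_cc σ τ) σ') == ω) :
  let P := fun x : exp => code (f (mk x) == g (mk x)) in
    over2 0 1 A P x w ((p • q) • r) t s h n
    (oconcat 0 1 A P x z w (p • q) r h m n
      (oconcat 0 1 A P x y z p q h k m (over_sq f g p σ) (over_sq f g q τ))
      (over_sq f g r σ'))
    (over_sq f g t ω).
Proof.
  gen c. gen ω. pind 1 s. gen σ'. gen n. pind 1 r. gen τ. gen m. pind 1 q.
  gen σ. gen k. pind 1 p. lam k. lam σ. lam m. lam τ. lam n. lam σ'. lam ω. lam c.
  pose (σ0 := cast (B := Sq h k (rfl (f x)) (rfl (g x))) σ).
  pose (τ0 := cast (B := Sq k m (rfl (f x)) (rfl (g x))) τ).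
  pose (ρ0 := cast (B := Sq m n (rfl (f x)) (rfl (g x))) σ').
  pose (ω0 := cast (B := Sq h n (rfl (f x)) (rfl (g x))) ω).
  pose (στ := cast (B := Sq h m (rfl (f x)) (rfl (g x))) (sq_cc σ0 τ0)).
  refine (cast ((ap1 (fun z => z • sq_rfl ρ0) (sq_rfl_cc σ0 τ0))⁻¹ •
    ((sq_rfl_cc στ ρ0)⁻¹ • ap1 (fun τ : Sq h n (rfl (f x)) (rfl (g x)) => sq_rfl τ)
      (cast (B := cast (sq_cc στ ρ0) == ω0) c)))).
Defined.
Instance : library := derive over_sq_K'.
Definition over_sq_K := cite over_sq_K'.
Arguments over_sq_K {A X} f g {x y z w p q r t} s {h k m n σ τ σ' ω} c.

Definition sq_iv_id' (X : typ 1) (a b : X) (u : a == b) :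
  sq_iv (sq_id (rfl u)) == sq_id (rfl u⁻¹).
Proof. pind 1 u. exact (cast (rfl (rfl (rfl a)))). Defined.
Instance : library := derive sq_iv_id'.
Definition sq_iv_id := cite sq_iv_id'.
Arguments sq_iv_id {X a b} u.

Definition sq_cc_id' (X : typ 1) (a b c : X) (u : a == b) (v : b == c) :
  sq_cc (sq_id (rfl u)) (sq_id (rfl v)) == sq_id (rfl (u • v)).
Proof. pind 1 v. exact (cast (rfl (cc_rfl_l u))). Defined.
Instance : library := derive sq_cc_id'.
Definition sq_cc_id := cite sq_cc_id'.
Arguments sq_cc_id {X a b c} u v.

Definition sq_tr_id' (X : typ 1) (a b : X) (u v : a == b)
  (κ : u == v) : sq_tr κ κ (sq_id (rfl u)) == sq_id (rfl v).
Proof. pind 1 κ. exact (cast (rfl (cc_rfl_l u))). Defined.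
Instance : library := derive sq_tr_id'.
Definition sq_tr_id := cite sq_tr_id'.
Arguments sq_tr_id {X a b u v} κ.

(** Supplies the equation between squares demanded by [over_sq_R] from the coherence that
    [dr_encode] extracts. *)
Definition sq_coherent_R' (X : typ 1) (b : X) (u u' : b == b)
  (κ : u⁻¹ == u) (κ' : u'⁻¹ == u') (α : u == u') (c : tr_R 1 α α κ == κ') :
  sq_tr κ κ' (sq_iv (sq_id α)) == sq_id α.
Proof.
  gen c. gen κ'. pind 1 α. lam κ'. lam c.
  refine (path_ind 1 (fun κ' _ => sq_tr κ κ' (sq_iv (sq_id (rfl u))) ==
    sq_id (rfl u)) _ κ' (cast (B := κ == κ') c)).
  exact (ap1 (sq_tr κ κ) (sq_iv_id u) • sq_tr_id κ).
Defined.
Instance : library := derive sq_coherent_R'.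
Definition sq_coherent_R := cite sq_coherent_R'.
Arguments sq_coherent_R {X b u u' κ κ' α} c.

Definition sq_coherent_K' (X : typ 1) (b : X) (u u' v v' : b == b)
  (κ : (u • v) • u == v) (κ' : (u' • v') • u' == v')
  (α : u == u') (β : v == v') (c : tr_K 1 α β α β κ == κ') :
  sq_tr κ κ' (sq_cc (sq_cc (sq_id α) (sq_id β)) (sq_id α)) == sq_id β.
Proof.
  gen c. gen κ'. pind 1 β. pind 1 α. lam κ'. lam c.
  refine (path_ind 1 (fun κ' _ => sq_tr κ κ' (sq_cc (sq_cc (sq_id (rfl u))
    (sq_id (rfl v))) (sq_id (rfl u))) == sq_id (rfl v)) _ κ' (cast (B := κ == κ') c)).
  refine (ap1 (sq_tr κ κ) _ • sq_tr_id κ).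
  exact (ap1 (fun z => sq_cc z (sq_id (rfl u))) (sq_cc_id u v) • sq_cc_id (u • v) u).
Defined.
Instance : library := derive sq_coherent_K'.
Definition sq_coherent_K := cite sq_coherent_K'.
Arguments sq_coherent_K {X b u u' v v' κ κ' α β} c.

(** The two maps agree judgmentally at [rpt], so the homotopy starts with [rfl b]. Their data agree
    by [betaR], and its components provide the square over the loop and its coherence. *)
Definition etaR' (X : typ 1) (f : forall x : RP2, X) (x : RP2) :
  recR 1 (f rpt) (ap0 1 f rloop) (ap_iv 1 f rsq) x == f x.
Proof.
  pose (b := f rpt). pose (u := ap0 1 f rloop : b == b).
  pose (κ := ap_iv 1 f rsq : u⁻¹ == u).
  pose (r := recR 1 b u κ). pose (u' := cast (B := b == b) (ap0 1 r rloop)).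
  pose (κ' := cast (B := u'⁻¹ == u') (ap_iv 1 r rsq)).
  pose (E := cast (B := dr 1 u' κ' == dr 1 u κ) (betaR 1 b u κ)).
  pose (e := cast (B := Sg 1 (u' == u) (fun α => tr_R 1 α α κ' == κ)) (dr_encode E)).
  pose (c := over_sq_R r f rsq (h := cast (rfl b)) (k := cast (rfl b))
    (σ := cast (sq_id (pr1 e))) (σ' := cast (sq_id (pr1 e)))
    (cast (sq_coherent_R (pr2 e)))).
  exact (mk (C (cRPInd 1) $ (λ x, r (mk x) == f (mk x)) $ rfl b $
    over_sq r f rloop (h := cast (rfl b)) (k := cast (rfl b)) (cast (sq_id (pr1 e))) $ c $ x)).
Defined.
Instance : library := derive etaR'.
Definition etaR := cite etaR'.
Arguments etaR {X} f x.

Definition etaK' (X : typ 1) (f : forall x : K2, X) (x : K2) :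
  recK 1 (f kpt) (ap0 1 f kloop1) (ap0 1 f kloop2) (ap_cc 1 f ksq) x == f x.
Proof.
  pose (b := f kpt). pose (u := ap0 1 f kloop1 : b == b).
  pose (v := ap0 1 f kloop2 : b == b).
  pose (κ := ap_cc 1 f ksq : (u • v) • u == v).
  pose (r := recK 1 b u v κ). pose (u' := cast (B := b == b) (ap0 1 r kloop1)).
  pose (v' := cast (B := b == b) (ap0 1 r kloop2)).
  pose (κ' := cast (B := (u' • v') • u' == v') (ap_cc 1 r ksq)).
  pose (E := cast (B := dk 1 u' v' κ' == dk 1 u v κ) (betaK 1 b u v κ)).
  pose (e := cast (B := Sg 1 (u' == u) (fun α => Sg 1 (v' == v)
    (fun β => tr_K 1 α β α β κ' == κ))) (dk_encode E)).
  pose (α := pr1 e). pose (β := pr1 (pr2 e)).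
  pose (c := over_sq_K r f ksq (h := cast (rfl b)) (k := cast (rfl b)) (m := cast (rfl b))
    (n := cast (rfl b))
    (σ := cast (sq_id α)) (τ := cast (sq_id β)) (σ' := cast (sq_id α)) (ω := cast (sq_id β))
    (cast (sq_coherent_K (pr2 (pr2 e))))).
  exact (mk (C (cKInd 1) $ (λ x, r (mk x) == f (mk x)) $ rfl b $
    over_sq r f kloop1 (h := cast (rfl b)) (k := cast (rfl b)) (cast (sq_id α)) $
    over_sq r f kloop2 (h := cast (rfl b)) (k := cast (rfl b)) (cast (sq_id β)) $ c $ x)).
Defined.
Instance : library := derive etaK'.
Definition etaK := cite etaK'.
Arguments etaK {X} f x.

(** * The collapse of the second loop *)

Definition collapse' (x : K2) : RP2 :=
  recK 0 rpt rloop (rfl_at 0 rpt) (cast (psi 0 rsq)) x.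
Instance : library := define collapse'.
Definition collapse := cite collapse'.

Definition ap_comp' (A B : typ 0) (X : typ 1) (f : forall x : B, X)
  (g : forall x : A, B) (x y : A) (p : x =={0} y) :
  ap0 1 (fun x => f (g x)) p == ap0 1 f (ap0 0 g p).
Proof. pind 1 p. exact (cast (rfl (rfl (f (g x))))). Defined.
Instance : library := define ap_comp'.
Definition ap_comp := cite ap_comp'.
Arguments ap_comp {A B X} f g {x y} p.

Definition ap_cc_comp' (A B : typ 0) (X : typ 1) (f : forall x : B, X)
  (g : forall x : A, B) (x y z w : A) (p : x =={0} y) (q : y =={0} z) (r : z =={0} w)
  (s : x =={0} w) (h : (p • q) • r =={0} s) :
  tr_K 1 (ap_comp f g p) (ap_comp f g q) (ap_comp f g r) (ap_comp f g s)
    (ap_cc 1 (fun x => f (g x)) h) == ap_cc 1 f (ap_cc 0 g h).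
Proof.
  pind 1 h. pind 1 r. pind 1 q. pind 1 p. exact (cast (rfl (rfl (rfl (f (g x)))))).
Defined.
Instance : library := derive ap_cc_comp'.
Definition ap_cc_comp := cite ap_cc_comp'.
Arguments ap_cc_comp {A B X} f g {x y z w p q r s} h.

Definition mapK' (A : typ 0) (X : typ 1) (f : forall x : A, X)
  (b : A) (e : DK 0 b) : DK 1 (f b) :=
  dk_ind 1 (fun _ => DK 1 (f b))
    (fun u v κ => dk 1 (ap0 1 f u) (ap0 1 f v) (ap_cc 1 f κ)) e.
Instance : library := define mapK'.
Definition mapK := cite mapK'.
Arguments mapK {A X} f {b} e.

Definition ap_psi' (A : typ 0) (X : typ 1) (f : forall x : A, X)
  (x y : A) (p : x =={0} y) (q : y =={0} x) (κ : p⁻¹ =={0} q) :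
  cast (B := ap0 1 f p • ap0 1 f q == rfl (f x))
    (ap_cc 1 f (cast (B := (p • rfl_at 0 y) • q =={0} rfl_at 0 x) (psi 0 κ))) ==
    psi 1 (ap_iv 1 f κ).
Proof. pind 1 κ. pind 1 p. exact (cast (rfl (rfl (rfl (f x))))). Defined.
Instance : library := derive ap_psi'.
Definition ap_psi := cite ap_psi'.
Arguments ap_psi {A X} f {x y p q} κ.

(** Data are functorial, so [f] is applied to the data of [collapse], which are known by [betaK] at
    level 0; on the 2-path, [ap_psi] then moves [f] inside [psi]. *)
Definition evK_collapse' (X : typ 1) (f : forall x : RP2, X) :
  cast (B := DK 1 (f rpt)) (evK 1 (fun x => f (collapse x))) ==
    include 1 (evR 1 f).
Proof.
  refine (cc (y := mapK f (cast (B := DK 0 rpt) (evK 0 collapse))) _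
    (cc (y := mapK f (dk 0 rloop (rfl_at 0 rpt) (cast (psi 0 rsq)))) _ _)).
  - exact (cast (dk_eq 1 (ap_comp f collapse kloop1) (ap_comp f collapse kloop2)
      (ap_cc_comp f collapse ksq))).
  - exact (app_path 0 1 (mapK f) (cast (B := cast (evK 0 collapse) =={0} dk 0 rloop
    (rfl_at 0 rpt) (cast (psi 0 rsq))) (betaK 0 rpt rloop (rfl_at 0 rpt) (cast (psi 0 rsq))))).
  - exact (cast (ap1 (fun κ : ap0 1 f rloop • ap0 1 f rloop == rfl (f rpt) => dk 1
    (ap0 1 f rloop) (rfl (f rpt)) (cast κ)) (ap_psi f rsq))).
Defined.
Instance : library := derive evK_collapse'.
Definition evK_collapse := cite evK_collapse'.
Arguments evK_collapse {X} f.

(** * Truncation levels and cohomology *)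

Definition nat_ind j (P : Nat -> ty) (z : P (mk zero))
  (s : forall n, (P n) -> (P (mk (succ n)))) (n : Nat) : P n :=
  mk (C (cNatInd j) $ (λ n, P (mk n)) $ z $ (λ n h, s (mk n) (mk h)) $ n).
Definition nsucc (n : Nat) : Nat := mk (succ n).
Definition nzero : Nat := mk zero.
Definition one := nsucc nzero.
Definition two := nsucc one.
Definition three := nsucc two.

Definition Contr' (A : typ 1) : typ 1 := Sg 1 A (fun a => ∏ x : A, a == x).
Instance : library := define Contr'.
Definition Contr := cite Contr'.
(** Counted from contractible types: [one] stands for propositions, [two] for sets, [three] for
    1-types. *)
Definition Lev' (k : Nat) (A : typ 1) : typ 1 := ofLevel 1 k A.
Instance : library := define Lev'.
Definition Lev := cite Lev'.
Definition isProp' (A : typ 1) : typ 1 := ∏ x : A, ∏ y : A, x == y.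
Instance : library := define isProp'.
Definition isProp := cite isProp'.
Notation HSet := (Lev two).

Definition pr (A : typ 1) (h : isProp A) (x y : A) : x == y :=
  cast (B := isProp' A) h @ x @ y.
Arguments pr {A} h x y.
Definition is_prop {A : typ 1} (h : forall x y : A, x == y) :
  isProp A := cast (fn (fun x => fn (fun y => h x y))).
Definition center {A : typ 1} (h : Contr A) : A :=
  pr1 (cast (B := Contr' A) h).
Definition contract {A : typ 1} (h : Contr A) (x : A) :
  center h == x := pr2 (cast (B := Contr' A) h) @ x.
Definition contr {A : typ 1} (a : A) (h : forall x : A, a == x) :
  Contr A := cast (@pair 1 A (fun a => ∏ x : A, a == x) a (fn h)).

Definition cc_iv_l' (A : typ 1) (x y : A) (p : x == y) : p⁻¹ • p == rfl y.
Proof. pind 1 p. exact (cast (rfl (rfl x))). Defined.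
Instance : library := derive cc_iv_l'.
Definition cc_iv_l := cite cc_iv_l'.
Arguments cc_iv_l {A x y} p.

Definition prop_paths' (A : typ 1) (h : isProp A) (x y : A) : Contr (x == y).
Proof.
  refine (contr ((pr h x x)⁻¹ • pr h x y) (fun p => _)).
  pind 1 p. exact (cc_iv_l _).
Defined.
Instance : library := derive prop_paths'.
Definition prop_paths := cite prop_paths'.
Arguments prop_paths {A} h x y.

Definition contr_prop' (A : typ 1) (h : Contr A) : isProp A.
Proof.
  exact (is_prop (fun x y => (contract h x)⁻¹ • contract h y)).
Defined.
Instance : library := derive contr_prop'.
Definition contr_prop := cite contr_prop'.
Arguments contr_prop {A} h.

Definition lev_succ' (k : Nat) (A : typ 1) (h : Lev k A) : Lev (nsucc k) A.
Proof.
  refine (cast (app (app (nat_ind 2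
    (fun k => ∏ A : U 1, Lev k (El A) ⟶ Lev (nsucc k) (El A)) _ _ k)
    (mk (code A))) h)).
  - lam B. lam g. refine (cast (fn (fun x : El B => fn (fun y : El B =>
      prop_paths (contr_prop (cast g)) x y)))).
  - intros n IH. lam B. lam g.
    refine (cast (fn (fun x : El B => fn (fun y : El B => _)))).
    exact (IH @ mk (code (x == y)) @
      cast (cast (B := ∏ x : El B, ∏ y : El B, Lev n (x == y)) g @ x @ y)).
Defined.
Instance : library := derive lev_succ'.
Definition lev_succ := cite lev_succ'.
Arguments lev_succ {k A} h.

Definition prop_lev' (A : typ 1) (h : isProp A) (k : Nat) : Lev (nsucc k) A.
Proof.
  refine (nat_ind 1 (fun k => Lev (nsucc k) A) _ _ k).
  - exact (cast (fn (fun x => fn (fun y => prop_paths h x y)))).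
  - intros n g. exact (lev_succ g).
Defined.
Instance : library := derive prop_lev'.
Definition prop_lev := cite prop_lev'.
Arguments prop_lev {A} h k.

Definition set_lev' (A : typ 1) (h : HSet A) (k : Nat) : Lev (nsucc (nsucc k)) A.
Proof.
  refine (nat_ind 1 (fun k => Lev (nsucc (nsucc k)) A) h _ k).
  intros n g. exact (lev_succ g).
Defined.
Instance : library := derive set_lev'.
Definition set_lev := cite set_lev'.
Arguments set_lev {A} h k.

Definition lev_paths' (k : Nat) (A : typ 1) (h : Lev (nsucc k) A)
  (x y : A) : Lev k (x == y) :=
  cast (B := ∏ x : A, ∏ y : A, Lev k (x == y)) h @ x @ y.
Instance : library := derive lev_paths'.
Definition lev_paths := cite lev_paths'.
Arguments lev_paths {k A} h x y.

Definition set_paths' (A : typ 1) (h : HSet A) (x y : A) (p q : x == y) : p == q :=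
  center (cast (lev_paths (lev_paths h x y) p q)).
Instance : library := derive set_paths'.
Definition set_paths := cite set_paths'.
Arguments set_paths {A} h {x y} p q.

Definition lev1_prop' (A : typ 1) (h : Lev one A) : isProp A :=
  is_prop (fun x y => center (cast (lev_paths h x y))).
Instance : library := derive lev1_prop'.
Definition lev1_prop := cite lev1_prop'.
Arguments lev1_prop {A} h.

Definition fun_ext' (A : typ 1) (B : A -> typ 1) (f g : ∏ x : A, B x)
  (h : ∏ x : A, f @ x == g @ x) : f == g.
Proof.
  pose (E := mk (C (cFunext 1) $ A $ (λ x, B (mk x)) $ f $ g) :
    isEquiv 1 (f == g) (∏ x : A, f @ x == g @ x)
      (fun p => happly 1 A (fun x => B (mk x)) f g p)).
  pose (S := Sg 1 ((∏ x : A, f @ x == g @ x) ⟶ (f == g)) (fun k =>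
     Π y : (∏ x : A, f @ x == g @ x), @Eq 1 (∏ x : A, f @ x == g @ x)
       (mk (happly 1 A (fun x => B (mk x)) f g (k $ y))) (mk y))).
  pose (R := Sg 1 ((∏ x : A, f @ x == g @ x) ⟶ (f == g)) (fun k =>
     Π p : (f == g), @Eq 1 (f == g)
       (mk (k $ (happly 1 A (fun x => B (mk x)) f g p))) (mk p))).
  exact (pr1 (pr1 (cast (B := Sg 1 S (fun _ => R)) E)) @ h).
Defined.
Instance : library := derive fun_ext'.
Definition fun_ext := cite fun_ext'.
Arguments fun_ext {A B f g} h.

Definition pi_prop' (A : typ 1) (B : A -> typ 1)
  (h : forall x : A, isProp (B x)) : isProp (∏ x : A, B x) :=
  is_prop (fun f g => fun_ext (fn (fun x => pr (h x) (f @ x) (g @ x)))).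
Instance : library := derive pi_prop'.
Definition pi_prop := cite pi_prop'.
Arguments pi_prop {A B} h.

Definition sig_path' (A : typ 1) (B : A -> typ 1) (a a' : A)
  (b : B a) (b' : B a') (p : a == a') (q : tr1 B p b == b') :
  @Eq 1 (Sg 1 A B) (pair a b) (pair a' b').
Proof.
  gen q. gen b'. pind 1 p. lam b'. lam q.
  exact (app_path 1 1 (fun b => @pair 1 A B a b) (cast (B := b == b') q)).
Defined.
Instance : library := define sig_path'.
Definition sig_path := cite sig_path'.
Arguments sig_path {A B a a' b b'} p q.

Definition contr_isProp' (A : typ 1) : isProp (Contr A).
Proof.
  pose (B := fun a : A => ∏ x : A, a == x).
  refine (is_prop (fun c d => _)).
  pose (c' := cast (B := Sg 1 A B) c). pose (d' := cast (B := Sg 1 A B) d).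
  pose (P := contr_prop c). clearbody P.
  refine (cast (A := c' == d') _). clearbody c' d'.
  revert c'. refine (sig_ind 1 (fun c' => c' == d') _). intros a f.
  revert d'. refine (sig_ind 1 (fun d' => @pair 1 A B a f == d') _). intros b g.
  refine (sig_path (f @ b) (fun_ext (fn (fun x => _)))).
  exact (set_paths (cast (prop_lev P one)) _ _).
Defined.
Instance : library := derive contr_isProp'.
Definition contr_isProp := cite contr_isProp'.

(** * Set truncation and homotopy classes of maps *)

Definition T0' (A : typ 1) : typ 1 := Trunc 1 zero A.
Instance : library := define T0'.
Definition T0 := cite T0'.
Definition tr0' (A : typ 1) (a : A) : T0 A := mk (Defs.tr 1 zero A a).
Instance : library := define tr0'.
Definition tr0 := cite tr0'.
Arguments tr0 {A} a.
Definition T0_set' (A : typ 1) : HSet (T0 A) :=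
  mk (C (cTrLevel 1) $ zero $ A).
Instance : library := define T0_set'.
Definition T0_set := cite T0_set'.
Definition T0_ind {A : typ 1} (P : (T0 A) -> typ 1)
  (h : forall x, HSet (P x)) (f : forall a : A, P (tr0 a)) (x : T0 A) : P x :=
  mk (C (cTrInd 1 1) $ zero $ A $ (λ x, P (mk x)) $ (λ x, h (mk x)) $ (λ a, f (mk a)) $ x).
Definition T0_rec {A B : typ 1} (h : HSet B) (f : A -> B)
  (x : T0 A) : B := T0_ind (fun _ => B) (fun _ => h) f x.

Definition T0_path' (A B : typ 1) (h : HSet B) (f g : forall x : T0 A, B)
  (e : forall a : A, f (tr0 a) == g (tr0 a)) (x : T0 A) : f x == g x :=
  T0_ind (fun x => f x == g x) (fun x => lev_paths (lev_succ h) (f x) (g x)) e x.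
Instance : library := derive T0_path'.
Definition T0_path := cite T0_path'.
Arguments T0_path {A B} h f g e x.

Definition recDR' (X : typ 1) (b : X) (d : DR 1 b) : RP2 ⟶ X :=
  fn (fun x => dr_ind 1 (fun _ => X) (fun u κ => recR 1 b u κ x) d).
Instance : library := define recDR'.
Definition recDR := cite recDR'.
Arguments recDR {X} b d.
Definition recDK' (X : typ 1) (b : X) (e : DK 1 b) : K2 ⟶ X :=
  fn (fun x => dk_ind 1 (fun _ => X) (fun u v κ => recK 1 b u v κ x) e).
Instance : library := define recDK'.
Definition recDK := cite recDK'.
Arguments recDK {X} b e.

Definition recDR_evR' (X : typ 1) (f : RP2 ⟶ X) : recDR (f @ rpt) (evR 1 (app f)) == f.
Proof. exact (fun_ext (fn (fun x => cast (etaR (app f) x)))). Defined.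
Instance : library := derive recDR_evR'.
Definition recDR_evR := cite recDR_evR'.
Arguments recDR_evR {X} f.
Definition recDK_evK' (X : typ 1) (f : K2 ⟶ X) : recDK (f @ kpt) (evK 1 (app f)) == f.
Proof. exact (fun_ext (fn (fun x => cast (etaK (app f) x)))). Defined.
Instance : library := derive recDK_evK'.
Definition recDK_evK := cite recDK_evK'.
Arguments recDK_evK {X} f.

Definition pullback' (X : typ 1) (f : RP2 ⟶ X) : K2 ⟶ X :=
  fn (fun x => f @ collapse x).
Instance : library := define pullback'.
Definition pullback := cite pullback'.
Arguments pullback {X} f.

Definition extract' (X : typ 1) (H : Homogeneous X) (f : K2 ⟶ X) :
  RP2 ⟶ X := recDR (f @ kpt) (restrict H (evK 1 (app f))).
Instance : library := define extract'.
Definition extract := cite extract'.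
Arguments extract {X} H f.

Definition extract_pullback' (X : typ 1) (H : Homogeneous X)
  (f : RP2 ⟶ X) : extract H (pullback f) == f.
Proof.
  pose (b := f @ rpt). pose (d := evR 1 (app f) : DR 1 b).
  refine (cc (y := recDR b d) _ (recDR_evR f)).
  refine (cast (ap1 (recDR b)
    (cc (y := restrict H (include 1 d)) (ap1 (restrict H) (evK_collapse (app f)))
      (cc (y := restrict H (combine H (rfl b) d))
        (ap1 (restrict H) (combine_rfl H d)⁻¹) (restrict_combine H (rfl b) d))))).
Defined.
Instance : library := derive extract_pullback'.
Definition extract_pullback := cite extract_pullback'.
Arguments extract_pullback {X} H f.

Definition rebuild' (X : typ 1) (H : Homogeneous X) (f : K2 ⟶ X) :
  recDK (f @ kpt) (combine H (ap0 1 (app f) kloop2)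
    (restrict H (evK 1 (app f)))) == f.
Proof.
  refine (_ • recDK_evK f).
  exact (ap1 (recDK (f @ kpt)) (cast (combine_restrict H (evK 1 (app f))))).
Defined.
Instance : library := derive rebuild'.
Definition rebuild := cite rebuild'.
Arguments rebuild {X} H f.

(** Compare [rebuild]: the two right constructions differ only in the second loop, which collapsing
    makes trivial. If that loop is merely trivial anyway, the classes agree. *)
Definition pullback_extract' (X : typ 1) (H : Homogeneous X) (f : K2 ⟶ X) :
  pullback (extract H f) == recDK (f @ kpt) (combine H (rfl (f @ kpt))
    (restrict H (evK 1 (app f)))).
Proof.
  pose (b := f @ kpt). pose (u := ap0 1 (app f) kloop1 : b == b).
  pose (v := ap0 1 (app f) kloop2 : b == b).
  pose (κ := to (theta H u v) (ap_cc 1 (app f) ksq)).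
  pose (d := dr 1 u κ). pose (g := recR 1 b u κ).
  refine (cast (A := fn (fun x => g (collapse x)) ==
    recDK b (combine H (rfl b) d)) _).
  pose (e := cast (B := DK 1 b) (evK 1 (fun x => g (collapse x)))).
  refine (cc (y := recDK b e)
    (cast (recDK_evK (fn (fun x => g (collapse x)))))⁻¹ _).
  refine (ap1 (recDK b) _).
  refine (cc (y := include 1 (cast (B := DR 1 b) (evR 1 g))) (cast (evK_collapse g)) _).
  refine (cc (y := include 1 d) _ (combine_rfl H d)⁻¹).
  exact (ap1 (include 1) (betaR 1 b u κ)).
Defined.
Instance : library := derive pullback_extract'.
Definition pullback_extract := cite pullback_extract'.
Arguments pullback_extract {X} H f.

Definition T0_map' (A B : typ 1) (f : forall x : A, B) (x : T0 A) :
  T0 B := T0_rec (T0_set B) (fun a => tr0 (f a)) x.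
Instance : library := define T0_map'.
Definition T0_map := cite T0_map'.
Arguments T0_map {A B} f x.

Definition pointwise' (S : typ 0) (X : typ 1) (a : X ⟶ X ⟶ X)
  (u v : T0 (S ⟶ X)) : T0 (S ⟶ X) :=
  T0_rec (T0_set (S ⟶ X)) (fun f : S ⟶ X => T0_rec (T0_set (S ⟶ X))
    (fun g : S ⟶ X => tr0 (fn (fun x => a @ (f @ x) @ (g @ x)))) v) u.
Instance : library := define pointwise'.
Definition pointwise := cite pointwise'.
Arguments pointwise {S X} a u v.

Definition pullback_hom' (X : typ 1) (a : X ⟶ X ⟶ X) (u v : T0 (RP2 ⟶ X)) :
  T0_map pullback (pointwise a u v) ==
    pointwise a (T0_map pullback u) (T0_map pullback v).
Proof.
  refine (T0_path (T0_set _) (fun u => T0_map pullback (pointwise a u v))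
    (fun u => pointwise a (T0_map pullback u) (T0_map pullback v)) (fun f => _) u).
  refine (T0_path (T0_set _) (fun v => T0_map pullback (pointwise a (tr0 f) v))
    (fun v => pointwise a (T0_map pullback (tr0 f)) (T0_map pullback v)) (fun g => _) v).
  exact (cast (rfl (T0_map pullback (pointwise a (tr0 f) (tr0 g))))).
Defined.
Instance : library := derive pullback_hom'.
Definition pullback_hom := cite pullback_hom'.
Arguments pullback_hom {X} a u v.

Definition group_iso' (A B : typ 1) (opA : A ⟶ A ⟶ A) (opB : B ⟶ B ⟶ B)
  (f : forall x : A, B) (g : forall x : B, A) (gf : forall x : A, g (f x) == x)
  (fg : forall y : B, f (g y) == y)
  (h : ∏ x : A, ∏ y : A, f (opA @ x @ y) == opB @ f x @ f y) :
  GroupIso 1 A (fun x y => opA $ x $ y) B (fun x y => opB $ x $ y).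
Proof.
  pose (r := @pair 1 (B ⟶ A) (fun g => ∏ y : B, f (g @ y) == y) (fn g) (cast (fn fg))).
  pose (s := @pair 1 (B ⟶ A) (fun g => ∏ x : A, g @ f x == x) (fn g) (cast (fn gf))).
  refine (cast (@pair 1 (A ⟶ B) (fun f =>
    Times 1 (isEquiv 1 A B (fun x => f $ x))
      (Π x : A, Π y : A, Id 1 B (f $ (opA $ x $ y)) (opB $ (f $ x) $ (f $ y)))) (fn f)
    (cast (@pair 1 _ (fun _ => ∏ x : A, ∏ y : A, f (opA @ x @ y) == opB @ f x @ f y)
      (cast (B := isEquiv 1 A B (fun x => f (mk x)))
        (@pair 1 _ (fun _ => Sg 1 (B ⟶ A) (fun g => ∏ x : A, g @ f x == x)) r s))
      h)))).
Defined.
Instance : library := derive group_iso'.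
Definition group_iso := cite group_iso'.
Arguments group_iso {A B} opA opB f g gf fg h.

Definition cohomology_iso' (X : typ 1) (H : Homogeneous X)
  (C : ∏ b : X, ∏ u : b == b, tr0 u == tr0 (rfl b)) (a : X ⟶ X ⟶ X) : GroupIso 1
    (T0 (K2 ⟶ X)) (fun u v => @pointwise K2 X a (mk u) (mk v))
    (T0 (RP2 ⟶ X)) (fun u v => @pointwise RP2 X a (mk u) (mk v)).
Proof.
  pose (p := T0_map (@pullback X)). pose (e := T0_map (extract H)).
  assert (ep : forall x, e (p x) == x).
  { intros x. refine (T0_path (T0_set _) (fun x => e (p x)) (fun x => x) (fun f => _) x).
    exact (cast (ap1 tr0 (extract_pullback H f))). }
  assert (pe : forall x, p (e x) == x).
  { intros x. refine (T0_path (T0_set _) (fun x => p (e x)) (fun x => x) (fun f => _) x).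
    pose (b := f @ kpt). pose (d := restrict H (evK 1 (app f))).
    (* The class of the reconstructed map depends on the second loop only through its truncation,
       where [C] replaces it by [rfl b]. *)
    pose (Φ := fun w : T0 (b == b) =>
      T0_map (fun v => recDK b (combine H v d)) w).
    refine (cc (y := Φ (tr0 (rfl b))) (cast (ap1 tr0 (pullback_extract H f))) _).
    refine (cc (y := Φ (tr0 (ap0 1 (app f) kloop2)))
      (ap1 Φ (C @ b @ (ap0 1 (app f) kloop2)))⁻¹ _).
    exact (cast (ap1 tr0 (rebuild H f))). }
  refine (cast (group_iso (fn (fun u => fn (fun v => pointwise a u v)))
    (fn (fun u => fn (fun v => pointwise a u v))) e p pe ep (fn (fun x => fn (fun y => _))))).
  refine (cast (A := e (pointwise a x y) == pointwise a (e x) (e y)) _).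
  (* Additivity of [e] is inherited from its inverse [p], which is a composition with a fixed
     map. *)
  refine (cc (y := e (p (pointwise a (e x) (e y)))) (ap1 e _) (ep _)).
  refine (cc (y := pointwise a (p (e x)) (p (e y))) _ (pullback_hom a (e x) (e y))⁻¹).
  refine (cc (y := pointwise a (p (e x)) y) _ _).
  - exact (ap1 (fun x => pointwise a x y) (pe x)⁻¹).
  - exact (ap1 (fun y => pointwise a (p (e x)) y) (pe y)⁻¹).
Defined.
Instance : library := derive cohomology_iso'.
Definition cohomology_iso := cite cohomology_iso'.
Arguments cohomology_iso {X} H C a.

(** * Connected H-spaces *)

(* [X] is connected: propositions about its points follow from the case of [e]. *)
Definition Conn' (X : typ 1) (e : X) : typ 2 :=
  ∏ R : (X ⟶ U 1), (∏ x : X, isProp (El (R @ x))) ⟶ El (R @ e) ⟶ ∏ x : X, El (R @ x).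
Instance : library := define Conn'.
Definition Conn := cite Conn'.
Arguments Conn {X} e.

Definition conn_ind {X : typ 1} {e : X} (c : Conn e) (R : X -> typ 1)
  (h : forall x, isProp (R x)) (r : R e) (x : X) : R x :=
  cast (cast (B := Conn' X e) c @ fn (fun x => mk (code (R x))) @
    cast (fn h) @ cast r @ x).

Definition singleton' (X : typ 1) (u : X) : Contr (Sg 1 X (fun v => v == u)).
Proof.
  pose (c := @pair 1 X (fun v => v == u) u (rfl u)).
  refine (contr c (fun t => _)).
  revert t. refine (sig_ind 1 (fun t => c == t) _). intros v p.
  unfold c. clear c.
  pind 1 p. exact (rfl _).
Defined.
Instance : library := derive singleton'.
Definition singleton := cite singleton'.
Arguments singleton {X} u.

Definition fiber_id' (X : typ 1) (g : X ⟶ X) (h : fn (fun x => x) == g)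
  (u : X) : Contr (Sg 1 X (fun v => g @ v == u)).
Proof. pind 1 h. exact (cast (singleton u)). Defined.
Instance : library := derive fiber_id'.
Definition fiber_id := cite fiber_id'.
Arguments fiber_id {X g} h u.

Definition ap_id' (X : typ 1) (x y : X) (p : x == y) : p == ap1 (fun x => x) p.
Proof. pind 1 p. exact (cast (rfl (rfl x))). Defined.
Instance : library := derive ap_id'.
Definition ap_id := cite ap_id'.
Arguments ap_id {X x y} p.

(** Induction replaces [f] by the identity and [r] by [rfl]. What remains is the action of the
    identity on loops, which is the identity by [ap_id] and function extensionality. *)
Definition fiber_loop' (X : typ 1) (e e' : X) (f : X ⟶ X)
  (h : fn (fun x => x) == f) (r : f @ e == e') (u : e' == e') :
  Contr (Sg 1 (e == e) (fun v => tr1 (fun x => x == x) r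
    (ap1 (app f) v) == u)).
Proof.
  gen u. gen r. pind 1 h. lam r. lam u.
  gen u. refine (cast (path_ind 1 (a := e) (fun e' r => ∏ u : e' == e', Contr
    (Sg 1 (e == e) (fun v =>
     tr1 (fun x => x == x) r (cast (ap1 (fun x => x) v)) == u))) _ e' (cast r))).
  lam u.
  exact (cast (fiber_id (X := e == e) (g := fn (fun v : e == e => ap1 (fun x => x) v))
    (fun_ext (f := fn (fun v : e == e => v)) (cast (fn (fun v : e == e => ap_id v)))) u)).
Defined.
Instance : library := derive fiber_loop'.
Definition fiber_loop := cite fiber_loop'.
Arguments fiber_loop {X e e' f} h r u.

(** For fixed [b] a map from loops at [e] to loops at [b]; for fixed [v] a homotopy from the
    identity of [X] to itself. [homogeneous] uses both readings. *)
Definition translate' (X : typ 1) (e : X) (a : X ⟶ X ⟶ X)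
  (ru : ∏ x : X, a @ x @ e == x) (b : X) (v : e == e) : b == b :=
  tr1 (fun x => x == x) (ru @ b) (ap1 (app (a @ b)) v).
Instance : library := define translate'.
Definition translate := cite translate'.
Arguments translate {X e} a ru b v.

Definition translate_contr' (X : typ 1) (e : X) (c : Conn e)
  (a : X ⟶ X ⟶ X) (lu : ∏ x : X, a @ e @ x == x) (ru : ∏ x : X, a @ x @ e == x) (b : X) :
  ∏ u : b == b, Contr (Sg 1 (e == e) (fun v => translate a ru b v == u)).
Proof.
  refine (conn_ind c (fun b => ∏ u : b == b, Contr (Sg 1 (e == e) (fun v =>
    translate a ru b v == u))) (fun b => _) _ b).
  - exact (pi_prop (fun u => contr_isProp _)).
  - refine (fn (fun u => _)).
    exact (cast (fiber_loop (f := a @ e) (fun_ext (f := fn (fun x : X => x))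
      (cast (fn (fun y => (lu @ y)⁻¹)))) (ru @ e) u)).
Defined.
Instance : library := derive translate_contr'.
Definition translate_contr := cite translate_contr'.
Arguments translate_contr {X e} c a lu ru b.

Definition homogeneous' (X : typ 1) (e : X) (c : Conn e)
  (a : X ⟶ X ⟶ X) (lu : ∏ x : X, a @ e @ x == x)
  (ru : ∏ x : X, a @ x @ e == x) : Homogeneous X.
Proof.
  refine (cast (A := Homogeneous' X) (fn (fun b => fn (fun u => _)))).
  pose (t := center (translate_contr c a lu ru b @ u)).
  exact (@pair 1 (∏ x : X, x == x) (fun ε => ε @ b == u)
    (fn (fun x => translate a ru x (pr1 t))) (cast (pr2 t))).
Defined.
Instance : library := derive homogeneous'.
Definition homogeneous := cite homogeneous'.
Arguments homogeneous {X e} c a lu ru.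

(** * Set-valued induction and connectedness of Eilenberg-MacLane spaces *)

Definition susp_ind' (A : typ 1) (a0 : A) (c : Conn a0)
  (Q : El (Susp 1 A) -> typ 1) (h : forall y : El (Susp 1 A), HSet (Q y))
  (q : Q (mk (north 1 A))) (y : El (Susp 1 A)) : Q y.
Proof.
  pose (S := El (Susp 1 A)). pose (n := mk (north 1 A) : S).
  pose (s := mk (south 1 A) : S).
  pose (m := fun a : A => mk (merid 1 A a) : n == s).
  (* The value at the south pole is obtained along the meridian of [a0]. That any other meridian
     gives the same value is a proposition about a point of a connected type. *)
  pose (t := fun a => tr1 Q (m a) q).
  pose (u := conn_ind c (fun a => t a == t a0)
    (fun a => lev1_prop (lev_paths (h s) (t a) (t a0))) (rfl (t a0))).
  exact (mk (C (cSuspInd 1 1) $ A $ (λ y, Q (mk y)) $ q $ t a0 $ (λ a, u (mk a)) $ y)).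
Defined.
Instance : library := define susp_ind'.
Definition susp_ind := cite susp_ind'.
Arguments susp_ind {A a0} c Q h q y.

Definition BG {G : typ 1} (add : G ⟶ G ⟶ G) : typ 1 := EM 1 G add.
Definition bpt {G : typ 1} (add : G ⟶ G ⟶ G) : BG add := mk (EMpt 1 G add).
Definition bloop {G : typ 1} (add : G ⟶ G ⟶ G) (g : G) :
  bpt add == bpt add := mk (EMloop 1 G add g).

(** In a family of sets the premise for the 2-dimensional constructor holds automatically. *)
Definition em_ind' (G : typ 1) (add : G ⟶ G ⟶ G)
  (P : BG add -> typ 1) (h : forall x : BG add, HSet (P x)) (b : P (bpt add))
  (u : ∏ g : G, tr1 P (bloop add g) b == b) (x : BG add) : P x.
Proof.
  pose (A := EM 1 G add). pose (o := EMpt 1 G add).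
  pose (Q := fun x : exp => code (P (mk x))).
  pose (O := fun r => over 1 1 A Q o o r b b).
  assert (s : ∏ g : G, ∏ k : G, El (EMover2 1 1 G add Q b u g k)).
  { lam g. lam k.
    exact (cast (set_paths (h (bpt add))
      (x := tr1 P (bloop add (mk (add $ g $ k))) b) (y := b)
      (mk (transport 1 1 (Id 1 A o o) O
        (EMconcat 1 G add (EMloop 1 G add g) (EMloop 1 G add k))
        (EMloop 1 G add (add $ g $ k)) (EMsq 1 G add g k)
        (EMoconcat 1 1 G add Q b g k (u $ g) (u $ k))))
      (mk (u $ (add $ g $ k))))). }
  exact (mk (C (cEMInd 1 1) $ G $ add $ (λ x, P (mk x)) $ b $ u $ s $ x)).
Defined.
Instance : library := define em_ind'.
Definition em_ind := cite em_ind'.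
Arguments em_ind {G add} P h b u x.

Definition set_path_prop' (A : typ 1) (h : HSet A) (x y : A) :
  isProp (x == y) := lev1_prop (lev_paths h x y).
Instance : library := derive set_path_prop'.
Definition set_path_prop := cite set_path_prop'.
Arguments set_path_prop {A} h x y.

Definition conn (X : typ 1) (e : X)
  (h : forall R : X ⟶ U 1, forall p : ∏ x : X, isProp (El (R @ x)),
    El (R @ e) -> forall x : X, El (R @ x)) : Conn e :=
  cast (fn (fun R => fn (fun p => fn (fun r => fn (fun x => h R p r x))))).
Arguments conn {X} e h.

Definition conn_EM' (G : typ 1) (add : G ⟶ G ⟶ G) : Conn (bpt add).
Proof.
  refine (conn (bpt add) (fun R p r x => em_ind (fun x => El (R @ x))
    (fun x => prop_lev (p @ x) one) r (fn (fun g => _)) x)).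
  exact (pr (p @ bpt add) _ _).
Defined.
Instance : library := derive conn_EM'.
Definition conn_EM := cite conn_EM'.
Arguments conn_EM {G} add.

Definition Su (A : typ 1) : typ 1 := Susp 1 A.
Definition pole (A : typ 1) : Su A := mk (north 1 A).

Definition conn_susp' (A : typ 1) (a0 : A) (c : Conn a0) : Conn (pole A).
Proof.
  exact (conn (pole A) (fun R p r x => susp_ind c (fun x => El (R @ x))
    (fun x => prop_lev (p @ x) one) r x)).
Defined.
Instance : library := derive conn_susp'.
Definition conn_susp := cite conn_susp'.
Arguments conn_susp {A a0} c.

Definition trunc_ind {d : Nat} {A : typ 1} (P : El (Trunc 1 d A) -> typ 1)
  (h : forall x, Lev (nsucc (nsucc d)) (P x)) (f : forall a : A, P (mk (Defs.tr 1 d A a)))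
  (x : El (Trunc 1 d A)) : P x :=
  mk (C (cTrInd 1 1) $ d $ A $ (λ x, P (mk x)) $ (λ x, h (mk x)) $ (λ a, f (mk a)) $ x).

Definition trunc {A : typ 1} (d : Nat) (a : A) : El (Trunc 1 d A) :=
  mk (Defs.tr 1 d A a).

Definition conn_trunc' (d : Nat) (A : typ 1) (a0 : A) (c : Conn a0) : Conn (trunc d a0).
Proof.
  exact (conn (trunc d a0) (fun R p r x => trunc_ind (fun x => El (R @ x))
    (fun x => prop_lev (p @ x) (nsucc d))
    (conn_ind c (fun a => El (R @ trunc d a)) (fun a => p @ trunc d a) r) x)).
Defined.
Instance : library := derive conn_trunc'.
Definition conn_trunc := cite conn_trunc'.
Arguments conn_trunc d {A a0} c.

Definition Kpt' (G : typ 1) (add : G ⟶ G ⟶ G) (m : Nat) : El (Kt 1 G add m) :=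
  nat_ind 1 (fun m => El (Kt 1 G add m)) (cast (bpt add))
    (fun m _ => cast (pole (El (Kt 1 G add m)))) m.
Instance : library := define Kpt'.
Definition Kpt := cite Kpt'.
Arguments Kpt {G} add m.

Definition conn_Kt' (G : typ 1) (add : G ⟶ G ⟶ G) (m : Nat) : Conn (Kpt add m).
Proof.
  refine (nat_ind 2 (fun m => Conn (Kpt add m)) _ _ m).
  - exact (cast (conn_EM add)).
  - intros n IH. exact (cast (conn_susp IH)).
Defined.
Instance : library := derive conn_Kt'.
Definition conn_Kt := cite conn_Kt'.
Arguments conn_Kt {G} add m.

Definition trunc_level' (d : Nat) (A : typ 1) :
  Lev (nsucc (nsucc d)) (El (Trunc 1 d A)) := mk (C (cTrLevel 1) $ d $ A).
Instance : library := derive trunc_level'.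
Definition trunc_level := cite trunc_level'.

Definition trunc_path_level' (d : Nat) (A : typ 1)
  (x y : El (Trunc 1 d A)) : Lev (nsucc (nsucc d)) (x == y) :=
  lev_paths (lev_succ (trunc_level d A)) x y.
Instance : library := derive trunc_path_level'.
Definition trunc_path_level := cite trunc_path_level'.
Arguments trunc_path_level {d A} x y.

Definition loops_susp' (A : typ 1) (a0 : A) (c : Conn a0) (d : Nat) :
  ∏ b : El (Trunc 1 d (Su A)), ∏ u : b == b, tr0 u == tr0 (rfl b).
Proof.
  pose (T := El (Trunc 1 d (Su A))). pose (e := trunc d (pole A) : T).
  (* A section over all [y] that is [tr0 1] at [e] is [tr0 u] at the end of any [u]. *)
  pose (s := fun y : T => trunc_ind (fun y => T0 (e == y))
    (fun y => set_lev (T0_set (e == y)) d)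
    (fun x => susp_ind c (fun x => T0 (e == trunc d x)) (fun x => T0_set (e == trunc d x))
      (tr0 (rfl e)) x) y).
  assert (q : forall (y : T) (u : e == y), s y == tr0 u).
  { intros y u. pind 1 u. exact (cast (rfl (tr0 (rfl e)))). }
  refine (fn (fun b => conn_ind (conn_trunc d (conn_susp c))
    (fun b => ∏ u : b == b, tr0 u == tr0 (rfl b)) (fun b => _) _ b)).
  - exact (pi_prop (fun u => set_path_prop (T0_set (b == b)) (tr0 u) (tr0 (rfl b)))).
  - refine (fn (fun u => _)). exact ((q e u)⁻¹ • q e (rfl e)).
Defined.
Instance : library := derive loops_susp'.
Definition loops_susp := cite loops_susp'.
Arguments loops_susp {A a0} c d.

Definition tr_square' (A X : typ 1) (f g : forall x : A, X) (x y : A)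
  (p : x == y) (h : f x == g x) (k : f y == g y) (σ : ap1 f p • k == h • ap1 g p) :
  tr1 (fun x => f x == g x) p h == k.
Proof.
  gen σ. gen k. pind 1 p. lam k. lam σ.
  exact (cast (cast (B := h == rfl (f x) • k) σ⁻¹ • cc_rfl_l k)).
Defined.
Instance : library := derive tr_square'.
Definition tr_square := cite tr_square'.
Arguments tr_square {A X} f g {x y p h k} σ.

(** * Degree 0 and degrees at least 2 *)

Definition CohIso (G : typ 1) (add : G ⟶ G ⟶ G) (n : Nat) (a : exp) : ty :=
  GroupIso 1 (H 1 G add n K2) (Hadd 1 G add n a K2)
    (H 1 G add n RP2) (Hadd 1 G add n a RP2).

(** In a set every loop is trivial, so the constant homotopy passes through it. *)
Definition iso_zero' (G : typ 1) (add : G ⟶ G ⟶ G) (h : HSet G)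
  (a : G ⟶ G ⟶ G) : CohIso G add nzero a.
Proof.
  refine (cast (cohomology_iso (X := G) (cast (A := Homogeneous' G)
    (fn (fun b => fn (fun u => _)))) (fn (fun b => fn (fun u => _))) a)).
  - exact (@pair 1 (∏ x : G, x == x) (fun ε => ε @ b == u) (fn (fun x => rfl x))
      (set_paths h _ _)).
  - exact (ap1 tr0 (set_paths h _ _)).
Defined.
Instance : library := derive iso_zero'.
Definition iso_zero := cite iso_zero'.
Arguments iso_zero {G} add h a.

Definition Khigh {G : typ 1} (add : G ⟶ G ⟶ G) (m : Nat) : typ 1 :=
  Trunc 1 (nsucc (nsucc m)) (Su (Kt 1 G add m)).

(** The unit laws are prescribed on the suspension. They extend to its truncation, because path
    types of the truncation have the level required for eliminating into them. *)
Definition iso_high' (G : typ 1) (add : G ⟶ G ⟶ G) (m : Nat)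
  (a : Khigh add m ⟶ Khigh add m ⟶ Khigh add m)
  (A : isAdd2 1 G add m a) : CohIso G add (nsucc (nsucc m)) a.
Proof.
  pose (d := nsucc (nsucc m)).
  pose (S := Su (Kt 1 G add m)). pose (T := Khigh add m).
  pose (o := pole (Kt 1 G add m) : S).
  pose (i := fun x => trunc d x : T).
  pose (A' := cast (B := Sg 1 (∏ x : S, a @ i x @ i o == i x) (fun ru =>
    Sg 1 (∏ y : S, a @ i o @ i y == i y) (fun lu => ru @ o == lu @ o))) A).
  pose (ru := pr1 A'). pose (lu := pr1 (pr2 A')).
  pose (c := conn_susp (conn_Kt add m)).
  refine (cast (cohomology_iso (X := T) (homogeneous (e := i o) (conn_trunc d c) a
    (fn (fun x => _)) (fn (fun x => _))) (loops_susp (conn_Kt add m) d) a)).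
  - exact (trunc_ind (fun x => a @ i o @ x == x) (fun x => trunc_path_level _ _)
      (fun y => lu @ y) x).
  - exact (trunc_ind (fun x => a @ x @ i o == x) (fun x => trunc_path_level _ _)
      (fun y => ru @ y) x).
Defined.
Instance : library := derive iso_high'.
Definition iso_high := cite iso_high'.
Arguments iso_high {G} add m a A.

(** * Univalence and the loops of [K(G, 1)] *)

Definition iv_cc' i (A : typ (S i)) (x y : A) (p : x =={S i} y) :
  p⁻¹ • p =={S i} rfl_at (S i) y.
Proof. pind (S i) p. exact (cast (rfl_at (S i) (rfl_at (S i) x))). Defined.
Instance : library := derive (iv_cc' 0).
Instance : library := derive (iv_cc' 1).
Definition iv_cc i := cite_levels iv_cc' i.
Arguments iv_cc i {A x y} p.

(** [X] and [Y] may lie in different universes: a path type of sets lies one level higher than the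
    type of equivalences that bounds it. For path types, the retraction is conjugated with [rs]. *)
Definition retract' i (k : Nat) (X : typ (S i)) (Y : typ 1)
  (r : forall y : Y, X) (s : forall x : X, Y)
  (rs : forall x : X, r (s x) =={S i} x) (h : Lev k Y) : ofLevel (S i) k X.
Proof.
  refine (cast (nat_ind (S (S i)) (fun k => ∏ X : U (S i), ∏ Y : U 1,
    ∏ r : El Y ⟶ El X, ∏ s : El X ⟶ El Y, (∏ x : El X, r @ (s @ x) =={S i} x) ⟶
    Lev k (El Y) ⟶ ofLevel (S i) k X) _ _ k @ mk (code X) @ mk (code Y) @ cast (fn r)
    @ cast (fn s) @ cast (fn rs) @ cast h)).
  - lam X. lam Y. lam r. lam s. lam rs. lam h.
    refine (cast (@pair (S i) (El X) (fun a => ∏ x : El X, a =={S i} x)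
      (r @ center (cast h)) (fn (fun x => _)))).
    exact (cc (y := r @ (s @ x)) (app_path 1 (S i) (app r) (contract (cast h) (s @ x)))
      (rs @ x)).
  - intros n IH. lam X. lam Y. lam r. lam s. lam rs. lam h.
    refine (cast (fn (fun x : El X => fn (fun y : El X => _)))).
    refine (IH @ mk (code (x =={S i} y)) @ mk (code (s @ x == s @ y)) @
      cast (fn (fun q : s @ x == s @ y =>
        cc (y := r @ (s @ y)) (cc (y := r @ (s @ x)) (rs @ x)⁻¹ (app_path 1 (S i) (app r) q))
          (rs @ y))) @
      cast (fn (fun p : x =={S i} y => app_path (S i) 1 (app s) p)) @
      cast (fn (fun p : x =={S i} y => _)) @ lev_paths h (s @ x) (s @ y)).
    refine (path_ind (S i) (fun y p => cc (y := r @ (s @ y)) (cc (y := r @ (s @ x))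
      (rs @ x)⁻¹ (app_path 1 (S i) (app r) (app_path (S i) 1 (app s) p))) (rs @ y)
      =={S i} p) _ y p).
    exact (cast (iv_cc i (rs @ x))).
Defined.
Instance : library := derive (retract' 0).
Instance : library := derive (retract' 1).
Definition retract i := cite_levels retract' i.
Arguments retract i k {X Y} r s rs h.

(** By function extensionality a path type of functions is a retract of a product of
    propositions. *)
Definition pi_set' (A : typ 1) (B : A -> typ 1)
  (h : forall x : A, HSet (B x)) : HSet (∏ x : A, B x).
Proof.
  refine (cast (fn (fun f : ∏ x : A, B x => fn (fun g : ∏ x : A, B x => _)))).
  pose (hap := fun p : f == g => mk (happly 1 A (fun x => B (mk x)) f g p) :
    ∏ x : A, f @ x == g @ x).
  pose (E := mk (C (cFunext 1) $ A $ (λ x, B (mk x)) $ f $ g) :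
    isEquiv 1 (f == g) (∏ x : A, f @ x == g @ x) (fun p => hap (mk p))).
  pose (Q := Sg 1 ((∏ x : A, f @ x == g @ x) ⟶ (f == g)) (fun k =>
     ∏ y : (∏ x : A, f @ x == g @ x), hap (k @ y) == y)).
  pose (R := Sg 1 ((∏ x : A, f @ x == g @ x) ⟶ (f == g)) (fun k =>
     ∏ p : (f == g), k @ hap p == p)).
  pose (k := pr2 (cast (B := Sg 1 Q (fun _ => R)) E)).
  exact (cast (B := Lev one (f == g)) ((retract 0 one
    (X := f == g) (Y := ∏ x : A, f @ x == g @ x) (app (pr1 k)) hap (app (pr2 k))
    (prop_lev (pi_prop (B := fun x => f @ x == g @ x)
      (fun x => set_path_prop (h x) (f @ x) (g @ x))) nzero)))).
Defined.
Instance : library := derive pi_set'.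
Definition pi_set := cite pi_set'.
Arguments pi_set {A B} h.

Definition sub_path' (A : typ 1) (B : A -> typ 1)
  (h : forall x : A, isProp (B x)) (a a' : A) (b : B a) (b' : B a') (p : a == a') :
  @Eq 1 (Sg 1 A B) (pair a b) (pair a' b') :=
  sig_path p (pr (h a') _ _).
Instance : library := derive sub_path'.
Definition sub_path := cite sub_path'.
Arguments sub_path {A B} h {a a' b b'} p.

Definition sig_prop' (A : typ 1) (B : A -> typ 1) (hA : isProp A)
  (hB : forall x : A, isProp (B x)) : isProp (Sg 1 A B).
Proof.
  refine (is_prop (fun t t' => _)).
  revert t. refine (sig_ind 1 (fun t => t == t') _). intros a b.
  revert t'. refine (sig_ind 1 (fun t' => @pair 1 A B a b == t') _). intros a' b'.
  exact (sub_path hB (pr hA a a')).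
Defined.
Instance : library := derive sig_prop'.
Definition sig_prop := cite sig_prop'.
Arguments sig_prop {A B} hA hB.

(** A path type of pairs is a retract of [D], the type of pairs of paths, which is a proposition
    here. *)
Definition sig_set' (A : typ 1) (B : A -> typ 1) (hA : HSet A)
  (hB : forall x : A, HSet (B x)) : HSet (Sg 1 A B).
Proof.
  pose (S := Sg 1 A B).
  refine (cast (fn (fun t : S => fn (fun t' : S => _)))).
  refine (_ : Lev one (t == t')).
  revert t. refine (sig_ind 1 (fun t => Lev one (t == t')) _). intros a b.
  pose (t := @pair 1 A B a b).
  pose (D := fun t' : S => Sg 1 (a == pr1 t') (fun p => tr1 B p b == pr2 t')).
  pose (s := fun (t' : S) (p : t == t') => path_ind 1 (fun t' _ => D t')
    (cast (@pair 1 (a == a) (fun p => tr1 B p b == b) (rfl a) (cast (rfl b)))) t' p).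
  pose (r := fun t' : S => sig_ind 1 (fun t' => D t' ⟶ t == t') (fun a' b' =>
     fn (fun d => sig_ind 1 (fun _ => t == @pair 1 A B a' b')
       (fun p q => sig_path p q) (cast (B := Sg 1 (a == a')
         (fun p => tr1 B p b == b')) d))) t').
  refine (cast (retract 0 one (X := t == t') (Y := D t') (app (r t')) (s t') (fun p => _)
    (prop_lev (A := D t') _ nzero))).
  - refine (path_ind 1 (fun t' p => r t' @ s t' p == p) _ t' p). exact (cast (rfl (rfl t))).
  - exact (sig_prop (set_path_prop hA a (pr1 t'))
    (fun p => set_path_prop (hB (pr1 t')) _ (pr2 t'))).
Defined.
Instance : library := derive sig_set'.
Definition sig_set := cite sig_set'.
Arguments sig_set {A B} hA hB.

Definition RInv' (A B : typ 1) (f : A ⟶ B) : typ 1 :=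
  Sg 1 (B ⟶ A) (fun g => ∏ y : B, f @ (g @ y) == y).
Instance : library := define RInv'.
Definition RInv := cite RInv'.
Arguments RInv {A B} f.
Definition LInv' (A B : typ 1) (f : A ⟶ B) : typ 1 :=
  Sg 1 (B ⟶ A) (fun g => ∏ x : A, g @ (f @ x) == x).
Instance : library := define LInv'.
Definition LInv := cite LInv'.
Arguments LInv {A B} f.

(** Any right inverse agrees pointwise with the left inverse [k]; the remaining component is a
    proposition since [B] is a set. *)
Definition rinv_prop' (A B : typ 1) (hB : HSet B) (f : A ⟶ B)
  (k : B ⟶ A) (η : ∏ x : A, k @ (f @ x) == x) : isProp (RInv f).
Proof.
  pose (P := fun g : B ⟶ A => ∏ y : B, f @ (g @ y) == y).
  refine (cast (is_prop (A := Sg 1 (B ⟶ A) P) (fun t t' => _))).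
  revert t. refine (sig_ind 1 (fun t => t == t') _). intros g ε.
  revert t'. refine (sig_ind 1 (fun t' => @pair 1 (B ⟶ A) P g ε == t') _). intros g' ε'.
  refine (sub_path (B := P) (fun g => pi_prop (B := fun y => f @ (g @ y) == y)
    (fun y => set_path_prop hB (f @ (g @ y)) y))
    (fun_ext (B := fun _ => A) (f := g) (g := g') (fn (fun y => _)))).
  refine (cc (y := k @ y) _ _).
  - exact (cc (y := k @ (f @ (g @ y))) (η @ (g @ y))⁻¹ (ap1 (app k) (ε @ y))).
  - exact (cc (y := k @ (f @ (g' @ y))) (ap1 (app k) (ε' @ y)⁻¹) (η @ (g' @ y))).
Defined.
Instance : library := derive rinv_prop'.
Definition rinv_prop := cite rinv_prop'.
Arguments rinv_prop {A B} hB f k η.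

Definition linv_prop' (A B : typ 1) (hA : HSet A) (f : A ⟶ B)
  (k : B ⟶ A) (ε : ∏ y : B, f @ (k @ y) == y) : isProp (LInv f).
Proof.
  pose (P := fun g : B ⟶ A => ∏ x : A, g @ (f @ x) == x).
  refine (cast (is_prop (A := Sg 1 (B ⟶ A) P) (fun t t' => _))).
  revert t. refine (sig_ind 1 (fun t => t == t') _). intros g η.
  revert t'. refine (sig_ind 1 (fun t' => @pair 1 (B ⟶ A) P g η == t') _). intros g' η'.
  refine (sub_path (B := P) (fun g => pi_prop (B := fun x => g @ (f @ x) == x)
    (fun x => set_path_prop hA (g @ (f @ x)) x))
    (fun_ext (B := fun _ => A) (f := g) (g := g') (fn (fun y => _)))).
  refine (cc (y := k @ y) _ _).
  - exact (cc (y := g @ (f @ (k @ y))) (ap1 (app g) (ε @ y)⁻¹) (η @ (k @ y))).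
  - exact (cc (y := g' @ (f @ (k @ y))) (η' @ (k @ y))⁻¹ (ap1 (app g') (ε @ y))).
Defined.
Instance : library := derive linv_prop'.
Definition linv_prop := cite linv_prop'.
Arguments linv_prop {A B} hA f k ε.

Definition IsEquiv' (A B : typ 1) (f : A ⟶ B) : typ 1 := RInv f × LInv f.
Instance : library := define IsEquiv'.
Definition IsEquiv := cite IsEquiv'.
Arguments IsEquiv {A B} f.

Definition is_equiv_prop' (A B : typ 1) (hA : HSet A) (hB : HSet B)
  (f : A ⟶ B) : isProp (IsEquiv f).
Proof.
  refine (cast (is_prop (A := RInv f × LInv f) (fun t t' => _))).
  revert t. refine (sig_ind 1 (fun t => t == t') _). intros q r.
  revert t'. refine (sig_ind 1 (fun t' => @pair 1 (RInv f) (fun _ => LInv f) q r == t') _).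
  intros q' r'.
  pose (k := cast (B := LInv' A B f) r). pose (k' := cast (B := RInv' A B f) q').
  exact (sig_path (B := fun _ => LInv f) (pr (rinv_prop hB f (pr1 k) (pr2 k)) q q')
    (pr (linv_prop hA f (pr1 k') (pr2 k')) _ r')).
Defined.
Instance : library := derive is_equiv_prop'.
Definition is_equiv_prop := cite is_equiv_prop'.
Arguments is_equiv_prop {A B} hA hB f.

Definition Equ' (A B : typ 1) : typ 1 := Sg 1 (A ⟶ B) (fun f => IsEquiv f).
Instance : library := define Equ'.
Definition Equ := cite Equ'.

Definition efun' (A B : typ 1) (e : Equ A B) : A ⟶ B :=
  pr1 (cast (B := Equ' A B) e).
Instance : library := define efun'.
Definition efun := cite efun'.
Arguments efun {A B} e.

Definition equ_path' (A B : typ 1) (hA : HSet A) (hB : HSet B)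
  (e e' : Equ A B) (p : ∏ x : A, efun e @ x == efun e' @ x) : e == e'.
Proof.
  pose (q := fun_ext (B := fun _ => B) p). clearbody q. clear p.
  gen q. refine (cast (sig_ind 1 (fun e : Equ' A B => (efun (cast e) == efun e') ⟶
    (e == cast (B := Equ' A B) e')) _ (cast e))). intros f h.
  refine (cast (sig_ind 1 (fun e' : Equ' A B => (f == efun (cast e')) ⟶
    (@pair 1 (A ⟶ B) (fun f => IsEquiv f) f h == e')) _ (cast e'))). intros f' h'.
  lam q. exact (sub_path (B := fun f => IsEquiv f) (fun f => is_equiv_prop hA hB f) (cast q)).
Defined.
Instance : library := derive equ_path'.
Definition equ_path := cite equ_path'.
Arguments equ_path {A B} hA hB {e e'} p.

Definition equ_set' (A B : typ 1) (hA : HSet A) (hB : HSet B) : HSet (Equ A B) :=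
  cast (sig_set (B := fun f => IsEquiv f) (pi_set (fun _ => hB))
    (fun f => prop_lev (is_equiv_prop hA hB f) one)).
Instance : library := derive equ_set'.
Definition equ_set := cite equ_set'.
Arguments equ_set {A B} hA hB.

Definition hset_prop' (A : typ 1) : isProp (HSet A).
Proof.
  refine (cast (pi_prop (B := fun x => ∏ y : A, ∏ p : x == y, ∏ q : x == y, Contr (p == q))
    (fun x => pi_prop (fun y => pi_prop (fun p => pi_prop (fun q => contr_isProp (p == q))))))).
Defined.
Instance : library := derive hset_prop'.
Definition hset_prop := cite hset_prop'.

Definition to_equ' (A B : U 1) (p : A =={2} B) : Equ (El A) (El B) :=
  mk (idToEquiv 1 A B p).
Instance : library := define to_equ'.
Definition to_equ := cite to_equ'.
Arguments to_equ {A B} p.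

(** Univalence is given by separate left and right inverses of [to_equ]. They agree, so the left one
    satisfies the other law too, which is recorded for underlying functions. *)
Definition UA_pack' (A B : U 1) : Sg 2 (Equ (El A) (El B) ⟶ A =={2} B) (fun u =>
    Sg 2 (∏ p : A =={2} B, u @ to_equ p =={2} p)
      (fun _ => ∏ e : Equ (El A) (El B), efun (to_equ (u @ e)) =={1} efun e)).
Proof.
  pose (E := Equ (El A) (El B)). pose (I := A =={2} B).
  pose (Q := Sg 2 (E ⟶ I) (fun g => ∏ e : E, to_equ (g @ e) =={2} e)).
  pose (R := Sg 2 (E ⟶ I) (fun g => ∏ p : I, g @ to_equ p =={2} p)).
  pose (w := cast (B := Sg 2 Q (fun _ => R)) (@mk (El (U 1)) (C (cUA 1) $ A $ B))).
  pose (q := pr1 w). pose (r := pr2 w).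
  refine (@pair 2 (E ⟶ I) (fun u => Sg 2 (∏ p : I, u @ to_equ p =={2} p)
      (fun _ => ∏ e : E, efun (to_equ (u @ e)) == efun e)) (pr1 r) (@pair 2 _
        (fun _ => ∏ e : E, efun (to_equ (pr1 r @ e)) == efun e) (pr2 r) (fn (fun e => _)))).
  refine (app_path 2 1 efun _).
  refine (cc (y := to_equ (pr1 q @ e)) _ (pr2 q @ e)).
  refine (app_path 2 2 to_equ _).
  refine (cc (y := pr1 r @ (to_equ (pr1 q @ e))) (app_path 2 2 (app (pr1 r)) (pr2 q @ e))⁻¹ _).
  exact (pr2 r @ (pr1 q @ e)).
Defined.
Instance : library := derive UA_pack'.
Definition UA_pack := cite UA_pack'.

Definition ua' (A B : U 1) (e : Equ (El A) (El B)) : A =={2} B :=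
  pr1 (UA_pack A B) @ e.
Instance : library := define ua'.
Definition ua := cite ua'.
Arguments ua {A B} e.
Definition ua_to_equ' (A B : U 1) (p : A =={2} B) :
  ua (to_equ p) =={2} p := cast (pr1 (pr2 (UA_pack A B)) @ p).
Instance : library := derive ua_to_equ'.
Definition ua_to_equ := cite ua_to_equ'.
Arguments ua_to_equ {A B} p.
Definition to_equ_ua' (A B : U 1) (e : Equ (El A) (El B)) :
  efun (to_equ (ua e)) == efun e := cast (pr2 (pr2 (UA_pack A B)) @ e).
Instance : library := derive to_equ_ua'.
Definition to_equ_ua := cite to_equ_ua'.
Arguments to_equ_ua {A B} e.

(** The universal cover must extend over a 1-truncation, so its classifying map needs a 1-type as
    target; the whole universe would not do. *)
Definition Sets' : typ 2 := Sg 2 (U 1) (fun A => HSet (El A)).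
Instance : library := define Sets'.
Definition Sets := cite Sets'.
Definition mkset' (A : U 1) (h : HSet (El A)) : Sets :=
  cast (@pair 2 (U 1) (fun A => HSet (El A)) A h).
Instance : library := define mkset'.
Definition mkset := cite mkset'.
Definition car' (s : Sets) : U 1 := pr1 (cast (B := Sets') s).
Instance : library := define car'.
Definition car := cite car'.
Definition car_set' (s : Sets) : HSet (El (car s)) :=
  cast (pr2 (cast (B := Sets') s)).
Instance : library := derive car_set'.
Definition car_set := cite car_set'.
Definition sets_ind {j} (P : Sets -> ty) (h : forall A k, P (mkset A k))
  (s : Sets) : P s :=
  cast (sig_ind j (fun t => P (cast t)) (fun A k => cast (h A k)) (cast (B := Sets') s)).

Definition set_eq' (A B : U 1) (hA : HSet (El A)) (hB : HSet (El B))
  (p : A =={2} B) : mkset A hA =={2} mkset B hB.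
Proof.
  gen hB. pind 2 p. lam hB.
  exact (app_path 1 2 (fun h => mkset A h) (pr (hset_prop (El A)) hA hB)).
Defined.
Instance : library := define set_eq'.
Definition set_eq := cite set_eq'.
Arguments set_eq {A B} hA hB p.

(** [set_eq] inserts the path between proofs of sethood that comes from their being a proposition;
    for equal proofs it is equal to [rfl], but not judgmentally. *)
Definition set_eq_rfl' (A : U 1) (hA : HSet (El A)) :
  set_eq hA hA (rfl_at 2 A) =={2} rfl_at 2 (mkset A hA).
Proof.
  exact (cast (app_path 1 2 (fun q : hA == hA => app_path 1 2 (fun h => mkset A h) q)
    (set_paths (prop_lev (hset_prop (El A)) one) (pr (hset_prop (El A)) hA hA) (rfl hA)))).
Defined.
Instance : library := derive set_eq_rfl'.
Definition set_eq_rfl := cite set_eq_rfl'.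
Arguments set_eq_rfl {A} hA.

Definition car_set_eq' (A B : U 1) (hA : HSet (El A)) (hB : HSet (El B)) (p : A =={2} B) :
  cast (app_path 2 2 car (set_eq hA hB p)) =={2} p.
Proof.
  gen hB. pind 2 p. lam hB.
  refine (cast (path_ind 2 (a := hA) (fun h q =>
    (app_path 2 2 car (app_path 1 2 (fun h => mkset A h) q))
    =={2} cast (rfl_at 2 A)) _ hB (pr (hset_prop (El A)) hA hB))).
  exact (cast (rfl_at 2 (rfl_at 2 A))).
Defined.
Instance : library := derive car_set_eq'.
Definition car_set_eq := cite car_set_eq'.
Arguments car_set_eq {A B} hA hB p.

Definition to_map' (x y : Sets) (p : x =={2} y) :
  Equ (El (car x)) (El (car y)) := to_equ (app_path 2 2 car p).
Instance : library := define to_map'.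
Definition to_map := cite to_map'.
Arguments to_map {x y} p.

Definition of_map' (x y : Sets) (e : Equ (El (car x)) (El (car y))) : x =={2} y.
Proof.
  gen e. refine (sets_ind (j := 2) (fun x => Equ (El (car x)) (El (car y)) ⟶ x =={2} y) _ x).
  intros A hA.
  refine (sets_ind (j := 2) (fun y => Equ (El (car (mkset A hA)))
    (El (car y)) ⟶ mkset A hA =={2} y) _ y).
  intros B hB. lam e. exact (set_eq hA hB (ua (cast e))).
Defined.
Instance : library := define of_map'.
Definition of_map := cite of_map'.
Arguments of_map {x y} e.

Definition of_to_map' (x y : Sets) (p : x =={2} y) : of_map (to_map p) =={2} p.
Proof.
  pind 2 p.
  refine (sets_ind (j := 2) (fun x => of_map (to_map (rfl_at 2 x)) =={2} rfl_at 2 x) _ x).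
  intros A hA.
  refine (cast (cc (y := set_eq hA hA (rfl_at 2 A))
    (app_path 2 2 (fun p => set_eq hA hA p) (ua_to_equ (rfl_at 2 A)))
    (set_eq_rfl hA))).
Defined.
Instance : library := derive of_to_map'.
Definition of_to_map := cite of_to_map'.
Arguments of_to_map {x y} p.

Definition to_of_map' (x y : Sets) (e : Equ (El (car x)) (El (car y))) :
  efun (to_map (of_map e)) == efun e.
Proof.
  gen e. refine (sets_ind (j := 2) (fun x => ∏ e : Equ (El (car x)) (El (car y)),
    efun (to_map (of_map e)) == efun e) _ x).
  intros A hA.
  refine (sets_ind (j := 2) (fun y => ∏ e : Equ (El (car (mkset A hA))) (El (car y)),
    efun (to_map (of_map e)) == efun e) _ y).
  intros B hB. lam e. pose (e' := cast (B := Equ (El A) (El B)) e).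
  refine (cast (cc (y := efun (to_equ (ua e'))) _ (to_equ_ua e'))).
  exact (app_path 2 1 (fun p => efun (to_equ p)) (car_set_eq hA hB (ua e'))).
Defined.
Instance : library := derive to_of_map'.
Definition to_of_map := cite to_of_map'.
Arguments to_of_map {x y} e.

Definition sets_level' : ofLevel 2 three Sets.
Proof.
  refine (cast (fn (fun x : Sets => fn (fun y : Sets => (_ : ofLevel 2 two (x =={2} y)))))).
  exact (retract 1 two (X := x =={2} y) of_map to_map (fun p => of_to_map p)
    (equ_set (car_set x) (car_set y))).
Defined.
Instance : library := derive sets_level'.
Definition sets_level := cite sets_level'.

Definition to_map_cc' (x y z : Sets) (p : x =={2} y) (q : y =={2} z) (a : El (car x)) :
  efun (to_map (p • q)) @ a == efun (to_map q) @ (efun (to_map p) @ a).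
Proof.
  pind 2 q. exact (cast (rfl (efun (to_map p) @ a))).
Defined.
Instance : library := derive to_map_cc'.
Definition to_map_cc := cite to_map_cc'.
Arguments to_map_cc {x y z} p q a.

(** Paths of sets are recovered from their equivalences, and these from their functions, so the
    equation may be tested on elements. *)
Definition of_map_cc' (x y z : Sets) (e : Equ (El (car x)) (El (car y)))
  (e' : Equ (El (car y)) (El (car z))) (k : Equ (El (car x)) (El (car z)))
  (h : ∏ a : El (car x), efun e' @ (efun e @ a) == efun k @ a) :
  of_map e • of_map e' =={2} of_map k.
Proof.
  pose (p := of_map e). pose (p' := of_map e'). pose (q := of_map k).
  refine (cc (y := of_map (to_map (p • p'))) (of_to_map _)⁻¹
    (cc (y := of_map (to_map q)) _ (of_to_map q))).
  refine (app_path 1 2 of_map (equ_path (car_set x) (car_set z) (fn (fun a => _)))).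
  refine (cc (y := efun (to_map p') @ (efun (to_map p) @ a)) (to_map_cc p p' a) _).
  refine (cc (y := efun e' @ (efun (to_map p) @ a))
    (ap1 (fun f => f @ (efun (to_map p) @ a)) (to_of_map e')) _).
  refine (cc (y := efun e' @ (efun e @ a))
    (ap1 (fun f : El (car x) ⟶ El (car y) => efun e' @ (f @ a)) (to_of_map e)) _).
  exact (h @ a • (ap1 (fun f : El (car x) ⟶ El (car z) => f @ a) (to_of_map k))⁻¹).
Defined.
Instance : library := derive of_map_cc'.
Definition of_map_cc := cite of_map_cc'.
Arguments of_map_cc {x y z e e' k} h.

(** * The universal cover of $K(G,1)$ *)

Definition AbGroup (G : typ 1) (o : G) (add : G ⟶ G ⟶ G) (opp : G ⟶ G) : typ 1 :=
  isAbGroup 1 G o add opp.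

Definition grp' (G : typ 1) (o : G) (add : G ⟶ G ⟶ G) (opp : G ⟶ G)
  (h : AbGroup G o add opp) : HSet G ×
    (∏ x : G, ∏ y : G, ∏ z : G, add @ (add @ x @ y) @ z == add @ x @ (add @ y @ z)) ×
    (∏ x : G, add @ o @ x == x) × (∏ x : G, add @ (opp @ x) @ x == o) ×
    (∏ x : G, ∏ y : G, add @ x @ y == add @ y @ x) := cast h.
Instance : library := derive grp'.
Definition grp := cite grp'.
Arguments grp {G o add opp} h.

Definition grp_assoc' (G : typ 1) (o : G) (add : G ⟶ G ⟶ G)
  (opp : G ⟶ G) (h : AbGroup G o add opp) (x y z : G) :
  add @ (add @ x @ y) @ z == add @ x @ (add @ y @ z) := pr1 (pr2 (grp h)) @ x @ y @ z.
Instance : library := derive grp_assoc'.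
Definition grp_assoc := cite grp_assoc'.
Arguments grp_assoc {G o add opp} h x y z.

Definition grp_0l' (G : typ 1) (o : G) (add : G ⟶ G ⟶ G)
  (opp : G ⟶ G) (h : AbGroup G o add opp) (x : G) :
  add @ o @ x == x := pr1 (pr2 (pr2 (grp h))) @ x.
Instance : library := derive grp_0l'.
Definition grp_0l := cite grp_0l'.
Arguments grp_0l {G o add opp} h x.

Definition grp_comm' (G : typ 1) (o : G) (add : G ⟶ G ⟶ G)
  (opp : G ⟶ G) (h : AbGroup G o add opp) (x y : G) :
  add @ x @ y == add @ y @ x := cast (pr2 (pr2 (pr2 (pr2 (grp h)))) @ x @ y).
Instance : library := derive grp_comm'.
Definition grp_comm := cite grp_comm'.
Arguments grp_comm {G o add opp} h x y.

Definition grp_cancel' (G : typ 1) (o : G) (add : G ⟶ G ⟶ G)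
  (opp : G ⟶ G) (h : AbGroup G o add opp) (x y : G)
  (y' : G) (e : add @ y @ y' == o) : add @ (add @ x @ y) @ y' == x.
Proof.
  refine (cc (y := add @ x @ (add @ y @ y')) (grp_assoc h x y y') _).
  refine (cc (y := add @ x @ o) (ap1 (app (add @ x)) e) _).
  exact (cc (y := add @ o @ x) (grp_comm h x o) (grp_0l h x)).
Defined.
Instance : library := derive grp_cancel'.
Definition grp_cancel := cite grp_cancel'.
Arguments grp_cancel {G o add opp} h x y {y'} e.

Definition shift' (G : typ 1) (o : G) (add : G ⟶ G ⟶ G)
  (opp : G ⟶ G) (h : AbGroup G o add opp) (g : G) : Equ G G.
Proof.
  pose (f := fn (fun x : G => add @ x @ g)).
  pose (k := fn (fun x : G => add @ x @ (opp @ g))).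
  pose (li := pr1 (pr2 (pr2 (pr2 (grp h)))) @ g : add @ (opp @ g) @ g == o).
  exact (cast (@pair 1 (G ⟶ G) (fun f => IsEquiv f) f
    (cast (@pair 1 (RInv f) (fun _ => LInv f)
      (cast (@pair 1 (G ⟶ G) (fun k => ∏ x : G, f @ (k @ x) == x) k
        (cast (fn (fun x => grp_cancel h x (opp @ g) li)))))
      (cast (@pair 1 (G ⟶ G) (fun k => ∏ x : G, k @ (f @ x) == x) k
        (cast (fn (fun x => grp_cancel h x g
          (cc (y := add @ (opp @ g) @ g) (grp_comm h g (opp @ g)) li)))))))))).
Defined.
Instance : library := define shift'.
Definition shift := cite shift'.
Arguments shift {G o add opp} h g.

Definition Over2' (A : typ 1) (X : typ 2) (x y : A) (p : x == y)
  (b c : X) : typ 2 := over 1 2 A (fun _ => code X) x y p b c.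
Instance : library := define Over2'.
Definition Over2 := cite Over2'.
Arguments Over2 {A X x y} p b c.

Definition to_over2' (A : typ 1) (X : typ 2) (x y : A) (p : x == y)
  (b c : X) (u : b =={2} c) : Over2 p b c.
Proof. pind 2 p. exact (cast u). Defined.
Instance : library := define to_over2'.
Definition to_over2 := cite to_over2'.
Arguments to_over2 {A X x y} p {b c} u.

Definition from_over2' (A : typ 1) (X : typ 2) (x y : A) (p : x == y)
  (b c : X) (u : Over2 p b c) : b =={2} c.
Proof. gen u. pind 2 p. lam u. exact (cast u). Defined.
Instance : library := define from_over2'.
Definition from_over2 := cite from_over2'.
Arguments from_over2 {A X x y} p {b c} u.

Definition from_to_over2' (A : typ 1) (X : typ 2) (x y : A) (p : x == y)
  (b c : X) (u : b =={2} c) : from_over2 p (to_over2 p u) =={2} u.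
Proof. pind 2 p. exact (cast (rfl_at 2 u)). Defined.
Instance : library := derive from_to_over2'.
Definition from_to_over2 := cite from_to_over2'.
Arguments from_to_over2 {A X x y} p {b c} u.

Definition from_apd2' (A : typ 1) (X : typ 2) (f : forall x : A, X)
  (x y : A) (p : x == y) :
  from_over2 p (mk (apd 1 2 A (fun _ => code X) (fun x => val (f (mk x))) x y p)
      : Over2 p (f x) (f y)) =={2} app_path 1 2 f p.
Proof. pind 2 p. exact (cast (rfl_at 2 (rfl_at 2 (f x)))). Defined.
Instance : library := derive from_apd2'.
Definition from_apd2 := cite from_apd2'.
Arguments from_apd2 {A X} f {x y} p.

Definition to_over2_cc' (A : typ 1) (X : typ 2) (x y z : A) (p : x == y)
  (q : y == z) (r : x == z) (h : p • q == r) (b c d : X)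
  (u : b =={2} c) (v : c =={2} d) (w : b =={2} d) (κ : u • v =={2} w) :
  over2 1 2 A (fun _ => code X) x z (p • q) r h b d
    (oconcat 1 2 A (fun _ => code X) x y z p q b c d (to_over2 p u) (to_over2 q v))
    (to_over2 r w).
Proof. pind 2 h. pind 2 q. pind 2 p. exact (cast κ). Defined.
Instance : library := derive to_over2_cc'.
Definition to_over2_cc := cite to_over2_cc'.
Arguments to_over2_cc {A X x y z p q r} h {b c d u v w} κ.

Definition gset' (G : typ 1) (o : G) (add : G ⟶ G ⟶ G)
  (opp : G ⟶ G) (h : AbGroup G o add opp) : Sets :=
  mkset (mk (code G)) (pr1 (grp h)).
Instance : library := define gset'.
Definition gset := cite gset'.
Arguments gset {G o add opp} h.

Definition slide' (G : typ 1) (o : G) (add : G ⟶ G ⟶ G)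
  (opp : G ⟶ G) (h : AbGroup G o add opp) (g : G) :
  gset h =={2} gset h := of_map (cast (shift h g)).
Instance : library := define slide'.
Definition slide := cite slide'.
Arguments slide {G o add opp} h g.

Definition slide_cc' (G : typ 1) (o : G) (add : G ⟶ G ⟶ G)
  (opp : G ⟶ G) (h : AbGroup G o add opp) (g k : G) :
  slide h g • slide h k =={2} slide h (add @ g @ k) :=
  cast (of_map_cc (x := gset h) (y := gset h) (z := gset h)
    (e := cast (shift h g)) (e' := cast (shift h k)) (k := cast (shift h (add @ g @ k)))
    (cast (fn (fun a : G => grp_assoc h a g k)))).
Instance : library := derive slide_cc'.
Definition slide_cc := cite slide_cc'.
Arguments slide_cc {G o add opp} h g k.

(* The universal cover of [BG]: the loop [g] acts by translation on the fibre [G]. *)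
Definition Code' (G : typ 1) (o : G) (add : G ⟶ G ⟶ G)
  (opp : G ⟶ G) (h : AbGroup G o add opp) (x : BG add) : Sets :=
  mk (C (cEMInd 1 2) $ G $ add $ (λ _, Sets) $ gset h $
    (λ g, to_over2 (bloop add (mk g)) (slide h (mk g))) $
    (λ g k, to_over2_cc (p := bloop add (mk g)) (q := bloop add (mk k))
      (r := bloop add (mk (add $ g $ k))) (mk (EMsq 1 G add g k))
        (slide_cc h (mk g) (mk k))) $ x).
Instance : library := define Code'.
Definition Code := cite Code'.
Arguments Code {G o add opp} h x.

(** The computation rule identifies tuples; the wanted path is its first component, evaluated at [g]
    and translated from paths over to paths. *)
Definition code_loop' (G : typ 1) (o : G) (add : G ⟶ G ⟶ G)
  (opp : G ⟶ G) (h : AbGroup G o add opp) (g : G) :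
  cast (app_path 1 2 (Code h) (bloop add g)) =={2} slide h g.
Proof.
  pose (c := gset h).
  pose (O := ∏ g : G, Over2 (bloop add g) c c).
  pose (D := fun u : O => Π g : G, Π k : G,
    EMover2 1 2 G add (fun _ => code Sets) c u g k).
  pose (f := fun x : exp => val (Code h (mk x))).
  pose (u := fn (fun g => to_over2 (bloop add g) (slide h g)) : O).
  pose (a := mk (λ g, EMapd 1 2 G add (fun _ => code Sets) f g) : O).
  pose (t := @pair 2 O D a (mk (λ g k, EMapd2 1 2 G add (fun _ => code Sets) f g k))).
  pose (s := λ g k, to_over2_cc (p := bloop add (mk g)) (q := bloop add (mk k))
      (r := bloop add (mk (add $ g $ k))) (mk (EMsq 1 G add g k)) (slide_cc h (mk g) (mk k))).
  pose (t' := @pair 2 O D u (mk s)).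
  pose (E := mk (C (cEMbeta 1 2) $ G $ add $ (λ _, Sets) $ c $ u $ s) : t =={2} t').
  refine (cc (y := from_over2 (bloop add g) (a @ g))
    (iv (cast (from_apd2 (Code h) (bloop add g)))) _).
  refine (cc (y := from_over2 (bloop add g) (u @ g)) _
    (cast (from_to_over2 (bloop add g) (slide h g)))).
  exact (cast (app_path 2 2 (fun t : Sg 2 O D => from_over2 (bloop add g) (pr1 t @ g)) E)).
Defined.
Instance : library := derive code_loop'.
Definition code_loop := cite code_loop'.
Arguments code_loop {G o add opp} h g.

(** * Encoding and decoding loops of $K(G,1)$ *)

Definition KG {G : typ 1} (add : G ⟶ G ⟶ G) : typ 1 := Trunc 1 one (BG add).
Definition kpt1 {G : typ 1} (add : G ⟶ G ⟶ G) : KG add :=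
  trunc one (bpt add).

Definition Fam' (G : typ 1) (o : G) (add : G ⟶ G ⟶ G)
  (opp : G ⟶ G) (h : AbGroup G o add opp) (y : KG add) : typ 1 :=
  El (car (mk (C (cTrInd 1 2) $ one $ BG add $ (λ _, Sets) $ (λ _, sets_level) $
    (λ x, Code h (mk x)) $ y))).
Instance : library := define Fam'.
Definition Fam := cite Fam'.
Arguments Fam {G o add opp} h y.

Definition kloop' (G : typ 1) (add : G ⟶ G ⟶ G) (g : G) :
  kpt1 add == kpt1 add := ap1 (trunc one) (bloop add g).
Instance : library := define kloop'.
Definition kloop := cite kloop'.
Arguments kloop {G} add g.

Definition kloop_cc' (G : typ 1) (add : G ⟶ G ⟶ G) (g k : G) :
  kloop add g • kloop add k == kloop add (add @ g @ k).
Proof.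
  pose (f := fun x : BG add => trunc one x).
  assert (q : forall (y z : BG add) (p : bpt add == y) (q : y == z),
    ap1 f p • ap1 f q == ap1 f (p • q)).
  { intros y z p q. pind 1 q. exact (cast (rfl (ap1 f p))). }
  refine (cast (cc (y := ap1 f (bloop add g • bloop add k))
    (q _ _ (bloop add g) (bloop add k)) _)).
  exact (ap1 (app_path 1 1 f) (mk (EMsq 1 G add g k) :
    bloop add g • bloop add k == bloop add (add @ g @ k))).
Defined.
Instance : library := derive kloop_cc'.
Definition kloop_cc := cite kloop_cc'.
Arguments kloop_cc {G add} g k.

Definition fam_path' (G : typ 1) (o : G) (add : G ⟶ G ⟶ G)
  (opp : G ⟶ G) (h : AbGroup G o add opp) (x y : BG add)
  (p : x == y) (a : Fam h (trunc one x)) : tr1 (fun y => Fam h y) (ap1 (trunc one) p) a ==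
    cast (efun (to_map (app_path 1 2 (Code h) p)) @ cast a).
Proof. gen a. pind 1 p. lam a. exact (cast (rfl a)). Defined.
Instance : library := derive fam_path'.
Definition fam_path := cite fam_path'.
Arguments fam_path {G o add opp} h {x y} p a.

Definition fam_loop' (G : typ 1) (o : G) (add : G ⟶ G ⟶ G)
  (opp : G ⟶ G) (h : AbGroup G o add opp) (g a : G) :
  cast (tr1 (fun y => Fam h y) (kloop add g) (cast a)) == add @ a @ g.
Proof.
  pose (c := gset h). pose (p := cast (app_path 1 2 (Code h) (bloop add g)) : c =={2} c).
  refine (cc (y := cast (efun (to_map p) @ cast a))
    (cast (fam_path h (bloop add g) (cast a))) _).
  refine (cc (y := cast (efun (to_map (slide h g)) @ cast a)) _ _).
  - exact (app_path 2 1 (fun q => cast (efun (to_map q) @ cast a)) (code_loop h g)).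
  - exact (cast (ap1 (fun f => f @ cast a) (to_of_map (x := c) (y := c) (cast (shift h g))))).
Defined.
Instance : library := derive fam_loop'.
Definition fam_loop := cite fam_loop'.
Arguments fam_loop {G o add opp} h g a.

Definition enc' (G : typ 1) (o : G) (add : G ⟶ G ⟶ G)
  (opp : G ⟶ G) (h : AbGroup G o add opp) (y : KG add) (u : kpt1 add == y) : Fam h y :=
  tr1 (fun y => Fam h y) u (cast o).
Instance : library := define enc'.
Definition enc := cite enc'.
Arguments enc {G o add opp} h {y} u.

Definition enc_kloop' (G : typ 1) (o : G) (add : G ⟶ G ⟶ G)
  (opp : G ⟶ G) (h : AbGroup G o add opp) (g : G) :
  cast (enc h (kloop add g)) == g := cast (fam_loop h g o) • grp_0l h g.
Instance : library := derive enc_kloop'.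
Definition enc_kloop := cite enc_kloop'.
Arguments enc_kloop {G o add opp} h g.

Definition tr_arrow' (A X : typ 1) (i : forall x : A, X)
  (F : X -> typ 1) (e : X) (x y : A) (p : x == y)
  (f : F (i x) ⟶ e == i x) (f' : F (i y) ⟶ e == i y)
  (h : ∏ a : F (i x), f @ a • ap1 i p == f' @ (tr1 F (ap1 i p) a)) :
  tr1 (fun x => F (i x) ⟶ e == i x) p f == f'.
Proof.
  gen h. gen f'. pind 1 p. lam f'. lam h. exact (cast (fun_ext (f := f) (g := f') (cast h))).
Defined.
Instance : library := derive tr_arrow'.
Definition tr_arrow := cite tr_arrow'.
Arguments tr_arrow {A X} i F e {x y p f f'} h.

(** At the base point this is [kloop]. Since the loop of [g] acts on the fibre by adding [g],
    compatibility with that loop says that [kloop] takes sums to composites. *)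
Definition dec' (G : typ 1) (o : G) (add : G ⟶ G ⟶ G)
  (opp : G ⟶ G) (h : AbGroup G o add opp) (y : KG add) : Fam h y ⟶ kpt1 add == y.
Proof.
  pose (d := one).
  pose (P := fun y => Fam h y ⟶ kpt1 add == y).
  assert (L : forall y, HSet (P y)).
  { intros z. exact (pi_set (fun _ => lev_paths (trunc_level d (BG add)) (kpt1 add) z)). }
  refine (trunc_ind P (fun y => lev_succ (L y)) (fun x => _) y).
  refine (em_ind (fun x => P (trunc d x)) (fun x => L (trunc d x))
    (cast (fn (fun g : G => kloop add g))) (fn (fun g => _)) x).
  refine (tr_arrow (trunc d) (Fam h) (kpt1 add) (x := bpt add) (y := bpt add)
    (p := bloop add g) (fn (fun a => _))).
  refine (cast (cc (y := kloop add (add @ cast a @ g)) (kloop_cc (add := add) (cast a) g) _)).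
  exact (ap1 (kloop add) (fam_loop h g (cast a))⁻¹).
Defined.
Instance : library := define dec'.
Definition dec := cite dec'.
Arguments dec {G o add opp} h y.

(** An idempotent loop is trivial. *)
Definition kloop_zero' (G : typ 1) (o : G) (add : G ⟶ G ⟶ G)
  (opp : G ⟶ G) (h : AbGroup G o add opp) : kloop add o == rfl (kpt1 add).
Proof.
  pose (p := kloop add o).
  exact (to (cancel (kloop_cc (add := add) o o • ap1 (kloop add) (grp_0l h o))) (rfl p)).
Defined.
Instance : library := derive kloop_zero'.
Definition kloop_zero := cite kloop_zero'.
Arguments kloop_zero {G o add opp} h.

Definition dec_enc' (G : typ 1) (o : G) (add : G ⟶ G ⟶ G)
  (opp : G ⟶ G) (h : AbGroup G o add opp) (y : KG add)
  (u : kpt1 add == y) : dec h y @ enc h u == u.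
Proof. pind 1 u. exact (cast (kloop_zero h)). Defined.
Instance : library := derive dec_enc'.
Definition dec_enc := cite dec_enc'.
Arguments dec_enc {G o add opp} h {y} u.

Definition kloop_enc' (G : typ 1) (o : G) (add : G ⟶ G ⟶ G)
  (opp : G ⟶ G) (h : AbGroup G o add opp) (u : kpt1 add == kpt1 add) :
  kloop add (cast (enc h u)) == u := cast (dec_enc h u).
Instance : library := derive kloop_enc'.
Definition kloop_enc := cite kloop_enc'.
Arguments kloop_enc {G o add opp} h u.

(** * Degree 1 *)

Definition cc_assoc' (A : typ 1) (x y z w : A) (p : x == y)
  (q : y == z) (r : z == w) : (p • q) • r == p • (q • r).
Proof. pind 1 r. exact (cast (rfl (p • q))). Defined.
Instance : library := derive cc_assoc'.
Definition cc_assoc := cite cc_assoc'.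
Arguments cc_assoc {A x y z w} p q r.

Definition tr_loop' (X : typ 1) (x y : X) (r : x == y) (u : x == x)
  (v : y == y) (σ : u • r == r • v) : tr1 (fun x => x == x) r u == v.
Proof. gen σ. gen v. pind 1 r. lam v. lam σ. exact
  (cast (A := u == v) (cc (x := u) (y := rfl x • v) (cast σ) (cc_rfl_l v))). Defined.
Instance : library := derive tr_loop'.
Definition tr_loop := cite tr_loop'.
Arguments tr_loop {X x y r u v} σ.

Definition tr_loop_inj' (X : typ 1) (x y : X) (r : x == y) (u v : x == x)
  (h : tr1 (fun x => x == x) r u == tr1 (fun x => x == x) r v) : u == v.
Proof. gen h. pind 1 r. lam h. exact (cast h). Defined.
Instance : library := derive tr_loop_inj'.
Definition tr_loop_inj := cite tr_loop_inj'.
Arguments tr_loop_inj {X x y} r {u v} h.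

Definition ap_natural' (X : typ 1) (f : forall x : X, X)
  (h : ∏ x : X, f x == x) (x y : X) (p : x == y) : ap1 f p • h @ y == h @ x • p.
Proof. pind 1 p. exact (cast (cc_rfl_l (h @ x))). Defined.
Instance : library := derive ap_natural'.
Definition ap_natural := cite ap_natural'.
Arguments ap_natural {X} f h {x y} p.

Definition translate_tr' (X : typ 1) (e : X) (a : X ⟶ X ⟶ X)
  (ru : ∏ x : X, a @ x @ e == x) (v : e == e) (b c : X) (r : b == c) :
  tr1 (fun x => x == x) r (translate a ru b v) == translate a ru c v.
Proof. pind 1 r. exact (cast (rfl (translate a ru b v))). Defined.
Instance : library := derive translate_tr'.
Definition translate_tr := cite translate_tr'.
Arguments translate_tr {X e a} ru v {b c} r.

(** Naturality of the left unit law, transferred to the right one by their agreement [ρ] at [e]. *)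
Definition square_e' (X : typ 1) (e : X) (a : X ⟶ X ⟶ X)
  (lu : ∏ x : X, a @ e @ x == x) (ru : ∏ x : X, a @ x @ e == x)
  (ρ : ru @ e == lu @ e) (v : e == e) : ap1 (app (a @ e)) v • ru @ e == ru @ e • v.
Proof.
  refine (cc (y := ap1 (app (a @ e)) v • lu @ e) (ap1 (fun r => ap1 (app (a @ e)) v • r) ρ) _).
  refine (cc (y := lu @ e • v) (ap_natural (app (a @ e)) lu v) _).
  exact (ap1 (fun r : a @ e @ e == e => r • v) ρ⁻¹).
Defined.
Instance : library := derive square_e'.
Definition square_e := cite square_e'.
Arguments square_e {X e a lu ru} ρ v.

Definition translate_e' (X : typ 1) (e : X) (a : X ⟶ X ⟶ X)
  (lu : ∏ x : X, a @ e @ x == x) (ru : ∏ x : X, a @ x @ e == x)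
  (ρ : ru @ e == lu @ e) (v : e == e) :
  translate a ru e v == v := cast (tr_loop (square_e ρ v)).
Instance : library := derive translate_e'.
Definition translate_e := cite translate_e'.
Arguments translate_e {X e a lu ru} ρ v.

Definition both' (X : typ 1) (a : X ⟶ X ⟶ X) (x x' y y' : X)
  (u : x == x') (v : y == y') : a @ x @ y == a @ x' @ y' :=
  cc (y := a @ x' @ y) (ap1 (fun x => a @ x @ y) u) (ap1 (app (a @ x')) v).
Instance : library := define both'.
Definition both := cite both'.
Arguments both {X} a {x x' y y'} u v.

(** As in the Eckmann-Hilton argument: up to the unit laws, the sum of two loops at [e] is their
    composite. *)
Definition both_e' (X : typ 1) (e : X) (a : X ⟶ X ⟶ X)
  (lu : ∏ x : X, a @ e @ x == x) (ru : ∏ x : X, a @ x @ e == x)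
  (ρ : ru @ e == lu @ e) (v v' : e == e) :
  tr1 (fun x => x == x) (ru @ e) (both a v v') == v • v'.
Proof.
  refine (tr_loop _). pose (r := ru @ e).
  pose (p := ap1 (fun x => a @ x @ e) v). pose (q := ap1 (app (a @ e)) v').
  refine (cc (y := (p • q) • r) (cast (rfl ((p • q) • r))) _).
  refine (cc (y := p • (q • r)) (cc_assoc p q r) _).
  refine (cc (y := p • (r • v')) (ap1 (fun s => p • s) (square_e ρ v')) _).
  refine (cc (y := (p • r) • v') (cc_assoc p r v')⁻¹ _).
  refine (cc (y := (r • v) • v') _ (cc_assoc r v v')).
  exact (ap1 (fun s => s • v') (ap_natural (fun x => a @ x @ e) ru v)).
Defined.
Instance : library := derive both_e'.
Definition both_e := cite both_e'.
Arguments both_e {X e a lu ru} ρ v v'.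

Definition both_translate' (X : typ 1) (hX : Lev three X)
  (e : X) (c : Conn e) (a : X ⟶ X ⟶ X)
  (lu : ∏ x : X, a @ e @ x == x) (ru : ∏ x : X, a @ x @ e == x)
  (ρ : ru @ e == lu @ e) (v v' : e == e) (b b' : X) :
  both a (translate a ru b v) (translate a ru b' v') ==
    translate a ru (a @ b @ b') (v • v').
Proof.
  pose (Q := fun b b' => both a (translate a ru b v) (translate a ru b' v') ==
    translate a ru (a @ b @ b') (v • v')).
  assert (h : forall b b', isProp (Q b b')).
  { intros x y. exact (set_path_prop (lev_paths hX (a @ x @ y) (a @ x @ y)) _ _). }
  refine (app (A := X) (B := Q b) (conn_ind c (fun b => ∏ b' : X, Q b b')
    (fun b => pi_prop (h b))
    (fn (fun b' => conn_ind c (Q e) (h e) _ b')) b) b').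
  (* The loops compared are based at [a @ e @ e]; transport along [ru @ e] moves them to [e], where
     [both_e] and [translate_e] apply. *)
  refine (tr_loop_inj (ru @ e) _).
  refine (cc (y := tr1 (fun x => x == x) (ru @ e) (both a v v')) _ _).
  - refine (app_path 1 1 (tr1 (fun x => x == x) (ru @ e)) _).
    refine (cc (y := both a v (translate a ru e v'))
      (ap1 (fun u => both a u (translate a ru e v')) (translate_e ρ v)) _).
    exact (ap1 (fun u => both a v u) (translate_e ρ v')).
  - refine (cc (y := v • v') (both_e ρ v v') _).
    refine (cc (y := translate a ru e (v • v')) (translate_e ρ (v • v'))⁻¹ _).
    exact (translate_tr ru (v • v') (ru @ e))⁻¹.
Defined.
Instance : library := derive both_translate'.
Definition both_translate := cite both_translate'.
Arguments both_translate {X} hX {e} c {a lu ru} ρ v v' b b'.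

Definition ap_both' (S : typ 0) (X : typ 1) (a : X ⟶ X ⟶ X)
  (f g : forall x : S, X) (x y : S) (p : x =={0} y) :
  ap0 1 (fun x => a @ f x @ g x) p == both a (ap0 1 f p) (ap0 1 g p).
Proof. pind 1 p. exact (cast (rfl (rfl (a @ f x @ g x)))). Defined.
Instance : library := derive ap_both'.
Definition ap_both := cite ap_both'.
Arguments ap_both {S X} a f g {x y} p.

(** * Splitting off the second loop *)

Definition ev_extract' (X : typ 1) (H : Homogeneous X) (f : K2 ⟶ X) :
  cast (evR 1 (app (extract H f))) == restrict H (evK 1 (app f)).
Proof.
  pose (u := ap0 1 (app f) kloop1 : f @ kpt == f @ kpt).
  pose (v := ap0 1 (app f) kloop2 : f @ kpt == f @ kpt).
  exact (cast (betaR 1 (f @ kpt) u (to (theta H u v) (ap_cc 1 (app f) ksq)))).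
Defined.
Instance : library := derive ev_extract'.
Definition ev_extract := cite ev_extract'.
Arguments ev_extract {X} H f.

Definition build' (X : typ 1) (H : Homogeneous X) (f : RP2 ⟶ X)
  (v : f @ rpt == f @ rpt) : K2 ⟶ X :=
  recDK (f @ rpt) (combine H v (evR 1 (app f))).
Instance : library := define build'.
Definition build := cite build'.
Arguments build {X} H f v.

Definition ev_build' (X : typ 1) (H : Homogeneous X) (f : RP2 ⟶ X)
  (v : f @ rpt == f @ rpt) :
  cast (evK 1 (app (build H f v))) == combine H v (evR 1 (app f)).
Proof.
  pose (u := ap0 1 (app f) rloop : f @ rpt == f @ rpt).
  exact (cast (betaK 1 (f @ rpt) u v (of (theta H u v) (ap_iv 1 (app f) rsq)))).
Defined.
Instance : library := derive ev_build'.
Definition ev_build := cite ev_build'.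
Arguments ev_build {X} H f v.

Definition first' (X : typ 1) (b : X) (d : DR 1 b) : b == b :=
  dr_ind 1 (fun _ => b == b) (fun u _ => u) d.
Instance : library := define first'.
Definition first := cite first'.
Arguments first {X b} d.

(** In a 1-type the loops at [b] form a set, so equality of the 2-paths is automatic. *)
Definition dr_path' (X : typ 1) (hX : Lev three X)
  (b : X) (d d' : DR 1 b) (p : first d == first d') : d == d'.
Proof.
  gen p. drind 1 d. intros u κ. drind 1 d'. intros u' κ'. lam p.
  exact (dr_eq 1 (cast p) (set_paths (lev_paths hX b b) _ κ')).
Defined.
Instance : library := derive dr_path'.
Definition dr_path := cite dr_path'.
Arguments dr_path {X} hX {b d d'} p.

Definition second_combine' (X : typ 1) (H : Homogeneous X) (b : X)
  (v : b == b) (d : DR 1 b) : second (combine H v d) == v.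
Proof. drind 1 d. intros u κ. exact (cast (rfl v)). Defined.
Instance : library := derive second_combine'.
Definition second_combine := cite second_combine'.
Arguments second_combine {X} H {b} v d.

Definition pair_path' (A B : typ 1) (x x' : A) (y y' : B) (p : x == x') (q : y == y') :
  @Eq 1 (A × B) (pair x y) (pair x' y').
Proof. pind 1 q. pind 1 p. exact (rfl (@pair 1 A (fun _ => B) x y)). Defined.
Instance : library := derive pair_path'.
Definition pair_path := cite pair_path'.
Arguments pair_path {A B x x' y y'} p q.

Definition Units' (X : typ 1) (e : X) (a : X ⟶ X ⟶ X) : typ 1 :=
  Sg 1 (∏ x : X, a @ e @ x == x) (fun lu =>
    Sg 1 (∏ x : X, a @ x @ e == x) (fun ru => ru @ e == lu @ e)).
Instance : library := define Units'.
Definition Units := cite Units'.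
Arguments Units {X} e a.

Definition lunit' (X : typ 1) (e : X) (a : X ⟶ X ⟶ X)
  (s : Units e a) : ∏ x : X, a @ e @ x == x := pr1 (cast (B := Units' X e a) s).
Instance : library := define lunit'.
Definition lunit := cite lunit'.
Arguments lunit {X e a} s.
Definition runit' (X : typ 1) (e : X) (a : X ⟶ X ⟶ X)
  (s : Units e a) : ∏ x : X, a @ x @ e == x :=
  pr1 (pr2 (cast (B := Units' X e a) s)).
Instance : library := define runit'.
Definition runit := cite runit'.
Arguments runit {X e a} s.
Definition units_agree' (X : typ 1) (e : X) (a : X ⟶ X ⟶ X)
  (s : Units e a) : runit s @ e == lunit s @ e :=
  cast (pr2 (pr2 (cast (B := Units' X e a) s))).
Instance : library := derive units_agree'.
Definition units_agree := cite units_agree'.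
Arguments units_agree {X e a} s.

(** The right unit law is built by set-valued induction from the prescribed action on loops. Its
    value at the base point is chosen to be that of the left law, so that the two agree there by
    [rfl]. *)
Definition units' (G : typ 1) (add : G ⟶ G ⟶ G)
  (a : KG add ⟶ KG add ⟶ KG add) (A : El (isAdd1 1 (code G) add a)) : Units (kpt1 add) a.
Proof.
  pose (d := one). pose (X := BG add). pose (T := KG add). pose (e := kpt1 add).
  pose (i := fun x => trunc d x : T).
  pose (A' := cast (B := Sg 1 (∏ x : X, a @ e @ i x == i x) (fun lu =>
    ∏ g : G, ap1 (fun x => a @ i x @ e) (bloop add g) • lu @ (bpt add) ==
      lu @ (bpt add) • ap1 i (bloop add g))) A).
  pose (lu := pr1 A'). pose (σ := pr2 A').
  assert (L : forall x y : T, HSet (x == y)) by exact (lev_paths (trunc_level d X)).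
  pose (LU := fn (fun x => trunc_ind (fun x => a @ e @ x == x) (fun x => trunc_path_level _ _)
    (fun x => lu @ x) x)).
  pose (RU := fn (fun x => trunc_ind (fun x => a @ x @ e == x) (fun x => trunc_path_level _ _)
    (fun x => em_ind (fun x => a @ i x @ e == i x) (fun x => L (a @ i x @ e) (i x))
      (lu @ (bpt add)) (fn (fun g => tr_square (fun x => a @ i x @ e) i (σ @ g))) x) x)).
  exact (cast (@pair 1 (∏ x : T, a @ e @ x == x) (fun lu =>
    Sg 1 (∏ x : T, a @ x @ e == x) (fun ru => ru @ e == lu @ e)) LU
    (@pair 1 (∏ x : T, a @ x @ e == x) (fun ru => ru @ e == LU @ e) RU
      (cast (rfl (lu @ (bpt add))))))).
Defined.
Instance : library := derive units'.
Definition units := cite units'.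
Arguments units {G add} a A.

Definition extract_build' (X : typ 1) (H : Homogeneous X) (f : RP2 ⟶ X)
  (v : f @ rpt == f @ rpt) : extract H (build H f v) == f.
Proof.
  pose (b := f @ rpt). pose (d := cast (evR 1 (app f)) : DR 1 b).
  refine (cc (y := recDR b d) _ (recDR_evR f)).
  refine (cast (ap1 (recDR b) (cc (y := restrict H (combine H v d))
    (ap1 (restrict H) (ev_build H f v)) (restrict_combine H v d)))).
Defined.
Instance : library := derive extract_build'.
Definition extract_build := cite extract_build'.
Arguments extract_build {X} H f v.

Definition build_extract' (X : typ 1) (H : Homogeneous X) (f : K2 ⟶ X) :
  build H (extract H f) (cast (ap0 1 (app f) kloop2)) == f.
Proof.
  pose (b := f @ kpt). pose (v := cast (ap0 1 (app f) kloop2) : b == b).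
  refine (cc (y := recDK b (combine H v (restrict H (evK 1 (app f))))) _ (cast (rebuild H f))).
  exact (cast (ap1 (fun d => recDK b (combine H v d)) (ev_extract H f))).
Defined.
Instance : library := derive build_extract'.
Definition build_extract := cite build_extract'.
Arguments build_extract {X} H f.

Definition second_build' (X : typ 1) (H : Homogeneous X) (f : RP2 ⟶ X)
  (v : f @ rpt == f @ rpt) : cast (ap0 1 (app (build H f v)) kloop2) == v.
Proof.
  refine (cc (y := second (combine H v (evR 1 (app f)))) _
    (second_combine H v (evR 1 (app f)))).
  exact (cast (ap1 second (ev_build H f v))).
Defined.
Instance : library := derive second_build'.
Definition second_build := cite second_build'.
Arguments second_build {X} H f v.

Definition sum' (S : typ 0) (X : typ 1) (a : X ⟶ X ⟶ X) (f g : S ⟶ X) :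
  S ⟶ X := fn (fun x => a @ (f @ x) @ (g @ x)).
Instance : library := define sum'.
Definition sum := cite sum'.
Arguments sum {S X} a f g.

Definition first_extract' (X : typ 1) (H : Homogeneous X) (f : K2 ⟶ X) :
  cast (ap0 1 (app (extract H f)) rloop) == ap0 1 (app f) kloop1 :=
  cast (ap1 first (ev_extract H f)).
Instance : library := derive first_extract'.
Definition first_extract := cite first_extract'.
Arguments first_extract {X} H f.

(** By [dr_path] it is enough to compare first loops. Extraction preserves them, and the loop of a
    pointwise sum is [both] of the loops. *)
Definition extract_sum' (X : typ 1) (hX : Lev three X)
  (H : Homogeneous X) (a : X ⟶ X ⟶ X) (f g : K2 ⟶ X) :
  extract H (sum a f g) == sum a (extract H f) (extract H g).
Proof.
  pose (s := sum a f g). pose (r := sum a (extract H f) (extract H g)).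
  pose (b := s @ kpt).
  refine (cc (y := recDR b (cast (evR 1 (app r)))) _ (cast (recDR_evR r))).
  refine (cast (ap1 (recDR b) (dr_path hX (d := restrict H (evK 1 (app s)))
    (d' := cast (evR 1 (app r))) _))).
  pose (u := cast (ap0 1 (app f) kloop1) : f @ kpt == f @ kpt).
  pose (v := cast (ap0 1 (app g) kloop1) : g @ kpt == g @ kpt).
  pose (u' := cast (ap0 1 (app (extract H f)) rloop) : f @ kpt == f @ kpt).
  pose (v' := cast (ap0 1 (app (extract H g)) rloop) : g @ kpt == g @ kpt).
  pose (p := cast (first_extract H f) : u' == u).
  pose (q := cast (first_extract H g) : v' == v).
  refine (cast (A := @Eq 1 (b == b) (cast (ap0 1 (app s) kloop1))
    (cast (ap0 1 (app r) rloop))) _).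
  refine (cc (y := cast (both a u v)) (cast (ap_both a (app f) (app g) kloop1)) (iv _)).
  refine (cc (y := cast (both a u' v'))
    (cast (ap_both a (app (extract H f)) (app (extract H g)) rloop)) _).
  exact (cast (cc (y := both a u v') (ap1 (fun u => both a u v') p)
    (ap1 (fun v => both a u v) q))).
Defined.
Instance : library := derive extract_sum'.
Definition extract_sum := cite extract_sum'.
Arguments extract_sum {X} hX H a f g.

(** [l] and [w] identify [G] with the loops at each point. The component in [G] of a map on [K2] is
    the second loop read through [w]; it is additive by [ll], which relates the identifications at
    [b], [b'] and their sum. *)
Definition iso_product' (G X : typ 1) (hG : HSet G) (add : G ⟶ G ⟶ G)
  (hX : Lev three X) (H : Homogeneous X)
  (a : X ⟶ X ⟶ X) (l : ∏ b : X, G ⟶ b == b) (w : ∏ b : X, b == b ⟶ G)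
  (wl : ∏ b : X, ∏ g : G, w @ b @ (l @ b @ g) == g)
  (lw : ∏ b : X, ∏ u : b == b, l @ b @ (w @ b @ u) == u)
  (ll : ∏ b : X, ∏ b' : X, ∏ g : G, ∏ g' : G,
    both a (l @ b @ g) (l @ b' @ g') == l @ (a @ b @ b') @ (add @ g @ g')) :
  GroupIso 1 (T0 (K2 ⟶ X)) (fun u v => @pointwise K2 X a (mk u) (mk v))
    (Times 1 G (T0 (RP2 ⟶ X)))
    (TimesOp 1 G (fun x y => add $ x $ y)
      (T0 (RP2 ⟶ X)) (fun u v => @pointwise RP2 X a (mk u) (mk v))).
Proof.
  pose (D := T0 (K2 ⟶ X)). pose (R := T0 (RP2 ⟶ X)). pose (E := G × R).
  pose (hE := sig_set (B := fun _ => R) hG (fun _ => T0_set (RP2 ⟶ X)) : HSet E).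
  pose (v := fun f : K2 ⟶ X => cast (ap0 1 (app f) kloop2) : f @ kpt == f @ kpt).
  pose (c := fun f : K2 ⟶ X => w @ (f @ kpt) @ v f).
  pose (F := fun x : D => T0_rec hE (fun f => @pair 1 G (fun _ => R) (c f)
    (tr0 (extract H f))) x).
  pose (B0 := fun (g : G) (z : R) => T0_map (fun f => build H f (l @ (f @ rpt) @ g)) z).
  pose (B := fun t : E => sig_ind 1 (fun _ => D) B0 t).
  pose (opE := fun x y : E => @pair 1 G (fun _ => R)
    (add @ pr1 x @ pr1 y) (pointwise a (pr2 x) (pr2 y))).
  assert (BF : forall x, B (F x) == x).
  { intros x. refine (T0_path (T0_set _) (fun x => B (F x)) (fun x => x) (fun f => _) x).
    refine (cast (ap1 tr0 (cc (x := build H (extract H f) (cast (l @ (f @ kpt) @ c f)))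
      (y := build H (extract H f) (cast (v f))) _ (build_extract H f)))).
    exact (cast (ap1 (fun v => build H (extract H f) (cast v)) (lw @ (f @ kpt) @ v f))). }
  assert (FB : forall t, F (B t) == t).
  { intros t. refine (sig_ind 1 (fun t => F (B t) == t) (fun g z => _) t).
    refine (T0_path hE (fun z => F (B (@pair 1 G (fun _ => R) g z)))
      (fun z => @pair 1 G (fun _ => R) g z) (fun f => _) z).
    pose (u := l @ (f @ rpt) @ g).
    refine (cast (pair_path (x := c (build H f u)) _ (ap1 tr0 (extract_build H f u)))).
    refine (cc (y := w @ (f @ rpt) @ u) _ (wl @ (f @ rpt) @ g)).
    exact (cast (ap1 (app (w @ (f @ rpt))) (second_build H f u))). }
  assert (cs : forall f g : K2 ⟶ X, c (sum a f g) == add @ c f @ c g).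
  { intros f g. pose (b := f @ kpt). pose (b' := g @ kpt). pose (b'' := a @ b @ b').
    refine (cc (y := w @ b'' @ both a (v f) (v g)) _ _).
    { exact (cast (ap1 (app (w @ b'')) (ap_both a (app f) (app g) kloop2))). }
    refine (cc (y := w @ b'' @ (l @ b'' @ (add @ c f @ c g))) _ (wl @ b'' @ _)).
    refine (ap1 (app (w @ b'')) _).
    refine (cc (y := both a (l @ b @ c f) (l @ b' @ c g)) _ (ll @ b @ b' @ c f @ c g)).
    refine (cc (y := both a (l @ b @ c f) (v g)) _ _).
    - exact (ap1 (fun u => both a u (v g)) (lw @ b @ v f)⁻¹).
    - exact (ap1 (fun u => both a (l @ b @ c f) u) (lw @ b' @ v g)⁻¹). }
  assert (FD : forall x y, F (pointwise a x y) == opE (F x) (F y)).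
  { intros x y.
    refine (T0_path hE (fun x => F (pointwise a x y)) (fun x => opE (F x) (F y))
      (fun f => _) x).
    refine (T0_path hE (fun y => F (pointwise a (tr0 f) y)) (fun y => opE (F (tr0 f)) (F y))
      (fun g => _) y).
    exact (cast (pair_path (cs f g) (ap1 tr0 (extract_sum hX H a f g)))). }
  exact (cast (group_iso (fn (fun x => fn (fun y => pointwise a x y)))
    (fn (fun x => fn (fun y => opE x y))) F B BF FB
    (fn (fun x => fn (fun y => cast (FD x y)))))).
Defined.
Instance : library := derive iso_product'.
Definition iso_product := cite iso_product'.
Arguments iso_product {G X} hG add hX H a l w wl lw ll.

Definition CohIsoProd (G : typ 1) (add : G ⟶ G ⟶ G) (n : Nat) (a : exp) : ty :=
  GroupIso 1 (H 1 G add n K2) (Hadd 1 G add n a K2)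
    (Times 1 G (H 1 G add n RP2))
    (TimesOp 1 G (fun x y => add $ x $ y) (H 1 G add n RP2) (Hadd 1 G add n a RP2)).

Definition iso_one' (G : typ 1) (o : G) (add : G ⟶ G ⟶ G)
  (opp : G ⟶ G) (h : AbGroup G o add opp)
  (a : KG add ⟶ KG add ⟶ KG add) (A : El (isAdd1 1 (code G) add a)) :
  CohIsoProd G add one a.
Proof.
  pose (X := KG add). pose (s := units a A).
  pose (lu := lunit s). pose (ru := runit s). pose (ρ := units_agree s).
  pose (c := cast (conn_trunc one (conn_EM add)) : Conn (kpt1 add)).
  pose (V := fun (b : X) (u : b == b) => translate_contr c a lu ru b @ u).
  pose (l := fun (b : X) (g : G) => translate a ru b (kloop add g)).
  pose (w := fun (b : X) (u : b == b) =>
    cast (enc h (pr1 (center (V b u)))) : G).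
  refine (cast (iso_product (X := X) (pr1 (grp h)) add (trunc_level one (BG add))
    (homogeneous c a lu ru) a (fn (fun b => fn (fun g => l b g)))
    (fn (fun b => fn (fun u => w b u))) _ _ _)).
  - refine (cast (fn (fun b : X => fn (fun g : G => (_ : w b (l b g) == g))))).
    (* [kloop add g] lies in the contractible fibre over [l b g], hence equals the centre that [w]
       encodes. *)
    pose (t := @pair 1 (kpt1 add == kpt1 add) (fun v => translate a ru b v == l b g)
      (kloop add g) (rfl (l b g))).
    refine (cc (y := cast (enc h (kloop add g))) _ (enc_kloop h g)).
    exact (cast (ap1 (fun t => cast (B := G) (enc h (pr1 t))) (contract (V b (l b g)) t))).
  - refine (cast (fn (fun b : X => fn (fun u : b == b =>
      (_ : l b (w b u) == u))))).
    pose (t := center (V b u)).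
    exact (cc (y := translate a ru b (pr1 t))
      (ap1 (translate a ru b) (kloop_enc h (pr1 t))) (pr2 t)).
  - refine (cast (fn (fun b : X => fn (fun b' : X => fn (fun g : G =>
      fn (fun g' : G => (_ : both a (l b g) (l b' g') == l (a @ b @ b') (add @ g @ g')))))))).
    refine (cc (y := translate a ru (a @ b @ b') (kloop add g • kloop add g')) _ _).
    + exact (both_translate (trunc_level one (BG add)) c ρ (kloop add g) (kloop add g') b b').
    + exact (ap1 (translate a ru (a @ b @ b')) (kloop_cc g g')).
Defined.
Instance : library := derive iso_one'.
Definition iso_one := cite iso_one'.
Arguments iso_one {G o add opp} h a A.

(** * Case distinction on the degree *)

Definition absurd {A : ty} (x : Empty) : A := mk (C (cEmptyInd 1) $ (λ _, A) $ x).

(** A family inhabited only at 1; transporting its element refutes [n = 1] in the other degrees. *)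
Definition is_one' (n : Nat) : typ 0 :=
  nat_ind 2 (fun _ => U 0) (mk Empty) (fun n _ =>
    nat_ind 2 (fun _ => U 0) (mk (C cUnit)) (fun _ _ => mk Empty) n) n.
Instance : library := define is_one'.
Definition is_one := cite is_one'.

Definition is_one_eq' (n : Nat) (p : n =={0} one) : El (is_one n) :=
  tr (i := 0) (j := 0) (fun n => El (is_one n)) p⁻¹ (mk (C cTt)).
Instance : library := derive is_one_eq'.
Definition is_one_eq := cite is_one_eq'.
Arguments is_one_eq {n} p.

Definition klein_cohomology' (G : typ 1) (o : G) (add : G ⟶ G ⟶ G)
  (opp : G ⟶ G) (h : AbGroup G o add opp) (n : Nat)
  (a : El (K 1 G add n) ⟶ El (K 1 G add n) ⟶ El (K 1 G add n))
  (A : El (isAdd 1 G add n a)) : ((n =={0} one ⟶ Empty) ⟶ CohIso G add n a) ×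
    (n =={0} one ⟶ CohIsoProd G add n a).
Proof.
  pose (M := fun (n : Nat) (a : exp) => ((n =={0} one ⟶ Empty) ⟶ CohIso G add n a) ×
    (n =={0} one ⟶ CohIsoProd G add n a)).
  pose (O := fun n : Nat => El (K 1 G add n) ⟶ El (K 1 G add n) ⟶ El (K 1 G add n)).
  pose (P := fun n => ∏ a : O n, El (isAdd 1 G add n a) ⟶ M n a).
  pose (case := fun n a x y => @pair 1 ((n =={0} one ⟶ Empty) ⟶ CohIso G add n a)
    (fun _ => n =={0} one ⟶ CohIsoProd G add n a) (fn (fun k => x k)) (fn (fun p => y p))).
  refine (nat_ind 1 P _ (fun n _ => nat_ind 1 (fun n => P (nsucc n)) _
    (fun n _ => _) n) n @ a @ A).
  - refine (fn (fun a => fn (fun A => case nzero a (fun _ => _) (fun p => _)))).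
    + exact (iso_zero add (pr1 (grp h)) (cast a)).
    + exact (absurd (cast (is_one_eq p))).
  - refine (fn (fun a => fn (fun A => case one a (fun k => _) (fun _ => _)))).
    + exact (absurd (k @ (rfl_at 0 one))).
    + exact (cast (iso_one h (cast a) (cast A))).
  - refine (fn (fun a => fn (fun A => case (nsucc (nsucc n)) a (fun _ => _) (fun p => _)))).
    + exact (cast (iso_high add n (cast a) (cast A))).
    + exact (absurd (cast (is_one_eq p))).
Defined.

Theorem proposition58 (l : nat) :
  derivable
    (Π G : U l, Π o : G, Π add : G ⇒ G ⇒ G, Π opp : G ⇒ G,
     isAbGroup l G o add opp ⇒
     Π n : Nat, Π a : K l G add n ⇒ K l G add n ⇒ K l G add n,
     isAdd l G add n a ⇒
     Times l
       ((Id 0 Nat n (succ zero) ⇒ Empty) ⇒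
        GroupIso l
          (H l G add n K2) (Hadd l G add n a K2)
          (H l G add n RP2) (Hadd l G add n a RP2))
       (Id 0 Nat n (succ zero) ⇒
        GroupIso l
          (H l G add n K2) (Hadd l G add n a K2)
          (Times l G (H l G add n RP2))
          (TimesOp l G (fun x y => add $ x $ y)
             (H l G add n RP2) (Hadd l G add n a RP2)))).
Proof.
  destruct (close_typed klein_cohomology' l) as (ρ & u & H); [vm_compute; reflexivity|].
  (* The checked statement has level 1 where the theorem has [l]. As [level l 1] computes to [l] and
     [level l 2] to [S l], its interpretation is the theorem judgmentally in Rocq. *)
  exists u. exact H.
Qed.
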